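(* Let $m,n\ge1$, $Q=[0,1]^m$, and let $M_\varphi>0$, $M_A>0$, $p\ge 2$ be integers. For symmetric real $n\times n$-matrices $A,B_1,\dots,B_m$ with $A>0$, let $n_A$ be the cardinality of the spectrum of $A$ and let $n_i$ be the cardinality of the spectrum of the matrix pencil $\lambda A-B_i$ (the number of distinct roots of $\det(\lambda A-B_i)$), $i=1,\dots,m$. Consider the Cauchy problem $$A\frac{\partial\mathbf u}{\partial t}+\sum_{i=1}^m B_i\frac{\partial\mathbf u}{\partial x_i}=0,\quad t\ge 0,\qquad \mathbf u|_{t=0}=\varphi(x_1,\dots,x_m),\quad x\in Q .$$ Then the operator $$(A,B_1,\dots,B_m,n_A,n_1,\dots,n_m,\varphi)\mapsto\mathbf u$$ sending - any sequence $A,B_1,\dots,B_m$ of symmetric real $n\times n$-matrices with $A>0$ such that the matrix pencils $\lambda A-B_i$ have no zero eigenvalues and $$\|A\|_2,\ \|A^{-1}\|_2,\ \|B_i\|_2\le M_A,\qquad \lambda^{(i)}_{\min}<0<\lambda^{(i)}_{\max},\qquad i=1,\dots,m,$$ - the sequence $n_A,n_1,\dots,n_m$ of the corresponding cardinalities, and - any $\varphi\in C^{p+1}(Q,\mathbb R^n)$ satisfying $\big\|\frac{\partial\varphi}{\partial x_i}\big\|_s\le M_\varphi$ and $\big\|\frac{\partial^2\varphi}{\partial x_i\partial x_j}\big\|_s\le M_\varphi$ for $i,j=1,\dots,m$, to the unique solution $\mathbf u\in C^p(H,\mathbb R^n)$ of the Cauchy problem, is a computable partial function from the space $S_+\times S^m\times\mathbb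 N^{m+1}\times C_s(Q,\mathbb R^n)$ to $C_{sL_2}(H,\mathbb R^n)$.
   Context: $\lambda^{(i)}_{\min},\lambda^{(i)}_{\max}$ are the minimal and maximal eigenvalues of the matrix pencil $\lambda A-B_i$, i.e. the minimal and maximal roots of $\det(\lambda A-B_i)$ (all roots are real). $\|\cdot\|_2$ is the matrix norm induced by the Euclidean vector norm (so $\|A\|_2=\lambda_{\max}(A)$, $\|A^{-1}\|_2=1/\lambda_{\min}(A)$). $H\subseteq\mathbb R^{m+1}$ is the domain of correctness of the Cauchy problem, i.e. the maximal set such that for any $p\ge2$ and $\varphi\in C^{p+1}(Q,\mathbb R^n)$ there is a unique solution $\mathbf u\in C^p(H,\mathbb R^n)$; it depends only on $A,B_1,\dots,B_m$ and is known to be the intersection of the half-spaces $t\ge0$, $x_i-\lambda^{(i)}_{\max}t\ge0$, $x_i-1-\lambda^{(i)}_{\min}t\le0$ ($i=1,\dots,m$). Under the condition $\lambda^{(i)}_{\min}<0<\lambda^{(i)}_{\max}$ it is a compact convex polyhedron in $Q\times[0,\infty)$. Norms and spaces: $\|\varphi\|_s=\sup_{x\in Q}|\varphi(x)|$ with $|\cdot|$ Euclidean; on $H$, $\|u\|_{sL_2}=\sup_{t_0}\sqrt{\int_{H\cap\{t=t_0\}}|u(x,t_0)|^2dx}$. $C_s(Q,\mathbb R^n)$ is the space of continuous functions $Q\to\mathbb R^n$ with the sup-norm, $C_{sL_2}(H,\mathbb R^n)$ the continuous functions $H\to\mathbb R^n$ with the $sL_2$-norm. $S\subseteq\mathbb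 R^{n\times n}$ is the space of symmetric real matrices and $S_+$ the space of symmetric positive definite real matrices, with the Euclidean norm. Computability (TTE): A sequence $\{x_k\}$ in a metric space $(M,d)$ is fast Cauchy if $d(x_i,x_k)<2^{-k}$ for all $k$ and $i>k$. Given a numbering $\nu:\mathbb N\to M$ of a dense subset, a Cauchy name of $x\in M$ is a $q\in\mathbb N^{\mathbb N}$ such that $\{\nu(q(k))\}_k$ is fast Cauchy and converges to $x$. A partial function is computable if there is a computable partial function on Baire space $\mathbb N^{\mathbb N}$ (a Type-2 machine) which transforms any names of an argument in the domain of the function into a name of its value. The numberings used: for $S$ and $S_+$, matrices in these sets with rational entries; $\mathbb N$ carries its discrete structure; for $C_s(Q,\mathbb R^n)$, the natural numbering of all multilinear interpolations of grid functions $G_N\to\mathbb Q^n$, $N\ge0$, where $G_N=\{(y_1/2^N,\dots,y_m/2^N): y_i\in\{0,\dots,2^N\}\}$ and the multilinear interpolation is the continuous extension that on each grid cell is affine in each coordinate separately; for $C_{sL_2}(H,\mathbb R^n)$, the natural numbering of restrictions to $H$ of multilinear interpolations of $\mathbb Q^n$-valued functions on space-time grids $G_N\times\{0,\tau,\dots,L\tau\}$, with rational $\tau>0$ and $L\ge1$, $H\subseteq Q\times[0,L\tau]$ (a name of $\mathbf u$ is a name of such a sequence, fast Cauchy in the $sL_2$-norm on $H$ and converging to $\mathbf u$).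
   Formalization: The operator is taken on those admissible data for which a solution in C^p(H) exists (uniqueness is proved, existence is not claimed), with H the stated intersection of half-spaces; for large m, e.g. m=5, some φ in C^{p+1} have no solution in C^p(H). *)

(* Defs.v *)
From HB Require Import structures.
From mathcomp Require Import all_boot all_order all_algebra.
From mathcomp Require Import all_classical all_reals all_analysis.

Set Implicit Arguments.
Unset Strict Implicit.
Unset Printing Implicit Defensive.

Import Order.TTheory GRing.Theory Num.Theory.
Import numFieldNormedType.Exports.

Local Open Scope classical_set_scope.
Local Open Scope ring_scope.

(* Type-2 machines are modelled by the Kleene partial recursive functions with
   an oracle: on input a point o of Baire space, the output is the point r such
   that the program with oracle o sends k to r k. *)
Inductive program : Type :=
| Zero
| Succ
| Proj of nat
| Oracle
| Comp of program & seq program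
| PrimRec of program & program
| Mu of program.

(* denote o e xs z: the program e with oracle o halts on xs with value z. *)
Fixpoint denote (o : nat -> nat) (e : program) (xs : seq nat) (z : nat)
    {struct e} : Prop :=
  match e with
  | Zero => z = 0%N
  | Succ => z = (nth 0%N xs 0).+1
  | Proj i => z = nth 0%N xs i
  | Oracle => z = o (nth 0%N xs 0)
  | Comp f gs => exists ys : seq nat,
      (fix denotes (gs : seq program) (ys : seq nat) {struct gs} : Prop :=
         match gs, ys with
         | [::], [::] => True
         | g :: gs', y :: ys' => denote o g xs y /\ denotes gs' ys'
         | _, _ => False
         end) gs ys
      /\ denote o f ys z
  | PrimRec f g =>
      if xs is k :: xs' then
        exists w : nat -> nat,
          [/\ denote o f xs' (w 0%N),
              forall j, (j < k)%N -> denote o g (j :: w j :: xs') (w j.+1)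
            & z = w k]
      else False
  | Mu f => denote o f (z :: xs) 0%N /\
      forall j, (j < z)%N -> exists w, denote o f (j :: xs) w.+1
  end.

Definition transforms (e : program) (o r : nat -> nat) : Prop :=
  forall k, denote o e [:: k] (r k).

(* delta q x: the point q of Baire space is a name of x. *)
Definition representation (T : Type) := (nat -> nat) -> T -> Prop.

Definition prod_rep T1 T2 (d1 : representation T1) (d2 : representation T2) :
    representation (T1 * T2) :=
  fun q x => d1 (fun k => q k.*2) x.1 /\ d2 (fun k => q k.*2.+1) x.2.

Definition pow_rep r T (d : representation T) : representation ('I_r -> T) :=
  fun q x => forall i : 'I_r, d (fun k => q (k * r + i)%N) (x i).

(* The representation of the target may depend on the argument, because the
   space in which the value lives does. *)
Definition computable_operator X Y (dX : representation X)
    (dY : X -> representation Y) (graph : X -> Y -> Prop) : Prop :=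
  exists e : program, forall x y, graph x y -> forall q, dX q x ->
    exists2 r, transforms e q r & dY x r y.

Section CauchyNames.
Context {R : realType} {T : Type}.

(* nu c y: the number c denotes the point y; numbers denoting no point of M do
   not occur in names. *)
Definition cauchy_rep (M : set T) (d : T -> T -> \bar R)
    (nu : nat -> T -> Prop) : representation T :=
  fun q x => M x /\ exists s : nat -> T,
    [/\ forall k, M (s k) /\ nu (q k) (s k),
        forall k i, (k < i)%N -> (d (s i) (s k) < (2 ^- k)%:E)%E
      & d (s k) x @[k --> \oo] --> 0%E].

End CauchyNames.

(* CodeSeq.decode is a computable bijection from nat to seq nat. *)
Definition rat_of_code (c : nat) : rat :=
  let s := CodeSeq.decode c in
  ((nth 0%N s 0)%:R - (nth 0%N s 1)%:R) / (nth 0%N s 2).+1%:R.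

Definition mx_of_code (R : realType) (n : nat) (c : nat) : 'M[R]_n :=
  \matrix_(i < n, j < n)
    ratr (rat_of_code (nth 0%N (CodeSeq.decode c) (i * n + j)%N)).

(* Position of the node y in the grid {0..K 0} x ... x {0..K (d-1)}. *)
Definition node_index d (K y : 'I_d -> nat) : nat :=
  (\sum_(i < d) y i * \prod_(j < d | j < i) (K j).+1)%N.

Definition grid_fun_of_codes (R : realType) d n (K : 'I_d -> nat) (s : seq nat)
    (y : 'I_d -> nat) : 'cV[R]_n :=
  \col_(j < n) ratr (rat_of_code (nth 0%N s (node_index K y * n + j)%N)).

Section Grids.
Context {R : realType} {d n : nat}.

Definition grid_box (h : 'I_d -> R) (K : 'I_d -> nat) : set 'rV[R]_d :=
  [set x | forall i, 0 <= x ord0 i <= (K i)%:R * h i].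

Definition grid_cell (h : 'I_d -> R) (c : 'I_d -> nat) : set 'rV[R]_d :=
  [set x | forall i, (c i)%:R * h i <= x ord0 i <= (c i).+1%:R * h i].

(* f is continuous on the box, takes the values of g at the nodes and is, on
   each cell, affine in each coordinate separately. *)
Definition multilinear_interpolation (h : 'I_d -> R) (K : 'I_d -> nat)
    (g : ('I_d -> nat) -> 'cV[R]_n) (f : 'rV[R]_d -> 'cV[R]_n) : Prop :=
  [/\ {within grid_box h K, continuous f},
      forall y : 'I_d -> nat, (forall i, (y i <= K i)%N) ->
        f (\row_i ((y i)%:R * h i)) = g y
    & forall (c : 'I_d -> nat), (forall i, (c i < K i)%N) ->
        forall (x x' : 'rV[R]_d) (i : 'I_d),
        grid_cell h c x -> grid_cell h c x' ->
        (forall j, j != i -> x ord0 j = x' ord0 j) ->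
        forall a : R, 0 <= a <= 1 ->
        f (a *: x + (1 - a) *: x') = a *: f x + (1 - a) *: f x'].

End Grids.

Section Norms.
Context {R : realType}.

(* The library norm on matrices is the max norm. *)
Definition enorm p q (M : 'M[R]_(p, q)) : R :=
  Num.sqrt (\sum_i \sum_j M i j ^+ 2).

Definition norm2 n (M : 'M[R]_n) : R :=
  sup [set enorm (M *m v) | v in [set v : 'cV[R]_n | enorm v <= 1]].

Definition s_norm d n (K : set 'rV[R]_d) (f : 'rV[R]_d -> 'cV[R]_n) : \bar R :=
  ereal_sup [set (enorm (f x))%:E | x in K].

(* Lebesgue integral over R^d of a nonnegative measurable function, as an
   iterated integral (Tonelli). *)
Fixpoint integral_Rd d : ('rV[R]_d -> \bar R) -> \bar R :=
  match d with
  | 0 => fun f => f 0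
  | d'.+1 => fun f =>
      (\int[@lebesgue_measure R]_(x in [set: R])
         integral_Rd (fun v : 'rV[R]_d' => f (row_mx (x%:M : 'rV[R]_1) v)))%E
  end.

(* The point of space-time with position x at time t. *)
Definition st_point m (x : 'rV[R]_m) (t : R) : 'rV[R]_(m + 1) :=
  row_mx x (t%:M : 'rV[R]_1).

Definition space m (i : 'I_m) : 'I_(m + 1) := lshift 1 i.
Definition time m : 'I_(m + 1) := rshift m ord0.

Definition sL2_norm m n (H : set 'rV[R]_(m + 1))
    (u : 'rV[R]_(m + 1) -> 'cV[R]_n) : \bar R :=
  ereal_sup [set sqrte (integral_Rd (fun x =>
      (\1_H (st_point x t) * enorm (u (st_point x t)) ^+ 2)%:E)) | t in [set: R]].

End Norms.
Arguments time m : clear implicits.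

Section Spaces.
Context {R : realType}.

Definition sym_mx n : set 'M[R]_n := [set M | M^T = M].

Definition posdef_mx n : set 'M[R]_n :=
  [set M | M^T = M /\
     forall v : 'cV[R]_n, v != 0 -> 0 < (v^T *m M *m v) ord0 ord0].

Definition mx_rep n (M : set 'M[R]_n) : representation 'M[R]_n :=
  cauchy_rep M (fun X Y => (enorm (X - Y))%:E) (fun c X => X = mx_of_code R n c).

Definition nat_rep : representation nat :=
  cauchy_rep [set: nat] (fun a b => ((a != b)%:R : R)%:E) (fun c a => a = c).

Definition unit_cube m : set 'rV[R]_m := [set x | forall i, 0 <= x ord0 i <= 1].

(* The code of an interpolation on G_N is N followed by the codes of its
   values at the nodes. *)
Definition cube_numbering m n (c : nat) (f : 'rV[R]_m -> 'cV[R]_n) : Prop :=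
  let s := CodeSeq.decode c in
  let N := nth 0%N s 0 in
  let K := fun _ : 'I_m => (2 ^ N)%N in
  multilinear_interpolation (fun=> 2 ^- N) K
    (grid_fun_of_codes R n K (drop 1 s)) f.

Definition Cs_rep m n : representation ('rV[R]_m -> 'cV[R]_n) :=
  cauchy_rep
    [set f : 'rV[R]_m -> 'cV[R]_n | {within @unit_cube m, continuous f}]
    (fun f g : 'rV[R]_m -> 'cV[R]_n =>
       s_norm (@unit_cube m) (fun x => f x - g x)) (@cube_numbering m n).

(* The code consists of N, a code of tau, L and the codes of the values. *)
Definition space_time_numbering m n (H : set 'rV[R]_(m + 1)) (c : nat)
    (w : 'rV[R]_(m + 1) -> 'cV[R]_n) : Prop :=
  let s := CodeSeq.decode c in
  let N := nth 0%N s 0 in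
  let tau : rat := rat_of_code (nth 0%N s 1) in
  let L := nth 0%N s 2 in
  let h (k : 'I_(m + 1)) : R := if (k < m)%N then 2 ^- N else ratr tau in
  let K (k : 'I_(m + 1)) : nat := if (k < m)%N then (2 ^ N)%N else L in
  [/\ 0 < tau, (1 <= L)%N, H `<=` grid_box h K
    & multilinear_interpolation h K (grid_fun_of_codes R n K (drop 3 s)) w].

(* Only the values on H matter. *)
Definition CsL2_rep m n (H : set 'rV[R]_(m + 1)) :
    representation ('rV[R]_(m + 1) -> 'cV[R]_n) :=
  cauchy_rep
    [set u : 'rV[R]_(m + 1) -> 'cV[R]_n | {within H, continuous u}]
    (fun u v : 'rV[R]_(m + 1) -> 'cV[R]_n =>
       sL2_norm H (fun y => u y - v y)) (@space_time_numbering m n H).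

End Spaces.

Section Smoothness.
Context {R : realType} {d n : nat}.
Implicit Types (K : set 'rV[R]_d) (f g : 'rV[R]_d -> 'cV[R]_n).

(* g is the continuous extension to K of the partial derivative of f along the
   i-th coordinate in the interior of K. *)
Definition is_partial K (i : 'I_d) f g : Prop :=
  {within K, continuous g} /\
  forall x, interior K x -> is_derive x (delta_mx ord0 i : 'rV[R]_d) f (g x).

Fixpoint Ck (k : nat) K f : Prop :=
  {within K, continuous f} /\
  if k is k'.+1 then forall i, exists g, is_partial K i f g /\ Ck k' K g
  else True.

End Smoothness.

Section Cauchy.
Context {R : realType} {m n : nat}.
Implicit Types (A M : 'M[R]_n) (B : 'I_m -> 'M[R]_n).

Definition spectrum M : set R := [set l | eigenvalue M l].

Definition pencil_spectrum A M : set R := [set l | \det (l *: A - M) = 0].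

(* These are attained: for A > 0 the spectrum is finite and nonempty. *)
Definition lambda_min A M : R := inf (pencil_spectrum A M).
Definition lambda_max A M : R := sup (pencil_spectrum A M).

(* The domain of correctness H, as the polyhedron bounded by t = 0 and the
   characteristic planes issuing from the faces of the cube. *)
Definition correctness_domain A B : set 'rV[R]_(m + 1) :=
  [set y | 0 <= y ord0 (time m) /\
     forall i : 'I_m,
       0 <= y ord0 (space i) - lambda_max A (B i) * y ord0 (time m) /\
       y ord0 (space i) - 1 - lambda_min A (B i) * y ord0 (time m) <= 0].

Definition solves_cauchy_problem A B (phi : 'rV[R]_m -> 'cV[R]_n)
    (u : 'rV[R]_(m + 1) -> 'cV[R]_n) : Prop :=
  let H := correctness_domain A B in
  (exists (ut : 'rV[R]_(m + 1) -> 'cV[R]_n)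
          (ux : 'I_m -> 'rV[R]_(m + 1) -> 'cV[R]_n),
     [/\ is_partial H (time m) u ut,
         forall i, is_partial H (space i) u (ux i)
       & forall y, H y -> A *m ut y + \sum_i B i *m ux i y = 0]) /\
  (forall x, unit_cube x -> u (st_point x 0) = phi x).

(* (A, (B_1, ..., B_m), (n_A, n_1, ..., n_m), phi) *)
Definition cauchy_data : Type :=
  'M[R]_n * ('I_m -> 'M[R]_n) * ('I_m.+1 -> nat) * ('rV[R]_m -> 'cV[R]_n).

Definition cauchy_data_rep : representation cauchy_data :=
  prod_rep
    (prod_rep
       (prod_rep (mx_rep (@posdef_mx R n)) (pow_rep (mx_rep (@sym_mx R n))))
       (pow_rep (@nat_rep R)))
    (@Cs_rep R m n).

Definition data_domain (D : cauchy_data) : set 'rV[R]_(m + 1) :=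
  correctness_domain D.1.1.1 D.1.1.2.

Definition admissible (Mphi MA p : nat) (D : cauchy_data) : Prop :=
  let: (A, B, N, phi) := D in
  [/\ [/\ posdef_mx A, norm2 A <= MA%:R & norm2 (invmx A) <= MA%:R],
      forall i, [/\ sym_mx (B i), norm2 (B i) <= MA%:R,
                    ~ pencil_spectrum A (B i) 0
                  & lambda_min A (B i) < 0 < lambda_max A (B i)],
      (spectrum A #= `I_(N ord0))%card /\
      forall i, (pencil_spectrum A (B i) #= `I_(N (lift ord0 i)))%card,
      Ck p.+1 (@unit_cube R m) phi
    & forall i g, is_partial (@unit_cube R m) i phi g ->
        (s_norm (@unit_cube R m) g <= (Mphi%:R)%:E)%E /\
        forall j h, is_partial (@unit_cube R m) j g h ->
          (s_norm (@unit_cube R m) h <= (Mphi%:R)%:E)%E].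

(* Graph of a partial operator: u is only determined on the domain H of D. *)
Definition solution_operator (Mphi MA p : nat) (D : cauchy_data)
    (u : 'rV[R]_(m + 1) -> 'cV[R]_n) : Prop :=
  [/\ admissible Mphi MA p D,
      Ck p (data_domain D) u
    & solves_cauchy_problem D.1.1.1 D.1.1.2 D.2 u].

End Cauchy.
Arguments cauchy_data : clear implicits.
Arguments cauchy_data_rep : clear implicits.

(* Main.v *)
(* The discrete solution is not computed by a difference scheme but searched
   for.  A certificate is a rational grid function w on a space-time grid of
   mesh 2^-N, together with rational lower bounds for the lambda_max and upper
   bounds for the lambda_min of the pencils, the latter being proved by Rayleigh
   quotients.  It is accepted when, on all edges of the grid that meet a
   neighbourhood of H, the difference quotients of w satisfy the equation up to
   e and vary by at most e between neighbouring cells, and when w is close to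
   phi at t = 0.  These are finitely many rational inequalities.

   Soundness: writing B_i = lambda_max P_i + lambda_min N_i with P_i + N_i = A
   and P_i, N_i semidefinite, one obtains a scheme on lattices that move with
   the leftmost characteristics and whose steps are A^-1-averages, hence, by
   Jensen's inequality for P_i and N_i, contractions for the energy norm.  Both
   the interpolation of w and the solution are almost solutions of this scheme
   on all fine enough lattices, so their difference stays small in L2 on every
   slice of H.  The same estimate gives uniqueness.

   Completeness: for theta < 1 close to 1, u (y0 + theta (y - y0)), with y0 an
   interior point of H, is a classical solution on a neighbourhood of H, and
   rational approximations of its values at the nodes of a fine grid pass the
   test.  Since the existence of u is a hypothesis, no existence theory and no
   eigenvectors are needed. *)

Require Import Defs.
From mathcomp Require Import all_boot all_order all_algebra.
From mathcomp Require Import all_classical all_reals all_analysis.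
From mathcomp Require Import measurable_realfun zify ring lra.

Set Implicit Arguments.
Unset Strict Implicit.
Unset Printing Implicit Defensive.

Import Order.TTheory GRing.Theory Num.Theory.
Import numFieldNormedType.Exports.

Local Notation space := Defs.space.

(** * Programs with an oracle *)

(** A search is possible because every constant of the error estimate depends only on m, n and [MA]:
    a certificate that passes at tolerance 2^-(k + Kc) is accurate to 2^-k, with one [Kc] for all
    data, so no modulus of continuity of the derivatives of u has to be known in advance.
    Eigenvalues are never computed. One vector confirms a strict lower bound for lambda_max or a
    strict upper bound for lambda_min, and such bounds suffice because they enlarge the polyhedron
    on which the inequalities are tested. The slices of H shrink in time, so a lattice that loses
    one layer per step never asks for values outside H. Directions are treated one after the other,
    so each partial step involves a single B_i. The derivatives of u exist in the interior of H and
    merely extend continuously to H; a dilation brings difference quotients taken up to the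
    boundary, or slightly beyond it, under the mean value theorem. Approximate solutions are
    described by difference quotients because interpolants have kinks. *)

Definition cfun T := (nat -> nat) -> seq nat -> T.

(** The arity [D] is fixed because the recursion schemes rebuild the argument list from projections,
    which requires its length. *)
Definition cmp D (f : cfun nat) : Prop :=
  exists e, forall o xs, size xs = D -> denote o e xs (f o xs).

Definition cmpb D (P : cfun bool) : Prop := cmp D (fun o xs => P o xs : nat).

Lemma cmp_ext D f g :
  (forall o xs, size xs = D -> f o xs = g o xs) -> cmp D f -> cmp D g.
Proof. by move=> fg [e he]; exists e => o xs sx; rewrite -fg //; exact: he. Qed.

Lemma cmp_proj D i : cmp D (fun o xs => nth 0 xs i).
Proof. by exists (Proj i). Qed.

Lemma cmp_comp D (fs : seq (cfun nat)) f : cmp (size fs) f ->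
  foldr (fun g P => cmp D g /\ P) True fs ->
  cmp D (fun o xs => f o [seq g o xs | g <- fs]).
Proof.
move=> [e he] hfs.
suff [gs hgs] : exists gs, forall o xs, size xs = D ->
    (fix denotes (gs : seq program) (ys : seq nat) {struct gs} : Prop :=
         match gs, ys with
         | [::], [::] => True
         | g :: gs', y :: ys' => denote o g xs y /\ denotes gs' ys'
         | _, _ => False
         end) gs [seq g o xs | g <- fs].
  exists (Comp e gs) => o xs sx; exists [seq g o xs | g <- fs].
  by split; [exact: hgs|apply: he; rewrite size_map].
elim: fs hfs {he} => [|g fs IH] /=; first by exists [::].
move=> [[e' he'] /IH [gs hgs]]; exists (e' :: gs) => o xs sx; split.
  exact: he'.
exact: hgs.
Qed.

Lemma cmp_proj_list D (ns : seq nat) :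
  foldr (fun g P => cmp D g /\ P) True [seq (fun _ xs => nth 0 xs i) | i <- ns].
Proof. by elim: ns => //= i ns IH; split=> //; exact: cmp_proj. Qed.

Lemma cmp1 D F g : cmp 1 (fun o xs => F o (nth 0 xs 0)) -> cmp D g ->
  cmp D (fun o xs => F o (g o xs)).
Proof. by move=> hF hg; apply: (cmp_comp (fs := [:: g]) hF). Qed.

Lemma cmp2 D F f g : cmp 2 (fun o xs => F (nth 0 xs 0) (nth 0 xs 1)) ->
  cmp D f -> cmp D g -> cmp D (fun o xs => F (f o xs) (g o xs)).
Proof. by move=> hF hf hg; apply: (cmp_comp (fs := [:: f; g]) hF). Qed.

Lemma cmp_succ D f : cmp D f -> cmp D (fun o xs => (f o xs).+1).
Proof. by move=> hf; apply: (@cmp1 D (fun _ => S)) => //; exists Succ. Qed.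

Lemma cmp_oracle D f : cmp D f -> cmp D (fun o xs => o (f o xs)).
Proof. by move=> hf; apply: (@cmp1 D (fun o => o)) => //; exists Oracle. Qed.

Lemma cmp_const D c : cmp D (fun _ _ => c).
Proof. by elim: c => [|c IH]; [exists Zero|exact: cmp_succ]. Qed.

Fixpoint nrec (a : nat) (g : nat -> nat -> nat) k :=
  if k is k'.+1 then g k' (nrec a g k') else a.

Lemma map_nth_iota (xs : seq nat) d : drop d xs =
  [seq nth 0 xs i | i <- iota d (size xs - d)].
Proof.
apply: (@eq_from_nth _ 0); first by rewrite size_drop size_map size_iota.
move=> i; rewrite size_drop => hi.
by rewrite nth_drop (nth_map 0) ?size_iota // nth_iota.
Qed.

(** [PrimRec] recurses on its first argument, whereas here the number of steps is computed from the
    arguments. The recursion is built with the counter as an additional first argument and then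
    composed with [n] and all projections. *)
Lemma cmp_rec D n a g : cmp D n -> cmp D a -> cmp D.+2 g ->
  cmp D (fun o xs => nrec (a o xs) (fun j w => g o (j :: w :: xs)) (n o xs)).
Proof.
move=> hn [ea ha] [eg hg].
have h : cmp D.+1 (fun o ys => nrec (a o (behead ys))
   (fun j w => g o (j :: w :: behead ys)) (nth 0 ys 0)).
  exists (PrimRec ea eg) => o [|k xs] //= [sx].
  exists (fun j => nrec (a o xs) (fun j w => g o (j :: w :: xs)) j).
  split=> //=; first exact: ha.
  by move=> j _; apply: hg; rewrite /= sx.
pose fs : seq (cfun nat) := n :: [seq (fun _ xs => nth 0 xs i) | i <- iota 0 D].
have sfs : size fs = D.+1 by rewrite /= size_map size_iota.
rewrite -sfs in h.
have /(_ _)/wrap [|] := @cmp_comp D fs _ h.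
  by split=> //; exact: cmp_proj_list.
apply: cmp_ext => o xs sx /=.
rewrite -map_comp (_ : map _ _ = xs) //.
by rewrite -[RHS]drop0 map_nth_iota subn0 sx.
Qed.

(** The body of a recursion receives counter, accumulator and parameters; the summand of a bounded
    sum must ignore the accumulator, which is removed here. *)
Lemma cmp_lift D f : cmp D.+1 f ->
  cmp D.+2 (fun o xs => f o (nth 0 xs 0 :: drop 2 xs)).
Proof.
move=> h.
pose fs : seq (cfun nat) :=
  (fun _ xs => nth 0 xs 0) :: [seq (fun _ xs => nth 0 xs i) | i <- iota 2 D].
have sfs : size fs = D.+1 by rewrite /= size_map size_iota.
rewrite -sfs in h.
have /(_ _)/wrap [|] := @cmp_comp D.+2 fs _ h.
  by split; [exact: cmp_proj|exact: cmp_proj_list].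
apply: cmp_ext => o xs sx /=.
rewrite -map_comp map_nth_iota sx.
by have -> : D.+2 - 2 = D by lia.
Qed.

Lemma cmp_add D f g : cmp D f -> cmp D g -> cmp D (fun o xs => f o xs + g o xs).
Proof.
apply: cmp2.
have := @cmp_rec 2 _ _ _ (@cmp_proj 2 0) (@cmp_proj 2 1)
  (cmp_succ (@cmp_proj 4 1)).
apply: cmp_ext => o xs _ /=.
by elim: (nth 0 xs 0) => //= k ->.
Qed.

Lemma cmp_mul D f g : cmp D f -> cmp D g -> cmp D (fun o xs => f o xs * g o xs).
Proof.
apply: cmp2.
have := @cmp_rec 2 _ _ _ (@cmp_proj 2 0) (@cmp_const 2 0)
  (cmp_add (@cmp_proj 4 1) (@cmp_proj 4 3)).
apply: cmp_ext => o xs _ /=.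
by elim: (nth 0 xs 0) => //= k ->; rewrite mulSn addnC.
Qed.

Lemma cmp_pred D f : cmp D f -> cmp D (fun o xs => (f o xs).-1).
Proof.
apply: (@cmp1 D (fun _ => predn)).
have := @cmp_rec 1 _ _ _ (@cmp_proj 1 0) (@cmp_const 1 0) (@cmp_proj 3 0).
by apply: cmp_ext => o xs _ /=; case: (nth 0 xs 0).
Qed.

Lemma cmp_sub D f g : cmp D f -> cmp D g -> cmp D (fun o xs => f o xs - g o xs).
Proof.
apply: cmp2.
have := @cmp_rec 2 _ _ _ (@cmp_proj 2 1) (@cmp_proj 2 0)
  (cmp_pred (@cmp_proj 4 1)).
apply: cmp_ext => o xs _ /=.
by elim: (nth 0 xs 1) => //= [|k ->]; rewrite ?subn0 ?subnS.
Qed.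

Lemma cmp_exp2 D f : cmp D f -> cmp D (fun o xs => 2 ^ f o xs).
Proof.
apply: (@cmp1 D (fun _ n => 2 ^ n)).
have := @cmp_rec 1 _ _ _ (@cmp_proj 1 0) (@cmp_const 1 1)
  (cmp_mul (@cmp_const 3 2) (@cmp_proj 3 1)).
apply: cmp_ext => o xs _ /=.
by elim: (nth 0 xs 0) => //= k ->; rewrite expnS.
Qed.

Lemma cmp_sum D n F : cmp D n -> cmp D.+1 F ->
  cmp D (fun o xs => \sum_(i < n o xs) F o (val i :: xs)).
Proof.
move=> hn hF.
have := @cmp_rec D _ _ _ hn (@cmp_const D 0)
   (cmp_add (@cmp_proj D.+2 1) (cmp_lift hF)).
apply: cmp_ext => o xs _ /=; rewrite drop0.
by elim: (n o xs) => [|k IH] /=; rewrite ?big_ord0 // big_ord_recr /= IH.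
Qed.

Lemma cmpb_eq0 D f : cmp D f -> cmpb D (fun o xs => f o xs == 0).
Proof.
move=> hf; have := cmp_sub (@cmp_const D 1) hf.
by apply: cmp_ext => o xs _; case: (f o xs).
Qed.

Lemma cmpb_not D P : cmpb D P -> cmpb D (fun o xs => ~~ P o xs).
Proof.
move=> /cmpb_eq0; apply: cmp_ext => o xs _; by case: (P o xs).
Qed.

Lemma cmpb_le D f g : cmp D f -> cmp D g -> cmpb D (fun o xs => f o xs <= g o xs).
Proof. by move=> hf hg; apply: cmpb_eq0; exact: cmp_sub. Qed.

Lemma cmpb_and D P Q : cmpb D P -> cmpb D Q -> cmpb D (fun o xs => P o xs && Q o xs).
Proof.
move=> hP hQ; have := cmp_mul hP hQ.
by apply: cmp_ext => o xs _; rewrite mulnb.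
Qed.

Lemma cmpb_imp D P Q : cmpb D P -> cmpb D Q -> cmpb D (fun o xs => P o xs ==> Q o xs).
Proof.
move=> hP hQ; have := cmpb_not (cmpb_and hP (cmpb_not hQ)).
by apply: cmp_ext => o xs _; rewrite negb_and negbK implybE.
Qed.

Lemma cmpb_eq D f g : cmp D f -> cmp D g -> cmpb D (fun o xs => f o xs == g o xs).
Proof.
move=> hf hg; have := cmpb_and (cmpb_le hf hg) (cmpb_le hg hf).
by apply: cmp_ext => o xs _; rewrite eqn_leq.
Qed.

Lemma cmpb_forall D (I : finType) (P : I -> cfun bool) :
  (forall i, cmpb D (P i)) -> cmpb D (fun o xs => [forall i, P i o xs]).
Proof.
move=> hP.
suff : forall s : seq I, cmpb D (fun o xs => all (fun i => P i o xs) s).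
  move=> /(_ (enum I)); apply: cmp_ext => o xs _; congr nat_of_bool.
  apply/allP/forallP => h i; first by apply: h; rewrite mem_enum.
  by move=> _; exact: h.
elim=> [|i s IH]; first exact: cmp_const.
exact: cmpb_and.
Qed.

Lemma cmpb_all D n P : cmp D n -> cmpb D.+1 P ->
  cmpb D (fun o xs => all (fun i => P o (i :: xs)) (iota 0 (n o xs))).
Proof.
move=> hn hP; have := cmpb_eq0 (cmp_sum hn (cmpb_not hP)).
apply: cmp_ext => o xs _; congr nat_of_bool.
rewrite sum_nat_eq0; apply/forallP/allP => [h i|h i].
  rewrite mem_iota add0n => hi.
  by have := h (Ordinal hi); rewrite /= eqb0 negbK.
by rewrite /= eqb0 negbK; apply: h; rewrite mem_iota add0n /= ltn_ord.
Qed.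

(** The outermost quantifier binds the last entry. Since [(ys ++ [:: i]) ++ xs] equals
    [ys ++ i :: xs], the inner quantifiers then have the parameters [i :: xs], which is the
    induction of [cmpb_allv]. *)
Fixpoint allv d S (P : seq nat -> bool) : bool :=
  if d is d'.+1 then
    all (fun i => allv d' S (fun ys => P (ys ++ [:: i]))) (iota 0 S)
  else P [::].

Lemma allvP d S (P : seq nat -> bool) : reflect
  (forall y : 'I_d -> nat, (forall i, y i < S) -> P [seq y i | i <- enum 'I_d])
  (allv d S P).
Proof.
have H : reflect (forall ys, size ys = d -> all (fun y => y < S) ys -> P ys)
    (allv d S P).
  elim: d P => [|d IH] P /=.
    apply: (iffP idP) => [h ys /size0nil -> //|h]; exact: (h [::]).
  apply: (iffP allP) => [h ys sys|h i].
    case/lastP: ys sys => // ys i; rewrite size_rcons => -[sys].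
    rewrite all_rcons => /andP[hi hys].
    have /h /IH : i \in iota 0 S by rewrite mem_iota.
    by move/(_ _ sys hys); rewrite cats1.
  rewrite mem_iota => /= hi; apply/IH => ys sys hys; apply: h.
    by rewrite size_cat /= sys addn1.
  by rewrite all_cat hys /= hi.
apply: (iffP H) => [h y hy|h ys sys hys].
  apply: h; first by rewrite size_map size_enum_ord.
  by apply/allP => _ /mapP[i _ ->]; exact: hy.
have -> : ys = [seq nth 0 ys (val i) | i <- enum 'I_d].
  apply: (@eq_from_nth _ 0); first by rewrite size_map size_enum_ord.
  move=> i; rewrite sys => hi.
  by rewrite (nth_map (Ordinal hi)) ?size_enum_ord //= nth_enum_ord.
apply: h => i; apply: (allP hys); apply: mem_nth; rewrite sys; exact: ltn_ord.
Qed.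

Lemma cmpb_allv d D n P : cmp D n -> cmpb (d + D) P ->
  cmpb D (fun o xs => allv d (n o xs) (fun ys => P o (ys ++ xs))).
Proof.
elim: d D n P => [|d IH] D n P hn hP //=.
have hn' : cmp D.+1 (fun o ys => n o (behead ys)).
  pose fs : seq (cfun nat) := [seq (fun _ xs => nth 0 xs i) | i <- iota 1 D].
  have sfs : size fs = D by rewrite /= size_map size_iota.
  rewrite -sfs in hn.
  have := @cmp_comp D.+1 fs _ hn (cmp_proj_list _ _).
  apply: cmp_ext => o xs sx /=; rewrite -drop1.
  by rewrite map_nth_iota -map_comp sx subn1.
have := IH D.+1 _ P hn'; rewrite addnS => /(_ hP) h.
have := cmpb_all hn h; apply: cmp_ext => o xs _ /=; congr nat_of_bool.
apply: eq_all => i; congr allv; apply: boolp.funext => ys; by rewrite -catA.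
Qed.

(** * Reading the codes of lists *)

Definition dhead c := nth 0 (CodeSeq.decode c) 0.
Definition dtail c := CodeSeq.code (behead (CodeSeq.decode c)).

(** Turns a number described by a monotone test into a bounded sum of truth values, for which
    [cmp_sum] provides a program. *)
Lemma sum_lt c v : v <= c -> \sum_(i < c) (i < v : nat) = v.
Proof.
move=> vc; rewrite -(big_mkord xpredT (fun i => (i < v : nat))).
rewrite (big_cat_nat (n := v)) //= (eq_big_nat _ _ (F2 := fun=> 1)).
  rewrite sum_nat_const_nat subn0 muln1 [X in _ + X]big1_seq ?addn0 // => i.
  by rewrite mem_index_iota => /andP[_ /andP[vi _]]; rewrite ltnNge vi.
by move=> i /andP[_ ->].
Qed.

Lemma dhead_code v s : dhead (CodeSeq.code (v :: s)) = v.
Proof. by rewrite /dhead CodeSeq.codeK. Qed.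

(** The code of [v :: s] is 2^v times an odd number, so the head is the exponent of 2 in the code;
    it is found by counting the powers of 2 that divide the code. *)
Lemma dhead_sum c : dhead c = \sum_(i < c) (2 ^ i.+1 %| c : nat).
Proof.
rewrite -[c]CodeSeq.decodeK; case: (CodeSeq.decode c) => [|v s].
  by rewrite big_ord0.
rewrite dhead_code [CodeSeq.code _]/=; set m := CodeSeq.code s.
rewrite -{1}(@sum_lt (2 ^ v * m.*2.+1) v); last first.
  by rewrite (leq_trans (ltnW (ltn_expl v (ltnSn 1)))) // leq_pmulr.
apply: eq_bigr => i _; congr nat_of_bool.
apply/idP/idP => iv; first by apply: dvdn_mulr; rewrite dvdn_exp2l.
rewrite ltnNge; apply/negP => vi.
have /dvdn_trans/(_ iv) : 2 ^ v.+1 %| 2 ^ i.+1 by rewrite dvdn_exp2l.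
by rewrite expnSr dvdn_pmul2l ?expn_gt0 // dvdn2 /= odd_double.
Qed.

(** With v the head, the code is 2^v (2m + 1) for the code m of the tail, and m is the number of
    smaller candidates. *)
Lemma dtail_sum c : dtail c = \sum_(m < c) (2 ^ dhead c * m.*2.+1 < c : nat).
Proof.
rewrite -[c]CodeSeq.decodeK; case: (CodeSeq.decode c) => [|v s].
  by rewrite big_ord0.
rewrite dhead_code /dtail CodeSeq.codeK /=; set m := CodeSeq.code s.
rewrite -{1}(@sum_lt (2 ^ v * m.*2.+1) m); last first.
  apply: (@leq_trans m.*2.+1); first by rewrite -addnn; lia.
  by rewrite leq_pmull // expn_gt0.
by apply: eq_bigr => i _; rewrite ltn_pmul2l ?expn_gt0 // ltnS ltn_double.
Qed.

Lemma cmpb_dvd2 D f g : cmp D f -> cmp D g -> cmpb D (fun o xs => 2 ^ f o xs %| g o xs).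
Proof.
move=> hf hg.
suff h' : cmp 2 (fun o xs => nat_of_bool (2 ^ nth 0 xs 0 %| nth 0 xs 1)).
  exact: (@cmp2 D (fun a b => nat_of_bool (2 ^ a %| b)) f g h' hf hg).
have h : cmpb 2 (fun o xs => ~~ all (fun i => ~~ (i * 2 ^ nth 0 xs 0 == nth 0 xs 1))
    (iota 0 (nth 0 xs 1).+1)).
  apply: cmpb_not; apply: (@cmpb_all 2 (fun _ xs => (nth 0 xs 1).+1)
    (fun _ xs => ~~ (nth 0 xs 0 * 2 ^ nth 0 xs 1 == nth 0 xs 2))).
    exact/cmp_succ/cmp_proj.
  apply/cmpb_not/cmpb_eq; last exact: cmp_proj.
  apply: cmp_mul; first exact: cmp_proj.
  exact/cmp_exp2/cmp_proj.
apply: cmp_ext h => o xs _; congr nat_of_bool.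
set a := nth 0 xs 0; set b := nth 0 xs 1; rewrite -has_predC.
apply/hasP/dvdnP => [[k _ /=]|[k ->]].
  by rewrite negbK => /eqP <-; exists k.
exists k; last by rewrite /= eqxx.
by rewrite mem_iota /= ltnS leq_pmulr // expn_gt0.
Qed.

Lemma cmp_dhead D f : cmp D f -> cmp D (fun o xs => dhead (f o xs)).
Proof.
apply: (@cmp1 D (fun _ => dhead)).
have := @cmp_sum 1 (fun _ xs => nth 0 xs 0)
  (fun _ xs => (2 ^ (nth 0 xs 0).+1 %| nth 0 xs 1)).
move=> /(_ (@cmp_proj 1 0)) /(_ (cmpb_dvd2 (cmp_succ (@cmp_proj 2 0)) (@cmp_proj 2 1))).
by apply: cmp_ext => o xs _; rewrite dhead_sum.
Qed.

Lemma cmp_dtail D f : cmp D f -> cmp D (fun o xs => dtail (f o xs)).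
Proof.
apply: (@cmp1 D (fun _ => dtail)).
have := @cmp_sum 1 (fun _ xs => nth 0 xs 0)
  (fun _ xs => 2 ^ dhead (nth 0 xs 1) * (nth 0 xs 0 * 2).+1 < nth 0 xs 1).
move=> /(_ (@cmp_proj 1 0)) h.
have /h : cmp 2 (fun _ xs => 2 ^ dhead (nth 0 xs 1) * (nth 0 xs 0 * 2).+1 < nth 0 xs 1).
  apply: cmpb_le; last exact: cmp_proj.
  apply: cmp_succ; apply: cmp_mul.
    exact/cmp_exp2/cmp_dhead/cmp_proj.
  by apply: cmp_succ; apply: cmp_mul; [exact: cmp_proj|exact: cmp_const].
apply: cmp_ext => o xs _; rewrite dtail_sum.
by apply: eq_bigr => i _; rewrite /= muln2.
Qed.

Definition dnth c i := nth 0 (CodeSeq.decode c) i.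

Lemma cmp_dnth D f g : cmp D f -> cmp D g -> cmp D (fun o xs => dnth (f o xs) (g o xs)).
Proof.
apply: (@cmp2 D dnth).
have := @cmp_dhead _ _ (@cmp_rec 2 _ _ _ (@cmp_proj 2 1) (@cmp_proj 2 0)
  (cmp_dtail (@cmp_proj 4 1))).
apply: cmp_ext => o xs _; rewrite /dnth /=.
set c := nth 0 xs 0; set i := nth 0 xs 1.
have -> : nrec c (fun _ w => dtail w) i = CodeSeq.code (drop i (CodeSeq.decode c)).
  elim: i => [|i IH] /=; first by rewrite drop0 CodeSeq.decodeK.
  by rewrite IH /dtail CodeSeq.codeK -drop1 drop_drop add1n.
by rewrite /dhead CodeSeq.codeK nth_drop addn0.
Qed.

Local Open Scope ring_scope.

(** * Rational arithmetic by programs *)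

Definition rat_of_nats (a b d : nat) : rat := (a%:R - b%:R) / d.+1%:R.

(** Programs output natural numbers only, so a rational function is presented by three of them, in
    the format of [rat_of_code]: a difference over a successor needs neither signs nor a test for
    zero denominators. *)
Definition cmpq D (F : cfun rat) : Prop := exists a b d : cfun nat,
  [/\ cmp D a, cmp D b, cmp D d &
    forall o xs, F o xs = rat_of_nats (a o xs) (b o xs) (d o xs)].

Lemma cmpq_nat D f : cmp D f -> cmpq D (fun o xs => (f o xs)%:R).
Proof.
move=> hf; exists f, (fun _ _ => 0%N), (fun _ _ => 0%N).
split=> //; try exact: cmp_const.
by move=> o xs; rewrite /rat_of_nats subr0 divr1.
Qed.

Lemma cmpq_code D f : cmp D f -> cmpq D (fun o xs => rat_of_code (f o xs)).
Proof.
move=> hf; exists (fun o xs => dnth (f o xs) 0), (fun o xs => dnth (f o xs) 1),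
  (fun o xs => dnth (f o xs) 2).
by split=> //; apply: cmp_dnth => //; exact: cmp_const.
Qed.

Lemma cmpq_opp D F : cmpq D F -> cmpq D (fun o xs => - F o xs).
Proof.
move=> [a [b [d [ha hb hd h]]]]; exists b, a, d; split=> // o xs.
by rewrite h /rat_of_nats -mulNr opprB.
Qed.

Lemma cmpq_add D F G : cmpq D F -> cmpq D G -> cmpq D (fun o xs => F o xs + G o xs).
Proof.
move=> [a [b [d [ha hb hd h]]]] [a' [b' [d' [ha' hb' hd' h']]]].
exists (fun o xs => a o xs * (d' o xs).+1 + a' o xs * (d o xs).+1)%N.
exists (fun o xs => b o xs * (d' o xs).+1 + b' o xs * (d o xs).+1)%N.
exists (fun o xs => ((d o xs).+1 * (d' o xs).+1).-1)%N.
split.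
- by apply: cmp_add; apply: cmp_mul => //; exact: cmp_succ.
- by apply: cmp_add; apply: cmp_mul => //; exact: cmp_succ.
- by apply: cmp_pred; apply: cmp_mul; exact: cmp_succ.
move=> o xs; rewrite h h' /rat_of_nats prednK // !natrD !natrM.
have := ltr0Sn rat (d o xs); have := ltr0Sn rat (d' o xs).
move: (d o xs).+1%:R (d' o xs).+1%:R => x y y0 x0.
by field; rewrite (lt0r_neq0 x0) (lt0r_neq0 y0).
Qed.

Lemma cmpq_sub D F G : cmpq D F -> cmpq D G -> cmpq D (fun o xs => F o xs - G o xs).
Proof. by move=> hF hG; apply: cmpq_add => //; exact: cmpq_opp. Qed.

Lemma cmpq_mul D F G : cmpq D F -> cmpq D G -> cmpq D (fun o xs => F o xs * G o xs).
Proof.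
move=> [a [b [d [ha hb hd h]]]] [a' [b' [d' [ha' hb' hd' h']]]].
exists (fun o xs => a o xs * a' o xs + b o xs * b' o xs)%N.
exists (fun o xs => a o xs * b' o xs + b o xs * a' o xs)%N.
exists (fun o xs => ((d o xs).+1 * (d' o xs).+1).-1)%N.
split; try by apply: cmp_add; apply: cmp_mul.
  by apply: cmp_pred; apply: cmp_mul; exact: cmp_succ.
move=> o xs; rewrite h h' /rat_of_nats prednK // !natrD !natrM.
have := ltr0Sn rat (d o xs); have := ltr0Sn rat (d' o xs).
move: (d o xs).+1%:R (d' o xs).+1%:R => x y y0 x0.
by field; rewrite (lt0r_neq0 x0) (lt0r_neq0 y0).
Qed.

Lemma cmpq_ext D F G : F =2 G -> cmpq D F -> cmpq D G.
Proof.
move=> FG [a [b [d [ha hb hd h]]]]; exists a, b, d; split=> // o xs.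
by rewrite -FG.
Qed.

Lemma cmpq_norm D F : cmpq D F -> cmpq D (fun o xs => `|F o xs|).
Proof.
move=> [a [b [d [ha hb hd h]]]].
(* One of the two truncated differences vanishes and the other is the absolute value of the
   numerator. *)
exists (fun o xs => (a o xs - b o xs) + (b o xs - a o xs))%N, (fun _ _ => 0%N), d.
split=> //; [by apply: cmp_add; exact: cmp_sub|exact: cmp_const|].
move=> o xs; rewrite h /rat_of_nats subr0 normrM normfV (ger0_norm (ler0n _ (d o xs).+1)).
congr (_ / _); case: (leqP (a o xs) (b o xs)) => ab.
  by rewrite (eqP ab) add0n natrB // distrC ger0_norm // subr_ge0 ler_nat.
have /eqP -> : (b o xs - a o xs == 0)%N by exact: ltnW.
by rewrite addn0 natrB ?(ltnW ab) // ger0_norm // subr_ge0 ler_nat ltnW.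
Qed.

Lemma cmpq_exp2V D f : cmp D f -> cmpq D (fun o xs => 2 ^- f o xs).
Proof.
move=> hf; exists (fun _ _ => 1%N), (fun _ _ => 0%N), (fun o xs => (2 ^ f o xs).-1)%N.
split; try exact: cmp_const.
  exact/cmp_pred/cmp_exp2.
by move=> o xs; rewrite /rat_of_nats prednK ?expn_gt0 // subr0 mul1r natrX.
Qed.

Lemma cmpb_leq D F G : cmpq D F -> cmpq D G -> cmpb D (fun o xs => F o xs <= G o xs).
Proof.
move=> [a [b [d [ha hb hd h]]]] [a' [b' [d' [ha' hb' hd' h']]]].
have := @cmpb_le D (fun o xs => a o xs * (d' o xs).+1 + b' o xs * (d o xs).+1)%N
   (fun o xs => a' o xs * (d o xs).+1 + b o xs * (d' o xs).+1)%N.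
move=> /(_ _)/wrap [|]; first by apply: cmp_add; apply: cmp_mul => //; exact: cmp_succ.
move=> /(_ _)/wrap [|]; first by apply: cmp_add; apply: cmp_mul => //; exact: cmp_succ.
apply: cmp_ext => o xs _; congr nat_of_bool; rewrite h h' /rat_of_nats.
rewrite ler_pdivrMr ?ltr0Sn // mulrAC ler_pdivlMr ?ltr0Sn //.
rewrite -(ler_nat rat) !natrD !natrM.
set x := (d o xs).+1%:R; set y := (d' o xs).+1%:R.
by rewrite !mulrBl lerBlDr addrAC lerBrDr.
Qed.

Lemma cmpb_ltq D F G : cmpq D F -> cmpq D G -> cmpb D (fun o xs => F o xs < G o xs).
Proof.
move=> hF hG; have := cmpb_not (cmpb_leq hG hF).
by apply: cmp_ext => o xs _; rewrite -ltNge.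
Qed.

Lemma cmpq_bigsum D (I : Type) (s : seq I) (P : pred I) (F : I -> cfun rat) :
  (forall i, cmpq D (F i)) -> cmpq D (fun o xs => \sum_(i <- s | P i) F i o xs).
Proof.
move=> hF; elim: s => [|i s IH].
  by apply: cmpq_ext (cmpq_nat (cmp_const D 0)) => o xs; rewrite big_nil.
case: (boolP (P i)) => Pi.
  by apply: cmpq_ext (cmpq_add (hF i) IH) => o xs; rewrite big_cons Pi.
by apply: cmpq_ext IH => o xs; rewrite big_cons (negbTE Pi).
Qed.

Lemma cmpq_bigprod D (I : Type) (s : seq I) (F : I -> cfun rat) :
  (forall i, cmpq D (F i)) -> cmpq D (fun o xs => \prod_(i <- s) F i o xs).
Proof.
move=> hF; elim: s => [|i s IH].
  by apply: cmpq_ext (cmpq_nat (cmp_const D 1)) => o xs; rewrite big_nil.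
by apply: cmpq_ext (cmpq_mul (hF i) IH) => o xs; rewrite big_cons.
Qed.

Lemma cmp_bigsum D (I : Type) (s : seq I) (F : I -> cfun nat) :
  (forall i, cmp D (F i)) -> cmp D (fun o xs => \sum_(i <- s) F i o xs)%N.
Proof.
move=> hF; elim: s => [|i s IH].
  by apply: cmp_ext (cmp_const D 0) => o xs; rewrite big_nil.
by apply: cmp_ext (cmp_add (hF i) IH) => o xs; rewrite big_cons.
Qed.

Lemma cmp_bigprod D (I : Type) (s : seq I) (P : pred I) (F : I -> cfun nat) :
  (forall i, cmp D (F i)) -> cmp D (fun o xs => \prod_(i <- s | P i) F i o xs)%N.
Proof.
move=> hF; elim: s => [|i s IH].
  by apply: cmp_ext (cmp_const D 1) => o xs; rewrite big_nil.
case: (boolP (P i)) => Pi.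
  by apply: cmp_ext (cmp_mul (hF i) IH) => o xs; rewrite big_cons Pi.
by apply: cmp_ext IH => o xs; rewrite big_cons (negbTE Pi).
Qed.

(* The program searches for the least z with P o [:: z; k] and outputs f z. *)
Lemma cmp_search (P : cfun bool) (f : cfun nat) :
  cmpb 2 P -> cmp 1 f ->
  exists e, forall o, (forall k, exists z, P o [:: z; k]) ->
    exists2 r, transforms e o r & forall k, exists2 z, P o [:: z; k] & r k = f o [:: z].
Proof.
(* [Mu] looks for a zero, hence the negated test. *)
move=> hP [ef hf]; have [eP heP] := cmpb_not hP.
exists (Comp ef [:: Mu eP]) => o ho.
exists (fun k => f o [:: ex_minn (ho k)]); last first.
  by move=> k; case: ex_minnP => z hz _; exists z.
move=> k; case: ex_minnP => z hz zmin; exists [:: z]; split; last exact: hf.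
split=> //; split; first by have := heP o [:: z; k] erefl; rewrite hz.
move=> j jz; exists 0%N; have := heP o [:: j; k] erefl.
suff -> : P o [:: j; k] = false by [].
by apply/negP => /zmin; rewrite leqNgt jz.
Qed.

Local Open Scope classical_set_scope.
Local Open Scope ring_scope.

(** * Quadratic forms and matrix pencils *)

Lemma le_coord_norm (R : realType) p q (M : 'M[R]_(p, q)) i j : `|M i j| <= `|M|.
Proof.
rewrite [leRHS]/Num.norm /= mx_normrE.
by apply: (le_bigmax _ (fun ij => `|M ij.1 ij.2|) (i, j)).
Qed.

Lemma mx_norm_le (R : realType) p q (M : 'M[R]_(p, q)) e : 0 <= e ->
  (forall i j, `|M i j| <= e) -> `|M| <= e.
Proof.
move=> e0 h; rewrite [leLHS]/Num.norm /= mx_normrE.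
by apply/bigmax_leP; split=> // -[i j] _; exact: h.
Qed.

Lemma norm_mulmx_le (R : realType) p q r (M : 'M[R]_(p, q)) (N : 'M[R]_(q, r)) :
  `|M *m N| <= q%:R * `|M| * `|N|.
Proof.
apply: mx_norm_le => [|i j]; first by rewrite !mulr_ge0.
rewrite mxE; apply: (le_trans (ler_norm_sum _ _ _)).
apply: (@le_trans _ _ (\sum_(k < q) `|M| * `|N|)); last first.
  by rewrite sumr_const card_ord -mulrA mulr_natl.
apply: ler_sum => k _; rewrite normrM.
by apply: ler_pM => //; exact: le_coord_norm.
Qed.

Lemma continuous_mul (R : realType) (T : topologicalType) (f g : T -> R) :
  continuous f -> continuous g -> continuous (fun x => f x * g x).
Proof. by move=> cf cg x; apply: continuousM; [exact: cf|exact: cg]. Qed.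

Section EuclideanNorm.
Variable R : realType.

Lemma enorm_ge0 p q (M : 'M[R]_(p, q)) : 0 <= enorm M.
Proof. exact: sqrtr_ge0. Qed.

Lemma sum_sqr_ge0 p q (M : 'M[R]_(p, q)) : 0 <= \sum_i \sum_j M i j ^+ 2.
Proof. by apply: sumr_ge0 => i _; apply: sumr_ge0 => j _; exact: sqr_ge0. Qed.

Lemma sqr_enorm p q (M : 'M[R]_(p, q)) :
  enorm M ^+ 2 = \sum_i \sum_j M i j ^+ 2.
Proof. by rewrite sqr_sqrtr // sum_sqr_ge0. Qed.

Lemma sqr_enorm_cV n (v : 'cV[R]_n) : enorm v ^+ 2 = \sum_i v i 0 ^+ 2.
Proof. by rewrite sqr_enorm; apply: eq_bigr => i _; rewrite big_ord1. Qed.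

Lemma le_coord_enorm p q (M : 'M[R]_(p, q)) i j : `|M i j| <= enorm M.
Proof.
rewrite -(ler_pXn2r (n := 2)) ?nnegrE ?enorm_ge0 // sqr_enorm real_normK ?num_real //.
rewrite (bigD1 i) //= (bigD1 j) //= -addrA lerDl.
apply: addr_ge0; first by apply: sumr_ge0 => k _; exact: sqr_ge0.
by apply: sumr_ge0 => k _; apply: sumr_ge0 => l _; exact: sqr_ge0.
Qed.

Lemma norm_le_enorm p q (M : 'M[R]_(p, q)) : `|M| <= enorm M.
Proof. by apply: mx_norm_le => [|i j]; [exact: enorm_ge0|exact: le_coord_enorm]. Qed.

Lemma sqr_enorm_le n (v : 'cV[R]_n) : enorm v ^+ 2 <= n%:R * `|v| ^+ 2.
Proof.
rewrite sqr_enorm_cV; apply: (@le_trans _ _ (\sum_(i < n) `|v| ^+ 2)); last first.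
  by rewrite sumr_const card_ord mulr_natl.
apply: ler_sum => i _; rewrite -[leLHS]real_normK ?num_real //.
by rewrite ler_pXn2r ?nnegrE //; exact: le_coord_norm.
Qed.

Lemma enorm_le n (v : 'cV[R]_n) : enorm v <= n%:R * `|v|.
Proof.
rewrite -(ler_pXn2r (n := 2)) ?nnegrE ?enorm_ge0 ?mulr_ge0 //.
apply: (le_trans (sqr_enorm_le v)); rewrite exprMn ler_wpM2r ?sqr_ge0 //.
by rewrite -natrX ler_nat; case: n {v} => // n; rewrite leq_pmulr.
Qed.

Lemma enormZ n a (v : 'cV[R]_n) : enorm (a *: v) = `|a| * enorm v.
Proof.
rewrite /enorm -sqrtr_sqr -sqrtrM ?sqr_ge0 //; congr Num.sqrt.
rewrite mulr_sumr; apply: eq_bigr => i _; rewrite mulr_sumr.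
by apply: eq_bigr => j _; rewrite mxE exprMn.
Qed.

Lemma enorm0 n : enorm (0 : 'cV[R]_n) = 0.
Proof. by rewrite -(scale0r 0) enormZ normr0 mul0r. Qed.

Lemma enorm_mulmx_le n (M : 'M[R]_n) c (v : 'cV[R]_n) :
  norm2 M <= c -> enorm (M *m v) <= c * enorm v.
Proof.
move=> Mc; have [->|v0] := eqVneq v 0; first by rewrite mulmx0 enorm0 mulr0.
have ev : 0 < enorm v.
  rewrite lt_neqAle enorm_ge0 andbT; apply: contra_neq v0 => ev0.
  apply/matrixP => i j; rewrite mxE; apply/eqP; rewrite -normr_le0.
  by rewrite [leRHS]ev0 le_coord_enorm.
rewrite -ler_pdivrMr //; apply: le_trans Mc; apply: ub_le_sup.
  (* The supremum defining [norm2] carries information only for a set that is bounded above; an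
     entrywise estimate provides the bound. *)
  exists (n%:R * (n%:R * `|M| * 1)) => _ [w w1 <-].
  apply: (le_trans (enorm_le _)); rewrite ler_wpM2l //.
  apply: (le_trans (norm_mulmx_le _ _)); rewrite ler_wpM2l ?mulr_ge0 //.
  exact: (le_trans (norm_le_enorm _)).
exists ((enorm v)^-1 *: v).
  by rewrite /= enormZ ger0_norm ?invr_ge0 ?enorm_ge0 // mulVf // gt_eqF.
by rewrite -scalemxAr enormZ ger0_norm ?invr_ge0 ?enorm_ge0 // mulrC.
Qed.

End EuclideanNorm.

Section QuadraticForms.
Context {R : realType} {n : nat}.
Implicit Types (A B P : 'M[R]_n) (u v w : 'cV[R]_n).

Definition bil A u v : R := (u^T *m A *m v) 0 0.
Definition qf A v : R := bil A v v.
Definition psd A : Prop := A^T = A /\ forall v, 0 <= qf A v.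

Lemma bilE A u v : bil A u v = \sum_i \sum_j u i 0 * A i j * v j 0.
Proof.
rewrite /bil mxE exchange_big /=; apply: eq_bigr => j _.
rewrite mxE mulr_suml; apply: eq_bigr => i _; by rewrite mxE.
Qed.

Lemma bilDl A u w v : bil A (u + w) v = bil A u v + bil A w v.
Proof. by rewrite /bil linearD /= !mulmxDl mxE. Qed.
Lemma bilDr A u v w : bil A u (v + w) = bil A u v + bil A u w.
Proof. by rewrite /bil mulmxDr mxE. Qed.
Lemma bilZl A a u v : bil A (a *: u) v = a * bil A u v.
Proof. by rewrite /bil linearZ /= -!scalemxAl mxE. Qed.
Lemma bilZr A a u v : bil A u (a *: v) = a * bil A u v.
Proof. by rewrite /bil -scalemxAr mxE. Qed.
Lemma bilDm A B u v : bil (A + B) u v = bil A u v + bil B u v.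
Proof. by rewrite /bil mulmxDr mulmxDl mxE. Qed.
Lemma bilZm A a u v : bil (a *: A) u v = a * bil A u v.
Proof. by rewrite /bil -scalemxAr -scalemxAl mxE. Qed.
Lemma bilNm A u v : bil (- A) u v = - bil A u v.
Proof. by rewrite -scaleN1r bilZm mulN1r. Qed.

Lemma bil_sym A u v : A^T = A -> bil A u v = bil A v u.
Proof.
move=> sA; rewrite !bilE exchange_big; apply: eq_bigr => i _.
by apply: eq_bigr => j _; rewrite -{1}sA mxE; ring.
Qed.

Lemma qfDm A B v : qf (A + B) v = qf A v + qf B v. Proof. exact: bilDm. Qed.
Lemma qfZm A a v : qf (a *: A) v = a * qf A v. Proof. exact: bilZm. Qed.
Lemma qfNm A v : qf (- A) v = - qf A v. Proof. exact: bilNm. Qed.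
Lemma qfZ A a v : qf A (a *: v) = a ^+ 2 * qf A v.
Proof. by rewrite /qf bilZl bilZr mulrA. Qed.
Lemma qf0 A : qf A 0 = 0.
Proof. by rewrite -(scale0r 0) qfZ expr0n mul0r. Qed.

Lemma qfD A u v : A^T = A -> qf A (u + v) = qf A u + 2 * bil A u v + qf A v.
Proof.
by move=> sA; rewrite /qf bilDl !bilDr (bil_sym v u sA); ring.
Qed.

Lemma qf_comb A a b u v : A^T = A ->
  qf A (a *: u + b *: v) = a ^+ 2 * qf A u + 2 * a * b * bil A u v + b ^+ 2 * qf A v.
Proof. by move=> sA; rewrite qfD // !qfZ bilZl bilZr; ring. Qed.

(* Weighted form of (x + y)^2 <= (M + e)^2, with eta playing the role of e / M. *)
Lemma qf_add_le A eta u v : psd A -> 0 < eta ->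
  qf A (u + v) <= (1 + eta) * qf A u + (1 + eta^-1) * qf A v.
Proof.
move=> [sA pA] eta0; rewrite qfD //.
have := pA (eta *: u + (-1) *: v); rewrite qf_comb //.
move=> /(mulr_ge0 (ltW (etrans (invr_gt0 eta) eta0))).
have -> : eta^-1 * (eta ^+ 2 * qf A u + 2 * eta * -1 * bil A u v + (-1) ^+ 2 * qf A v)
  = eta * qf A u - 2 * bil A u v + eta^-1 * qf A v by field; rewrite gt_eqF.
lra.
Qed.

Lemma psd_null A u v : psd A -> qf A v = 0 -> bil A u v = 0.
Proof.
move=> [sA pA] v0; have q0 := pA u.
have q1 : 0 < qf A u + 1 by lra.
(* Moving from [v] along [u] against the sign of the mixed term would make the form negative unless
   that term is zero. The added 1 covers the case where [qf A u] vanishes too. *)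
have := pA (1 *: v + (- bil A u v / (qf A u + 1)) *: u).
rewrite qf_comb // v0 (bil_sym v u sA); set b := bil A u v; set q := qf A u in q0 q1 *.
have -> : 1 ^+ 2 * 0 + 2 * 1 * (- b / (q + 1)) * b + (- b / (q + 1)) ^+ 2 * q =
   - (b ^+ 2 * ((q + 2) / (q + 1) ^+ 2)) by field; rewrite gt_eqF.
rewrite oppr_ge0 pmulr_lle0; last by rewrite divr_gt0 ?exprn_gt0 //; lra.
by move=> h; apply/eqP; rewrite -sqrf_eq0 eq_le h sqr_ge0.
Qed.

Lemma psd_CS A u v : psd A -> bil A u v ^+ 2 <= qf A u * qf A v.
Proof.
move=> pA; have [sA p] := pA.
have := p v; rewrite le_eqVlt => /orP[/eqP v0|v0].
  by rewrite psd_null // -v0 mulr0 expr0n.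
have := p (qf A v *: u + (- bil A u v) *: v); rewrite qf_comb //.
have -> : qf A v ^+ 2 * qf A u + 2 * qf A v * - bil A u v * bil A u v +
   (- bil A u v) ^+ 2 * qf A v = qf A v * (qf A u * qf A v - bil A u v ^+ 2) by ring.
by rewrite pmulr_rge0 // subr_ge0.
Qed.

Lemma mulmx_coord A v i : (A *m v) i 0 = bil A (delta_mx i 0) v.
Proof. by rewrite /bil trmx_delta -mulmxA -rowE [RHS]mxE. Qed.

Lemma psd_kernel A v : psd A -> qf A v = 0 -> A *m v = 0.
Proof.
by move=> pA v0; apply/matrixP => i j; rewrite ord1 mulmx_coord psd_null // mxE.
Qed.

Lemma abs_bil_le A u v c : (forall i j, `|A i j| <= c) ->
  `|bil A u v| <= c * (\sum_i `|u i 0|) * (\sum_i `|v i 0|).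
Proof.
move=> Ac; rewrite bilE -mulrA mulr_suml mulr_sumr.
apply: (le_trans (ler_norm_sum _ _ _)); apply: ler_sum => i _.
rewrite 2!mulr_sumr; apply: (le_trans (ler_norm_sum _ _ _)).
apply: ler_sum => j _; rewrite !normrM (mulrC `|u i 0|) -!mulrA.
by rewrite ler_wpM2r ?mulr_ge0.
Qed.

Lemma abs_qf_le A v c : (forall i j, `|A i j| <= c) ->
  `|qf A v| <= c * (\sum_i `|v i 0|) ^+ 2.
Proof. by move=> Ac; rewrite /qf expr2 mulrA; exact: abs_bil_le. Qed.

Lemma sum_norm_le v : \sum_i `|v i 0| <= n%:R * `|v|.
Proof.
rewrite -[n in n%:R]card_ord mulr_natl -sumr_const.
by apply: ler_sum => i _; exact: le_coord_norm.
Qed.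

Lemma posdef_psd A : posdef_mx A -> psd A.
Proof.
move=> [sA pA]; split=> // v; have [->|v0] := eqVneq v 0; first by rewrite qf0.
exact/ltW/pA.
Qed.

(* Jensen's inequality for the matrix-valued convex combination P + N = A. *)
Lemma psd_jensen A P N u v w : psd P -> psd N -> P + N = A -> A^T = A ->
  A *m w = P *m u + N *m v -> qf A w <= qf P u + qf N v.
Proof.
move=> [sP pP] [sN pN] PN sA e.
(* The forms of [P] at u - w and of [N] at v - w are non-negative, and by [e] their mixed terms add
   up to [qf A w]. *)
have := addr_ge0 (pP (1 *: u + (-1) *: w)) (pN (1 *: v + (-1) *: w)).
rewrite !qf_comb // (bil_sym u w sP) (bil_sym v w sN).
have : bil P w u + bil N w v = qf A w.
  have := congr1 (fun M => (w^T *m M) 0 0) e.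
  by rewrite /qf /bil mulmxDr [in RHS]mxE !mulmxA => ->.
have : qf A w = qf P w + qf N w by rewrite -PN qfDm.
lra.
Qed.

End QuadraticForms.

Section Pencil.
Context {R : realType} {n : nat}.
Implicit Types (A B P : 'M[R]_n) (u v w : 'cV[R]_n).

Lemma posdef_inj A v : posdef_mx A -> A *m v = 0 -> v = 0.
Proof.
move=> [sA pA] Av; apply/eqP; apply: contraT => /pA.
by rewrite -mulmxA Av mulmx0 mxE ltxx.
Qed.

Lemma det0_cV A : reflect (exists2 v : 'cV[R]_n, v != 0 & A *m v = 0) (\det A == 0).
Proof.
rewrite -det_tr; apply: (iffP det0P) => -[v v0 e].
  exists v^T; first by rewrite trmx_eq0.
  by apply: trmx_inj; rewrite trmx_mul trmxK e trmx0.
exists v^T; first by rewrite trmx_eq0.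
by rewrite -trmx_mul e trmx0.
Qed.

Lemma posdef_unit A : posdef_mx A -> A \in unitmx.
Proof.
move=> pA; rewrite unitmxE unitfE; apply/negP => /det0_cV[v v0 /(posdef_inj pA)].
by move/eqP; rewrite (negbTE v0).
Qed.

Lemma pencilP A B l : pencil_spectrum A B l <->
  exists2 v : 'cV[R]_n, v != 0 & B *m v = l *: (A *m v).
Proof.
rewrite /pencil_spectrum /=; split.
  move=> /eqP /det0_cV[v v0]; rewrite mulmxBl => /eqP; rewrite subr_eq0 => /eqP e.
  by exists v => //; rewrite -e -scalemxAl.
move=> [v v0 e]; apply/eqP/det0_cV; exists v => //.
by rewrite mulmxBl e -scalemxAl subrr.
Qed.

Lemma qf_continuous A : continuous (fun v : 'rV[R]_n => qf A v^T).
Proof.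
have -> : (fun v : 'rV[R]_n => qf A v^T) =
    (fun v : 'rV[R]_n => \sum_i \sum_j v 0 i * A i j * v 0 j).
  apply/funext => v; rewrite /qf bilE; apply: eq_bigr => i _.
  by apply: eq_bigr => j _; rewrite !mxE.
apply: (continuous_big (@add_continuous _)) => i _.
apply: (continuous_big (@add_continuous _)) => j _.
apply: continuous_mul; last exact: coord_continuous.
by apply: continuous_mul; [exact: coord_continuous|exact: cst_continuous].
Qed.

Lemma pencil_max A B : (0 < n)%N -> posdef_mx A -> B^T = B ->
  exists2 mu, pencil_spectrum A B mu & psd (mu *: A - B).
Proof.
move=> n0 pA sB.
pose S := [set v : 'rV[R]_n | `|v| = 1].
have qA v : v != 0 -> 0 < qf A v by case: pA => _ /[apply].
have S0 (v : 'rV[R]_n) : S v -> v^T != 0.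
  by rewrite /S /= trmx_eq0 -normr_gt0 => ->.
have [||| c cS cmax] := @EVT_max_rV R n (fun v : 'rV[R]_n => qf B v^T / qf A v^T) S.
- exists (const_mx 1) => /=; apply/eqP; rewrite eq_le; apply/andP; split.
    by apply: mx_norm_le => // i j; rewrite mxE normr1.
  by have := @le_coord_norm _ _ _ (const_mx 1 : 'rV[R]_n) 0 (Ordinal n0); rewrite mxE normr1.
- apply: bounded_closed_compact.
    by exists 1; split; [exact: num_real|move=> M M1 v /= ->; exact: ltW].
  have -> : S = Num.norm @^-1` [set x | x = 1] by [].
  apply: preimage_closed; last exact: closed_eq.
  by move=> v _; exact: norm_continuous.
- rewrite continuous_subspace_in => v; rewrite inE => vS.
  apply: cvgM; first exact: (@continuous_subspaceT _ _ S _ (@qf_continuous B)).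
  apply: cvgV; first by rewrite gt_eqF // qA // S0.
  exact: (@continuous_subspaceT _ _ S _ (@qf_continuous A)).
rewrite inE in cS; set mu := qf B c^T / qf A c^T in cmax *.
have hpsd : psd (mu *: A - B).
  split; first by case: pA => sA _; rewrite linearB /= linearZ /= sA sB.
  move=> v; have [->|v0] := eqVneq v 0; first by rewrite qf0.
  rewrite qfDm qfZm qfNm subr_ge0 -ler_pdivrMr ?qA //.
  have nv : 0 < `|v^T| by rewrite normr_gt0 trmx_eq0.
  have := cmax (`|v^T|^-1 *: v^T).
  rewrite !linearZ /= trmxK !qfZ -mulf_div divff ?mul1r; last first.
    by rewrite sqrf_eq0 invr_eq0 gt_eqF.
  by apply; rewrite inE /S /= normrZ normfV normr_id mulVf // gt_eqF.
exists mu => //; apply/pencilP; exists c^T; first exact: S0.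
have /(psd_kernel hpsd) : qf (mu *: A - B) c^T = 0.
  by rewrite qfDm qfZm qfNm /mu divfK ?subrr // gt_eqF // qA // S0.
by rewrite mulmxBl => /eqP; rewrite subr_eq0 -scalemxAl => /eqP.
Qed.

Lemma pencil_le A B mu l : posdef_mx A -> psd (mu *: A - B) ->
  pencil_spectrum A B l -> l <= mu.
Proof.
move=> [sA pA] [_ p] /pencilP[v v0 e].
have := p v; rewrite qfDm qfZm qfNm {2}/qf /bil -mulmxA e -scalemxAr mulmxA mxE.
by rewrite -/(bil A v v) -/(qf A v) -mulrBl pmulr_lge0 ?subr_ge0 //; exact: pA.
Qed.

Lemma lambda_maxP A B : (0 < n)%N -> posdef_mx A -> B^T = B ->
  pencil_spectrum A B (lambda_max A B) /\ psd (lambda_max A B *: A - B).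
Proof.
move=> n0 pA sB; have [mu smu pmu] := pencil_max n0 pA sB.
suff -> : lambda_max A B = mu by [].
apply/eqP; rewrite eq_le; apply/andP; split.
  apply: ge_sup; first by exists mu.
  by move=> l; exact: pencil_le.
by apply: ub_le_sup => //; exists mu => l; exact: pencil_le.
Qed.

Lemma pencil_spectrumN A B :
  pencil_spectrum A (- B) = -%R @` pencil_spectrum A B.
Proof.
apply/seteqP; split=> [l /pencilP[v v0 e]|_ [l /pencilP[v v0 e] <-]].
  exists (- l); last by rewrite opprK.
  by apply/pencilP; exists v => //; rewrite scaleNr -e mulNmx opprK.
by apply/pencilP; exists v => //; rewrite mulNmx e scaleNr.
Qed.

Lemma lambda_minP A B : (0 < n)%N -> posdef_mx A -> B^T = B ->
  pencil_spectrum A B (lambda_min A B) /\ psd (B - lambda_min A B *: A).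
Proof.
move=> n0 pA sB.
have -> : lambda_min A B = - lambda_max A (- B).
  by rewrite /lambda_min /lambda_max /inf pencil_spectrumN.
have [|s p] := @lambda_maxP A (- B) n0 pA; first by rewrite linearN /= sB.
split; last by move: p; rewrite opprK scaleNr opprK addrC.
have := s; rewrite {1}pencil_spectrumN => -[l hl <-]; by rewrite opprK.
Qed.

(** This is what makes strict lower bounds of [lambda_max] verifiable: one vector is a proof, and by
    continuity it may be taken rational. *)
Lemma lambda_max_gt A B al : (0 < n)%N -> posdef_mx A -> B^T = B ->
  (exists v, 0 < qf B v - al * qf A v) <-> al < lambda_max A B.
Proof.
move=> n0 pA sB; have [/pencilP[v v0 e] [_ p]] := lambda_maxP n0 pA sB.
split=> [[w hw]|h].
  have := p w; rewrite qfDm qfZm qfNm => h.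
  have := proj2 (posdef_psd pA) w; rewrite ltNge => q0; apply/negP => le.
  have := ler_wpM2r q0 le; lra.
exists v; rewrite /qf {1}/bil -mulmxA e -scalemxAr mulmxA mxE -/(bil A v v) -mulrBl.
by rewrite mulr_gt0 ?subr_gt0 //; case: pA => _; exact.
Qed.

Lemma lambda_min_lt A B be : (0 < n)%N -> posdef_mx A -> B^T = B ->
  (exists v, 0 < be * qf A v - qf B v) <-> lambda_min A B < be.
Proof.
move=> n0 pA sB; have [/pencilP[v v0 e] [_ p]] := lambda_minP n0 pA sB.
split=> [[w hw]|h].
  have := p w; rewrite qfDm qfNm qfZm => h.
  have := proj2 (posdef_psd pA) w; rewrite ltNge => q0; apply/negP => le.
  have := ler_wpM2r q0 le; lra.
exists v; rewrite /qf {2}/bil -mulmxA e -scalemxAr mulmxA mxE -/(bil A v v) -mulrBl.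
by rewrite mulr_gt0 ?subr_gt0 //; case: pA => _; exact.
Qed.

End Pencil.

Section Bounds.
Context {R : realType} {n : nat}.
Implicit Types (A B P : 'M[R]_n) (u v w : 'cV[R]_n).

(* The only consequences of the bounds on A and its inverse that are used. *)
Definition coercive (K : R) A : Prop :=
  forall v, qf A v <= K * `|v| ^+ 2 /\ `|v| ^+ 2 <= K * qf A v.

Lemma entry_le_norm2 A c i j : norm2 A <= c -> `|A i j| <= c.
Proof.
move=> Ac.
have := enorm_mulmx_le (delta_mx j 0) Ac.
have -> : enorm (delta_mx j 0 : 'cV[R]_n) = 1.
  apply/eqP; rewrite -(eqrXn2 (n := 2)) ?enorm_ge0 // expr1n sqr_enorm_cV.
  rewrite (bigD1 j) //= mxE !eqxx expr1n big1 ?addr0 // => k kj.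
  by rewrite mxE (negbTE kj) expr0n.
rewrite mulr1; apply: le_trans.
apply: le_trans (le_coord_enorm _ i 0); by rewrite -colE mxE.
Qed.

(** The upper bound uses that entries are at most [MA]. For the lower one, v is the inverse of A
    applied to A v, and by Cauchy-Schwarz each coordinate of A v has a square of at most [MA] times
    [qf A v]. The constants obtained are n^2 MA and n^2 MA^3; the larger one serves for both. *)
Lemma posdef_coercive (MA : nat) A : (0 < MA)%N -> posdef_mx A ->
  norm2 A <= MA%:R -> norm2 (invmx A) <= MA%:R -> coercive (n ^ 2 * MA ^ 3)%:R A.
Proof.
move=> MA0 pA A1 A2 v; split.
  apply: (le_trans (ler_norm _)).
  apply: (le_trans (abs_qf_le v (fun i j => entry_le_norm2 i j A1))).
  apply: (@le_trans _ _ (MA%:R * (n%:R * `|v|) ^+ 2)).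
    rewrite ler_wpM2l // ler_pXn2r ?nnegrE ?mulr_ge0 ?sumr_ge0 //.
    exact: sum_norm_le.
  rewrite exprMn mulrA ler_wpM2r ?sqr_ge0 // -natrX -natrM ler_nat mulnC.
  by rewrite leq_mul2l; apply/orP; right; rewrite -{1}[MA]expn1 leq_pexp2l.
have Av : `|A *m v| ^+ 2 <= MA%:R * qf A v.
  rewrite -ler_sqrt ?mulr_ge0 ?(proj2 (posdef_psd pA)) // sqrtr_sqr normr_id.
  apply: mx_norm_le => [|i j]; first exact: sqrtr_ge0.
  rewrite -sqrtr_sqr ler_sqrt ?mulr_ge0 ?(proj2 (posdef_psd pA)) // ord1.
  rewrite mulmx_coord; apply: (le_trans (psd_CS _ _ (posdef_psd pA))).
  rewrite ler_wpM2r ?(proj2 (posdef_psd pA)) //.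
  rewrite /qf -mulmx_coord -colE mxE; apply: (le_trans (ler_norm _)).
  exact: entry_le_norm2.
have : `|v| <= MA%:R * (n%:R * `|A *m v|).
  apply: (le_trans (norm_le_enorm _)).
  rewrite -{1}[v](mulKmx (posdef_unit pA)); apply: (le_trans (enorm_mulmx_le _ A2)).
  by rewrite ler_wpM2l //; exact: enorm_le.
rewrite -(ler_pXn2r (n := 2)) ?nnegrE ?mulr_ge0 // => /le_trans; apply.
rewrite !exprMn -!natrX natrM (natrX _ MA 3) (exprS MA%:R) -[MA%:R ^+ 2]natrX.
have E (a b c d : R) : a * (b * c) * d = c * (a * (b * d)) by ring.
rewrite E.
by rewrite !ler_wpM2l.
Qed.

Lemma sym_abs_qf_le (MA : nat) B v : (0 < MA)%N ->
  norm2 B <= MA%:R -> `|qf B v| <= (n ^ 2 * MA ^ 3)%:R * `|v| ^+ 2.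
Proof.
move=> MA0 A1.
apply: (le_trans (abs_qf_le v (fun i j => entry_le_norm2 i j A1))).
apply: (@le_trans _ _ (MA%:R * (n%:R * `|v|) ^+ 2)).
  rewrite ler_wpM2l // ler_pXn2r ?nnegrE ?mulr_ge0 ?sumr_ge0 //.
  exact: sum_norm_le.
rewrite exprMn mulrA ler_wpM2r ?sqr_ge0 // -natrX -natrM ler_nat mulnC.
by rewrite leq_mul2l; apply/orP; right; rewrite -{1}[MA]expn1 leq_pexp2l.
Qed.

Lemma pencil_abs_le K A B l : posdef_mx A -> coercive K A ->
  (forall v, `|qf B v| <= K * `|v| ^+ 2) -> pencil_spectrum A B l -> `|l| <= K ^+ 2.
Proof.
move=> pA cA cB /pencilP[v v0 e].
have q0 : 0 < qf A v by case: pA => _; exact.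
have [_ h] := cA v.
have K0 : 0 <= K.
  have : 0 < K * qf A v by apply: lt_le_trans h; rewrite exprn_gt0 // normr_gt0.
  by rewrite pmulr_lgt0 // => /ltW.
have : `|qf B v| = `|l| * qf A v.
  by rewrite /qf {1}/bil -mulmxA e -scalemxAr mulmxA mxE normrM (gtr0_norm q0).
move=> e2; rewrite -(ler_pM2r q0) -e2; apply: (le_trans (cB v)).
by rewrite expr2 -mulrA ler_wpM2l.
Qed.

End Bounds.

(** * Upper bounds for iterated integrals *)

Section IteratedIntegral.
Variable R : realType.

(* The library lemma ge0_le_integral requires measurability. *)
Lemma integral_le_nomeas (f g : R -> \bar R) :
  (forall x, 0 <= f x)%E -> (forall x, f x <= g x)%E ->
  (\int[@lebesgue_measure R]_(x in [set: R]) f x <=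
   \int[@lebesgue_measure R]_(x in [set: R]) g x)%E.
Proof.
move=> f0 fg; rewrite !ge0_integralTE //; last first.
  by move=> x; exact: le_trans (fg x).
apply: ereal_sup_le => _ [h hf <-]; exists h => // x.
exact: le_trans (hf x) (fg x).
Qed.

Lemma integral_Rd_ge0 d (f : 'rV[R]_d -> \bar R) :
  (forall x, 0 <= f x)%E -> (0 <= integral_Rd f)%E.
Proof.
by elim: d f => [|d IH] f f0 //=; apply: integral_ge0 => x _; exact: IH.
Qed.

Lemma le_integral_Rd d (f g : 'rV[R]_d -> \bar R) :
  (forall x, 0 <= f x)%E -> (forall x, f x <= g x)%E ->
  (integral_Rd f <= integral_Rd g)%E.
Proof.
elim: d f g => [|d IH] f g f0 fg //=.
by apply: integral_le_nomeas => x; [exact: integral_Rd_ge0|exact: IH].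
Qed.

Lemma row_mx_ord0 d (x : R) (v : 'rV[R]_d) :
  row_mx (x%:M : 'rV[R]_1) v 0 (ord0 : 'I_(1 + d)) = x.
Proof.
have -> : (ord0 : 'I_(1 + d)) = lshift d ord0 by exact: val_inj.
by rewrite row_mxEl mxE eqxx mulr1n.
Qed.

Lemma row_mx_lift d (x : R) (v : 'rV[R]_d) (l : 'I_d) :
  row_mx (x%:M : 'rV[R]_1) v 0 (lift ord0 l : 'I_(1 + d)) = v 0 l.
Proof.
have -> : (lift ord0 l : 'I_(1 + d)) = rshift 1 l by exact: val_inj.
by rewrite row_mxEr.
Qed.

(** The upper bound of a slice by a lattice sum and the lower bound needed for uniqueness both
    compare the integrand with a step function on half-open boxes, so that measurability of the
    solution is never involved. *)
Lemma integral_Rd_cells d (I : finType) (c : I -> R) (lo len : I -> 'I_d -> R) :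
  (forall i, 0 <= c i) -> (forall i l, 0 < len i l) ->
  integral_Rd (fun v : 'rV[R]_d =>
    (\sum_i c i * \prod_l \1_(`[lo i l, lo i l + len i l[) (v 0 l))%:E) =
  (\sum_i c i * \prod_l len i l)%:E.
Proof.
elim: d c lo len => [|d IH] c lo len c0 len0 /=.
  by congr EFin; apply: eq_bigr => i _; rewrite !big_ord0.
transitivity (\int[@lebesgue_measure R]_(x in [set: R])
   \sum_(i <- index_enum I) ((c i * \prod_(l < d) len i (lift ord0 l))%:E *
     (\1_(`[lo i ord0, lo i ord0 + len i ord0[) x)%:E))%E.
  apply: eq_integral => x _; rewrite sumEFin.
  have c0' i : 0 <= c i * \1_(`[lo i ord0, lo i ord0 + len i ord0[) x.
    by rewrite mulr_ge0 // indicE.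
  have h := IH (fun i => c i * \1_(`[lo i ord0, lo i ord0 + len i ord0[) x)
    (fun i l => lo i (lift ord0 l)) (fun i l => len i (lift ord0 l))
    c0' (fun i l => len0 _ _).
  transitivity (\sum_i c i * \1_(`[lo i ord0, lo i ord0 + len i ord0[) x *
     \prod_(l < d) len i (lift ord0 l))%:E.
    rewrite -h; congr integral_Rd; apply/funext => v; congr EFin.
    apply: eq_bigr => i _; rewrite big_ord_recl row_mx_ord0 mulrA; congr (_ * _).
    by apply: eq_bigr => l _; rewrite row_mx_lift.
  by congr EFin; apply: eq_bigr => i _; rewrite mulrAC.
have k0 i : 0 <= c i * \prod_(l < d) len i (lift ord0 l).
  by rewrite mulr_ge0 // prodr_ge0 // => l _; exact: ltW.
rewrite ge0_integral_sum //; last 2 first.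
- move=> i; apply: measurable_funeM; apply/measurable_EFinP.
  exact: measurable_indic.
- by move=> i x _; rewrite mule_ge0 // lee_fin // indicE.
rewrite -sumEFin; apply: eq_bigr => i _.
rewrite ge0_integralZl_EFin //; last first.
  by apply/measurable_EFinP; exact: measurable_indic.
rewrite integral_indic // setIT.
rewrite [X in (_ * X)%E](lebesgue_measure_itv `[lo i ord0, lo i ord0 + len i ord0[) /= lte_fin ltrDl len0 -EFinD addrAC subrr add0r.
by rewrite -EFinM big_ord_recl mulrAC mulrA.
Qed.

End IteratedIntegral.

(** Consistency of the scheme in one direction: for affine data with value [c] and slope [g], the
    average of the values found upstream at the speeds [a] and [b] is exactly the value after the
    time [t]. *)
Lemma split_comb (R : realType) n (P N A B : 'M[R]_n) (a b t : R) (c g : 'cV[R]_n) :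
  P + N = A -> a *: P + b *: N = B ->
  P *m (c - (a * t) *: g) + N *m (c - (b * t) *: g) = A *m c - t *: (B *m g).
Proof.
move=> <- <-; rewrite !mulmxBr !mulmxDl -!scalemxAr -!scalemxAl.
move: (P *m c) (N *m c) (P *m g) (N *m g) => p1 p2 q1 q2.
by apply/matrixP => i j; rewrite !mxE; ring.
Qed.

(** * The energy estimate *)

Section Scheme.
Context {R : realType} {m n : nat} (A : 'M[R]_n) (B : 'I_m -> 'M[R]_n).
Context (lM lm : 'I_m -> R) (K : R).
Hypothesis unitA : A \in unitmx.
Hypothesis symA : A^T = A.
Hypothesis K0 : 0 <= K.
Hypothesis cA : coercive K A.
Hypothesis psdM : forall l, psd (lM l *: A - B l).
Hypothesis psdm : forall l, psd (B l - lm l *: A).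
Hypothesis lM0 : forall l, 0 < lM l.
Hypothesis lm0 : forall l, lm l < 0.

Let wd l := lM l - lm l.

Lemma width_gt0 l : 0 < wd l.
Proof. by rewrite /wd; have := lM0 l; have := lm0 l; lra. Qed.

(* B l = lM l *: split_max l + lm l *: split_min l: data travelling at the two
   extreme characteristic speeds only. *)
Definition split_max l := (wd l)^-1 *: (B l - lm l *: A).
Definition split_min l := (wd l)^-1 *: (lM l *: A - B l).

Lemma psdZ (a : R) (P : 'M[R]_n) : 0 <= a -> psd P -> psd (a *: P).
Proof.
move=> a0 [sP pP]; split; first by rewrite linearZ /= sP.
by move=> v; rewrite qfZm mulr_ge0.
Qed.

Lemma psd_split_max l : psd (split_max l).
Proof. by apply: psdZ => //; rewrite invr_ge0 ltW // width_gt0. Qed.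

Lemma psd_split_min l : psd (split_min l).
Proof. by apply: psdZ => //; rewrite invr_ge0 ltW // width_gt0. Qed.

Lemma split_sum l : split_max l + split_min l = A.
Proof.
have w0 := lt0r_neq0 (width_gt0 l).
by apply/matrixP => i j; rewrite !mxE; move: w0; rewrite /wd => w0; field.
Qed.

Lemma split_speed l : lM l *: split_max l + lm l *: split_min l = B l.
Proof.
have w0 := lt0r_neq0 (width_gt0 l).
apply/matrixP => i j; rewrite !mxE.
by move: w0; rewrite /wd => w0; field.
Qed.

(** Jensen's inequality with one argument zero shows that neither half of a step increases the
    energy; passing from the energy to the max norm and back costs [K]. *)
Lemma invA_bound (x y : 'cV[R]_n) l :
  A *m y = split_max l *m x \/ A *m y = split_min l *m x -> `|y| <= K * `|x|.
Proof.
move=> h; suff : qf A y <= qf A x.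
  move=> yx; rewrite -(ler_pXn2r (n := 2)) ?nnegrE ?mulr_ge0 //.
  apply: (le_trans (proj2 (cA y))); rewrite exprMn expr2 -mulrA ler_wpM2l //.
  exact: le_trans yx (proj1 (cA x)).
have h1 := psd_split_max l; have h2 := psd_split_min l.
have e : qf A x = qf (split_max l) x + qf (split_min l) x by rewrite -qfDm split_sum.
have p1 := proj2 h1 x; have p2 := proj2 h2 x.
case: h => h.
  have := @psd_jensen _ _ A _ _ x 0 y h1 h2 (split_sum l) symA.
  by rewrite mulmx0 addr0 => /(_ h); rewrite qf0; lra.
have := @psd_jensen _ _ A _ _ 0 x y h1 h2 (split_sum l) symA.
by rewrite mulmx0 add0r => /(_ h); rewrite qf0; lra.
Qed.

Lemma invA_norm_le (r : 'cV[R]_n) : `|invmx A *m r| <= K * (n%:R * `|r|).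
Proof.
set x := invmx A *m r; have Ax : A *m x = r by rewrite mulKVmx.
have [->|x0] := eqVneq x 0; first by rewrite normr0 !mulr_ge0.
have nx : 0 < `|x| by rewrite normr_gt0.
rewrite -(ler_pM2r nx) -expr2; apply: (le_trans (proj2 (cA x))).
rewrite -mulrA ler_wpM2l // /qf /bil -mulmxA Ax.
apply: le_trans (ler_norm _) _; apply: le_trans (le_coord_norm _ _ _) _.
apply: (le_trans (norm_mulmx_le _ _)).
rewrite mulrAC ler_wpM2l ?mulr_ge0 // mx_norm_le // => i j.
by rewrite mxE le_coord_norm.
Qed.

Variable N : nat.
(* Indices are cyclic so that the shifts are bijections; grid functions vanish
   near the top, so the wrap-around is never felt. *)
Let T := {ffun 'I_m -> 'I_N.+1}.
Implicit Types (f V : T -> 'cV[R]_n) (j : T).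

Definition shift (l : 'I_m) (j : T) : T :=
  [ffun i => if i == l then ordS (j i) else j i].

Lemma shift_inj l : injective (shift l).
Proof.
move=> j j' /ffunP e; apply/ffunP => i; have := e i; rewrite !ffunE.
by case: eqP => // _ /ordS_inj.
Qed.

(** One factor of a full time step, for the direction [l] alone. On the moving lattice the
    characteristic of speed [lM l] that ends in the node [j] starts in the node [j] of the level
    below, and that of speed [lm l] starts in [shift l j]. *)
Definition step l f j : 'cV[R]_n :=
  invmx A *m (split_max l *m f j + split_min l *m f (shift l j)).

Definition energy f : R := \sum_j qf A (f j).

(** Jensen's inequality at every node. As the shift is a bijection of the cyclic lattice, every
    value is then counted once with [split_max l] and once with [split_min l], which add up to
    [A]. *)
Lemma energy_step l f : energy (step l f) <= energy f.
Proof.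
apply: (@le_trans _ _ (\sum_j (qf (split_max l) (f j) + qf (split_min l) (f (shift l j))))).
  apply: ler_sum => j _.
  apply: (psd_jensen (psd_split_max l) (psd_split_min l) (split_sum l) symA).
  by rewrite mulKVmx.
rewrite big_split /= -(reindex_inj (@shift_inj l) (P := xpredT)
  (F := fun j => qf (split_min l) (f j))) -big_split /=.
by apply: ler_sum => j _; rewrite -qfDm split_sum.
Qed.

Lemma energy_steps ds f : energy (foldr step f ds) <= energy f.
Proof. by elim: ds => //= l ds; apply: le_trans (energy_step _ _). Qed.

Section Consistency.
Variables (tau : R) (g : 'I_m -> 'cV[R]_n).

(** The binary tree of backward characteristics used by [foldr step V ds j]: at its leaves, [V]
    agrees up to [del] with the affine function that has slopes [g] and the value [v0] at the
    root. *)
Fixpoint good V (del : R) ds v0 j : Prop :=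
  if ds is l :: ds' then
    good V del ds' (v0 - (lM l * tau) *: g l) j /\
    good V del ds' (v0 - (lm l * tau) *: g l) (shift l j)
  else `|V j - v0| <= del.

(** A step is exact on affine data by [split_comb], and both of its terms multiply errors by at most
    [K]. The resulting power of 2 K enters the error of a single time level only and is not
    compounded over time, because propagation between levels is measured in the energy. *)
Lemma good_steps V del ds v0 j : 0 <= del -> good V del ds v0 j ->
  `|foldr step V ds j - (v0 - tau *: \sum_(l <- ds) invmx A *m (B l *m g l))| <=
  (2 * K) ^+ size ds * del.
Proof.
move=> del0; elim: ds v0 j => [|l ds IH] v0 j /=.
  by rewrite big_nil scaler0 subr0 expr0 mul1r.
move=> [/IH h1 /IH h2]; rewrite big_cons.
set S := \sum_(l0 <- ds) _ in h1 h2 *.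
set F := foldr step V ds in h1 h2 *.
set x1 := (X in F j - X) in h1; set x2 := (X in F (shift l j) - X) in h2.
have -> : v0 - tau *: (invmx A *m (B l *m g l) + S) =
    invmx A *m (split_max l *m x1) + invmx A *m (split_min l *m x2).
  rewrite -mulmxDr -[LHS](mulKmx unitA); congr (_ *m _).
  have -> : x1 = (v0 - tau *: S) - (lM l * tau) *: g l.
    by apply/matrixP => a b; rewrite !mxE; ring.
  have -> : x2 = (v0 - tau *: S) - (lm l * tau) *: g l.
    by apply/matrixP => a b; rewrite !mxE; ring.
  have -> : v0 - tau *: (invmx A *m (B l *m g l) + S) =
      (v0 - tau *: S) - tau *: (invmx A *m (B l *m g l)).
    by apply/matrixP => a b; rewrite !mxE; ring.
  by rewrite (split_comb _ _ _ (split_sum l) (split_speed l)) mulmxBr -scalemxAr mulKVmx.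
rewrite /step mulmxDr opprD addrACA -!mulmxBr.
have -> : (2 * K) ^+ (size ds).+1 * del =
  K * ((2 * K) ^+ size ds * del) + K * ((2 * K) ^+ size ds * del).
  by rewrite exprS; ring.
apply: (le_trans (ler_normD _ _)); apply: lerD.
  apply: le_trans (ler_wpM2l K0 h1); apply: (@invA_bound _ _ l).
  by left; rewrite mulKVmx.
apply: le_trans (ler_wpM2l K0 h2); apply: (@invA_bound _ _ l).
by right; rewrite mulKVmx.
Qed.

End Consistency.

Section Lattice.
Variables (tau Lam : R).
Hypothesis tau0 : 0 < tau.
Hypothesis LamM : forall l, lM l <= Lam.
Hypothesis Lamm : forall l, - lm l <= Lam.

Definition slice (t : R) : set 'rV[R]_m :=
  [set x | forall l, lM l * t <= x 0 l <= 1 + lm l * t].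

Definition ncell l : nat := Num.truncn (wd l * tau)^-1.

Hypothesis hN : forall l, (ncell l <= N)%N.

(* The lattice moves with the leftmost characteristics, and its spacing makes
   the rightmost ones pass through the neighbouring node. *)
Definition pt k (j : T) : 'rV[R]_m :=
  \row_l (lM l * (k%:R * tau) + (j l)%:R * (wd l * tau)).

(** A slice narrows by [wd l * tau], one cell of the lattice, per time level. Lowering the index
    bound by one each time keeps the right neighbours of admissible nodes admissible on the level
    below. *)
Definition inbox k (j : T) : bool := [forall l, (j l + k <= ncell l)%N].

Definition on_lattice (v : 'rV[R]_m -> R -> 'cV[R]_n) k (j : T) : 'cV[R]_n :=
  if inbox k j then v (pt k j) (k%:R * tau) else 0.

(** At the scale [tau] around (x, t) the function is affine up to [del * tau], with slopes that
    satisfy the equation up to [del]. Piecewise multilinear functions as well as dilated solutions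
    qualify, and the notion is stable under differences. *)
Definition approx_sol (del : R) (v : 'rV[R]_m -> R -> 'cV[R]_n) : Prop :=
  forall x t, 0 <= t -> slice (t + tau) x ->
  exists (gt : 'cV[R]_n) (g : 'I_m -> 'cV[R]_n),
  [/\ `|A *m gt + \sum_l B l *m g l| <= del,
      `|v x (t + tau) - v x t - tau *: gt| <= del * tau &
      forall z l s, slice t z -> slice t (z + s *: delta_mx 0 l) ->
        (forall i, `|z 0 i - x 0 i| <= Lam * tau) -> `|s| <= Lam * tau ->
        `|v (z + s *: delta_mx 0 l) t - v z t - s *: g l| <= del * tau].

Lemma wtau_gt0 l : 0 < wd l * tau.
Proof. by rewrite mulr_gt0 // width_gt0. Qed.

Lemma inbox_coord k l (i : nat) : (i + k <= ncell l)%N ->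
  lM l * (k%:R * tau) <= lM l * (k%:R * tau) + i%:R * (wd l * tau)
    <= 1 + lm l * (k%:R * tau).
Proof.
move=> ik; have w0 := wtau_gt0 l.
have : (i + k)%:R <= (wd l * tau)^-1.
  by rewrite -truncn_ge_nat // invr_ge0 ltW.
rewrite -(ler_pM2r w0) mulVf ?gt_eqF // natrD mulrDl => h.
have := mulr_ge0 (ler0n R i) (ltW w0); move: h; rewrite /wd.
set x := i%:R * _; move: (k%:R) => y h x0.
apply/andP; split; first by lra.
have : y * ((lM l - lm l) * tau) = lM l * (y * tau) - lm l * (y * tau) by ring.
lra.
Qed.

Lemma inbox_slice k j : inbox k j -> slice (k%:R * tau) (pt k j).
Proof. by move=> /forallP h l; rewrite mxE; apply: inbox_coord; exact: h. Qed.

Lemma slice_le t x : slice (t + tau) x -> slice t x.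
Proof.
move=> h l; have := h l; have := lM0 l; have := lm0 l; rewrite !mulrDr => a b.
have := mulr_gt0 b tau0; have : lm l * tau < 0 by rewrite pmulr_llt0.
by move=> c d /andP[e f]; apply/andP; split; lra.
Qed.

(** Invariant of the descent: the coordinates of [z] in the directions [ds] still to be treated are
    those of the node on level k + 1, the others are already those of a node on level k. Every edge
    of the tree changes one coordinate at the fixed time k tau and costs one [del]; the intermediate
    points need not be lattice nodes but stay in the slice. *)
Lemma good_lattice (v : 'rV[R]_m -> R -> 'cV[R]_n) (del : R) k (j : T)
    (g : 'I_m -> 'cV[R]_n) (ds : seq 'I_m) :
  inbox k.+1 j -> uniq ds -> 0 <= del ->
  (forall z l s, slice (k%:R * tau) z -> slice (k%:R * tau) (z + s *: delta_mx 0 l) ->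
        (forall i, `|z 0 i - pt k.+1 j 0 i| <= Lam * tau) -> `|s| <= Lam * tau ->
        `|v (z + s *: delta_mx 0 l) (k%:R * tau) - v z (k%:R * tau) - s *: g l| <= del) ->
  forall (j' : T) (z : 'rV[R]_m) (v0 : 'cV[R]_n) (del0 : R),
  (forall l, if l \in ds then j' l = j l /\ z 0 l = pt k.+1 j 0 l
    else ((j' l = j l :> nat) \/ (j' l = (j l).+1 :> nat)) /\ z 0 l = pt k j' 0 l) ->
  `|v z (k%:R * tau) - v0| <= del0 ->
  good tau g (on_lattice v k) (del0 + (size ds)%:R * del) ds v0 j'.
Proof.
move=> /forallP jb uds del_ge0 hv.
(* Hence the cyclic successor of [j l] is the ordinary one. *)
have jn l : (j l < N)%N by have := jb l; have := hN l; lia.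
have xs : slice (k%:R * tau) (pt k.+1 j).
  apply: slice_le; rewrite -[X in _ + X]mul1r -mulrDl natr1.
  by apply: inbox_slice; apply/forallP.
have inv_slice (ds' : seq 'I_m) (j' : T) (z : 'rV[R]_m) :
  (forall l, if l \in ds' then j' l = j l /\ z 0 l = pt k.+1 j 0 l
    else ((j' l = j l :> nat) \/ (j' l = (j l).+1 :> nat)) /\ z 0 l = pt k j' 0 l) ->
  slice (k%:R * tau) z.
  move=> h l; have := h l; case: ifP => _ [j'l ->]; first exact: xs.
  rewrite mxE; apply: inbox_coord; have := jb l.
  by case: j'l => ->; lia.
have ptE (c : R) : c * (k.+1%:R * tau) = c * (k%:R * tau) + c * tau.
  by rewrite -natr1; ring.
have inv_near (ds' : seq 'I_m) (j' : T) (z : 'rV[R]_m) :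
  (forall l, if l \in ds' then j' l = j l /\ z 0 l = pt k.+1 j 0 l
    else ((j' l = j l :> nat) \/ (j' l = (j l).+1 :> nat)) /\ z 0 l = pt k j' 0 l) ->
  forall l, `|z 0 l - pt k.+1 j 0 l| <= Lam * tau.
  have L0 (l : 'I_m) : 0 <= Lam * tau.
    by rewrite mulr_ge0 ?ltW //; apply: lt_le_trans (LamM l).
  move=> h l; have := h l; case: ifP => _ [j'l ->]; first by rewrite subrr normr0 L0.
  rewrite !mxE (ptE (lM l)); case: j'l => ->.
    rewrite (_ : _ - _ = - (lM l * tau)); last by ring.
    rewrite normrN ger0_norm; last by rewrite mulr_ge0 // ltW.
    by apply: ler_wpM2r; rewrite // ltW.
  rewrite -natr1 (_ : _ - _ = - lm l * tau); last by rewrite /wd; ring.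
  rewrite ger0_norm; last by rewrite mulr_ge0 ?ltW // oppr_gt0.
  by apply: ler_wpM2r; rewrite // ltW.
elim: ds uds => [_|l ds IH /= /andP[lds uds]] j' z v0 del0 inv hz /=.
  rewrite mul0r addr0 /on_lattice.
  have jb' : inbox k j'.
    apply/forallP => l; have [[-> | ->] _] := inv l; have := jb l; lia.
  rewrite jb'; suff <- : z = pt k j' by [].
  by apply/rowP => l; have [_] := inv l.
have zs := inv_slice _ _ _ inv; have zn := inv_near _ _ _ inv.
have [j'l zl] : j' l = j l /\ z 0 l = pt k.+1 j 0 l by have := inv l; rewrite mem_head.
have kid (j'' : T) (s : R) : `|s| <= Lam * tau ->
  (j'' l = j l :> nat) \/ (j'' l = (j l).+1 :> nat) ->
  z 0 l + s = pt k j'' 0 l -> (forall i, i != l -> j'' i = j' i) ->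
  good tau g (on_lattice v k) (del0 + (size ds).+1%:R * del) ds (v0 + s *: g l) j''.
  move=> sL j''l zs' j''i.
  have inv' : forall i, if i \in ds then j'' i = j i /\
      (z + s *: delta_mx 0 l) 0 i = pt k.+1 j 0 i
    else ((j'' i = j i :> nat) \/ (j'' i = (j i).+1 :> nat)) /\
      (z + s *: delta_mx 0 l) 0 i = pt k j'' 0 i.
    have zE i : (z + s *: delta_mx 0 l) 0 i = z 0 i + s * (i == l)%:R.
      by rewrite !mxE eqxx.
    move=> i; rewrite zE; have [il|il] := eqVneq i l.
      by subst i; rewrite (negbTE lds) mulr1.
    have := inv i; rewrite inE (negbTE il) /= mulr0 addr0 j''i //.
    by rewrite (_ : pt k j'' 0 i = pt k j' 0 i) // !mxE j''i.
  have := IH uds j'' (z + s *: delta_mx 0 l) (v0 + s *: g l) (del0 + del) inv'.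
  rewrite -natr1 mulrDl mul1r addrA addrAC -addrA; apply.
  have := hv z l s zs (inv_slice _ _ _ inv') zn sL.
  set a := v _ _; set b := v _ _ in hz *; move=> h.
  have -> : a - (v0 + s *: g l) = (b - v0) + (a - b - s *: g l).
    by apply/matrixP => p q; rewrite !mxE; ring.
  by apply: (le_trans (ler_normD _ _)); apply: lerD.
rewrite -(scaleNr (lM l * tau)) -(scaleNr (lm l * tau)); split; apply: kid.
- rewrite normrN ger0_norm; last by rewrite mulr_ge0 // ltW.
  by apply: ler_wpM2r; rewrite // ltW.
- by left; rewrite j'l.
- by rewrite zl !mxE j'l (ptE (lM l)); ring.
- by [].
- rewrite -mulNr ger0_norm; last by rewrite mulr_ge0 ?ltW // oppr_gt0.
  by apply: ler_wpM2r; rewrite // ltW.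
- by right; rewrite ffunE eqxx j'l /= modn_small // ltnS.
- rewrite zl !mxE ffunE eqxx j'l /= modn_small ?ltnS // (ptE (lM l)) -natr1 /wd.
  by ring.
- by move=> i il; rewrite ffunE (negbTE il).
Qed.

(** The three terms are the residual of the equation, to which the inverse of A is applied, the
    error of the time difference, and the errors at the leaves after the m partial steps. *)
Definition stab_const : R := K * n%:R + 1 + (2 * K) ^+ m * m%:R.

Lemma stab_const_gt0 : 0 < stab_const.
Proof.
rewrite /stab_const addrAC ltr_pwDr // addr_ge0 // mulr_ge0 //.
by rewrite exprn_ge0 // mulr_ge0.
Qed.

Lemma one_step v del k (j : T) : 0 <= del -> approx_sol del v -> inbox k.+1 j ->
  `|on_lattice v k.+1 j - foldr step (on_lattice v k) (enum 'I_m) j|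
    <= stab_const * del * tau.
Proof.
move=> del0 hv jb; set t := k%:R * tau; set x := pt k.+1 j.
have t0 : 0 <= t by rewrite mulr_ge0 // ltW.
have tE : k.+1%:R * tau = t + tau by rewrite -natr1 mulrDl mul1r.
have xs : slice (t + tau) x by rewrite -tE; exact: inbox_slice.
have [gt [g [hres ht hx]]] := hv x t t0 xs.
have := @good_lattice v (del * tau) k j g (enum 'I_m) jb (enum_uniq _)
  (mulr_ge0 del0 (ltW tau0)) hx j x (v x t) 0.
move=> /(_ _)/wrap [|]; first by move=> l; rewrite mem_enum.
move=> /(_ _)/wrap [|]; first by rewrite subrr normr0.
rewrite add0r size_enum_ord => /good_steps -/(_ _)/wrap [|].
  by rewrite mulr_ge0 // mulr_ge0 // ltW.
pose S := \sum_(l < m) invmx A *m (B l *m g l).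
have -> : \sum_(l <- enum 'I_m) invmx A *m (B l *m g l) = S.
  by rewrite big_enum; apply: eq_bigl.
have -> : on_lattice v k.+1 j = v x (t + tau) by rewrite /on_lattice jb tE.
rewrite size_enum_ord; set F := foldr _ _ _ _ => hF.
have hr := invA_norm_le (A *m gt + \sum_l B l *m g l).
have eS : invmx A *m (A *m gt + \sum_l B l *m g l) = gt + S.
  by rewrite mulmxDr mulKmx // mulmx_sumr.
rewrite eS in hr.
have -> : v x (t + tau) - F =
   (v x (t + tau) - v x t - tau *: gt) + tau *: (gt + S) - (F - (v x t - tau *: S)).
  by apply/matrixP => a b; rewrite !mxE; ring.
apply: (le_trans (ler_normD _ _)); rewrite normrN.
apply: (le_trans (lerD (ler_normD _ _) (lexx _))).
rewrite normrZ (gtr0_norm tau0).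
have h1 : tau * `|gt + S| <= tau * (K * (n%:R * del)).
  rewrite ler_wpM2l ?(ltW tau0) //; apply: (le_trans hr).
  by rewrite !ler_wpM2l.
apply: (le_trans (lerD (lerD ht h1) hF)).
by rewrite le_eqVlt; apply/orP; left; apply/eqP; rewrite /stab_const; ring.
Qed.

Definition cnt : R := \sum_(j : T) (inbox 0 j)%:R.
Definition vol : R := \prod_l (wd l * tau).

Lemma vol_gt0 : 0 < vol. Proof. by apply: prodr_gt0 => l _; exact: wtau_gt0. Qed.

Lemma inbox0 k (j : T) : inbox k j -> inbox 0 j.
Proof.
move=> /forallP h; apply/forallP => l; rewrite addn0.
by apply: leq_trans (h l); rewrite leq_addr.
Qed.

(** The indicator of the box factorises over the directions, and each factor contributes a length of
    at most the cell width times (1 / width + 1), that is, at most 2. *)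
Lemma vol_cnt : (forall l, wd l * tau <= 1) -> vol * cnt <= 2 ^+ m.
Proof.
move=> w1; rewrite /cnt.
have -> : \sum_(j : T) (inbox 0 j)%:R =
    \prod_(l < m) \sum_(i < N.+1) (i <= ncell l)%N%:R :> R.
  rewrite bigA_distr_bigA /=; apply: eq_bigr => j _.
  rewrite -natr_prod /inbox; congr (_%:R).
  under eq_forallb => l do rewrite addn0.
  apply/esym; case: (boolP [forall l, (j l <= ncell l)%N]) => [/forallP h|].
    by rewrite big1 // => l _; rewrite h.
  rewrite negb_forall => /existsP[l hl]; rewrite (bigD1 l) //= (negbTE hl).
  by rewrite mul0n.
rewrite /vol -big_split /= -[m in 2 ^+ m]card_ord -prodr_const.
apply: ler_prod => l _; apply/andP; split.
  by rewrite mulr_ge0 ?(ltW (wtau_gt0 l)) ?sumr_ge0.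
have -> : \sum_(i < N.+1) (i <= ncell l)%N%:R = (ncell l).+1%:R :> R.
  rewrite -natr_sum; congr (_%:R).
  exact: (@sum_lt N.+1 (ncell l).+1 (hN l)).
rewrite -natr1 mulrDr mulr1 -[2]/(1 + 1); apply: lerD => //.
have h : (ncell l)%:R <= (wd l * tau)^-1.
  by rewrite truncn_le invr_ge0 ltW // wtau_gt0.
apply: (le_trans (ler_wpM2l (ltW (wtau_gt0 l)) h)).
by rewrite mulfV // gt_eqF // wtau_gt0.
Qed.

(** The root of the energy grows linearly: a level adds an error e to a norm M that the scheme does
    not increase. In terms of squares this is [qf_add_le] with eta = e / M, for which (1 + eta) M^2
    + (1 + 1/eta) e^2 = (M + e)^2; the positive [eps] keeps M away from zero. *)
Lemma energy_bound v del eps : 0 < del -> 0 < eps -> approx_sol del v ->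
  (forall x, slice 0 x -> `|v x 0| <= eps) ->
  forall k, energy (on_lattice v k) <=
    cnt * K * (eps + k%:R * (stab_const * del * tau)) ^+ 2.
Proof.
move=> del0 eps0 hv hv0; set e := stab_const * del * tau.
have e0 : 0 < e by rewrite !mulr_gt0 // stab_const_gt0.
elim=> [|k IH].
  rewrite mul0r addr0 /cnt !mulr_suml; apply: ler_sum => j _.
  rewrite /on_lattice; case: ifP => jb /=; last by rewrite qf0 !mul0r.
  rewrite mul1r mul0r; apply: (le_trans (proj1 (cA _))).
  apply: ler_wpM2l => //; rewrite ler_pXn2r ?nnegrE ?(ltW eps0) //.
  by apply: hv0; have := inbox_slice jb; rewrite mul0r.
set M0 := eps + k%:R * e in IH.
have M00 : 0 < M0 by rewrite /M0 ltr_pwDl // mulr_ge0 // ltW.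
have psdA : psd A.
  split=> // w; have [_] := cA w; have := sqr_ge0 `|w| => a b.
  have c : 0 <= K * qf A w by exact: le_trans b.
  have [K00|K00] := eqVneq K 0.
    move: b; rewrite K00 mul0r => b.
    have : `|w| ^+ 2 == 0 by rewrite eq_le b a.
    by rewrite sqrf_eq0 normr_eq0 => /eqP ->; rewrite qf0.
  by move: c; rewrite pmulr_rge0 // lt_neqAle eq_sym K00.
set eta := e / M0; have eta0 : 0 < eta by rewrite divr_gt0.
pose FV := foldr step (on_lattice v k) (enum 'I_m).
have EF : energy FV <= cnt * K * M0 ^+ 2 by exact: le_trans (energy_steps _ _) IH.
apply: (@le_trans _ _ (\sum_(j : T) ((1 + eta) * qf A (FV j) +
    (1 + eta^-1) * ((inbox 0 j)%:R * (K * e ^+ 2))))).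
  apply: ler_sum => j _; have eta1 : 0 < eta^-1 by rewrite invr_gt0.
  have [jb|jb] := boolP (inbox k.+1 j); last first.
    rewrite /on_lattice (negbTE jb) qf0; apply: addr_ge0; apply: mulr_ge0.
    - by lra.
    - by case: psdA.
    - by lra.
    - by rewrite mulr_ge0 // mulr_ge0 // sqr_ge0.
  rewrite (inbox0 jb) mul1r.
  have -> : on_lattice v k.+1 j = FV j + (on_lattice v k.+1 j - FV j).
    by rewrite addrC subrK.
  apply: (le_trans (qf_add_le _ _ psdA eta0)); apply: lerD => //.
  apply: ler_wpM2l; first by lra.
  apply: (le_trans (proj1 (cA _))); apply: ler_wpM2l => //.
  rewrite ler_pXn2r ?nnegrE ?(ltW e0) //.
  by apply: one_step => //; exact: ltW.
rewrite big_split /= -!mulr_sumr -mulr_suml -/cnt -/(energy FV).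
apply: (@le_trans _ _ ((1 + eta) * (cnt * K * M0 ^+ 2) + (1 + eta^-1) * (cnt * (K * e ^+ 2)))).
  by apply: lerD => //; apply: ler_wpM2l => //; lra.
rewrite le_eqVlt; apply/orP; left; apply/eqP.
have -> : eps + k.+1%:R * e = M0 + e by rewrite /M0 -natr1; ring.
by rewrite /eta; field; rewrite !gt_eqF.
Qed.

(** A Riemann sum for the squared max norm over the slice at the time k tau. *)
Definition lsum (v : 'rV[R]_m -> R -> 'cV[R]_n) k : R :=
  vol * \sum_(j : T) `|on_lattice v k j| ^+ 2.

Lemma lsum_energy v del eps k : (forall l, wd l * tau <= 1) ->
  0 < del -> 0 < eps -> approx_sol del v ->
  (forall x, slice 0 x -> `|v x 0| <= eps) ->
  lsum v k <= 2 ^+ m * K ^+ 2 * (eps + stab_const * del * (k%:R * tau)) ^+ 2.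
Proof.
move=> w1 del0 eps0 hv hv0; have := energy_bound del0 eps0 hv hv0 k.
set X := eps + k%:R * _; have -> : eps + stab_const * del * (k%:R * tau) = X.
  by rewrite /X; ring.
move=> h; apply: (@le_trans _ _ (vol * (K * (cnt * K * X ^+ 2)))).
  rewrite /lsum ler_wpM2l ?(ltW vol_gt0) //; apply: le_trans (ler_wpM2l K0 h).
  by rewrite /energy mulr_sumr; apply: ler_sum => j _; case: (cA (on_lattice v k j)).
have -> : vol * (K * (cnt * K * X ^+ 2)) = (vol * cnt) * K ^+ 2 * X ^+ 2 by ring.
by rewrite !ler_wpM2r ?sqr_ge0 // vol_cnt.
Qed.

Lemma lsumD v v' k : lsum (fun x t => v x t + v' x t) k <= 2 * (lsum v k + lsum v' k).
Proof.
rewrite /lsum -mulrDr mulrCA ler_wpM2l ?(ltW vol_gt0) // -big_split mulr_sumr.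
apply: ler_sum => j _ /=.
have -> : on_lattice (fun x t => v x t + v' x t) k j = on_lattice v k j + on_lattice v' k j.
  by rewrite /on_lattice; case: ifP => //; rewrite addr0.
set a := on_lattice v k j; set b := on_lattice v' k j.
have h : `|a + b| ^+ 2 <= (`|a| + `|b|) ^+ 2.
  by rewrite ler_pXn2r ?nnegrE ?addr_ge0 // ler_normD.
apply: (le_trans h); have := sqr_ge0 (`|a| - `|b|); rewrite !expr2; lra.
Qed.

Lemma lsum_sup v eta k : (forall l, wd l * tau <= 1) -> 0 <= eta ->
  (forall x, slice (k%:R * tau) x -> `|v x (k%:R * tau)| <= eta) ->
  lsum v k <= 2 ^+ m * eta ^+ 2.
Proof.
move=> w1 eta0 h; apply: le_trans (ler_wpM2r (sqr_ge0 eta) (vol_cnt w1)).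
rewrite /lsum -mulrA ler_wpM2l ?(ltW vol_gt0) // /cnt mulr_suml.
apply: ler_sum => j _; rewrite /on_lattice; case: ifP => jb; last first.
  by rewrite normr0 expr0n /= mulr_ge0 // sqr_ge0.
rewrite (inbox0 jb) mul1r ler_pXn2r ?nnegrE //.
by apply: h; exact: inbox_slice.
Qed.

(* The cells of the lattice cover the slice. *)
Lemma integral_slice_le v k eta : (forall l, wd l * tau <= 1) -> 0 <= eta ->
  (forall x y, slice (k%:R * tau) x -> slice (k%:R * tau) y ->
     (forall l, `|x 0 l - y 0 l| <= wd l * tau) ->
     `|v x (k%:R * tau)| ^+ 2 <= `|v y (k%:R * tau)| ^+ 2 + eta) ->
  (integral_Rd (fun x => (\1_(slice (k%:R * tau)) x * enorm (v x (k%:R * tau)) ^+ 2)%:E)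
    <= (n%:R * (lsum v k + 2 ^+ m * eta))%:E)%E.
Proof.
move=> w1 eta0 hv; set t := k%:R * tau in hv *.
pose c (j : T) : R := n%:R * (`|on_lattice v k j| ^+ 2 + (inbox 0 j)%:R * eta).
have c0 j : 0 <= c j by rewrite mulr_ge0 // addr_ge0 ?sqr_ge0 // mulr_ge0.
have := @integral_Rd_cells R m T c (fun j l => pt k j 0 l) (fun _ l => wd l * tau)
  c0 (fun _ l => wtau_gt0 l).
move=> h; apply: (@le_trans _ _ (\sum_i c i * \prod_l (wd l * tau))%:E); last first.
  rewrite lee_fin -mulr_suml -/vol /c -mulr_sumr big_split /= -mulr_suml -/cnt.
  rewrite -mulrA ler_wpM2l // mulrC mulrDr mulrA lerD2l.
  by rewrite ler_wpM2r // vol_cnt.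
rewrite -h; apply: le_integral_Rd => x; rewrite lee_fin.
  by rewrite mulr_ge0 ?sqr_ge0 // indicE.
rewrite indicE; case: (boolP (x \in slice t)) => [|_]; last first.
  by rewrite mul0r; apply: sumr_ge0 => j _; rewrite mulr_ge0 // prodr_ge0.
rewrite inE mul1r => xs.
(* Index of the lower corner of the cell that contains x. It is admissible because x lies in the
   slice. *)
pose f l : nat := Num.truncn ((x 0 l - lM l * t) / (wd l * tau)).
have f0 l : 0 <= (x 0 l - lM l * t) / (wd l * tau).
  rewrite divr_ge0 ?(ltW (wtau_gt0 l)) // subr_ge0.
  by have /andP[] := xs l.
have fl l : (f l)%:R <= (x 0 l - lM l * t) / (wd l * tau).
  by have /andP[] := truncn_itv (f0 l).
have fu l : (x 0 l - lM l * t) / (wd l * tau) < (f l).+1%:R.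
  by have /andP[] := truncn_itv (f0 l).
have fk l : (f l + k <= ncell l)%N.
  rewrite truncn_ge_nat ?invr_ge0 ?(ltW (wtau_gt0 l)) // natrD.
  rewrite -(ler_pM2r (wtau_gt0 l)) mulVf ?gt_eqF ?wtau_gt0 // mulrDl.
  have := fl l; rewrite ler_pdivlMr ?wtau_gt0 // => h1.
  have /andP[_ h2] := xs l.
  have : k%:R * (wd l * tau) = lM l * t - lm l * t by rewrite /t /wd; ring.
  by rewrite -/(f l) in h1; move=> ->; lra.
have fN l : (f l < N.+1)%N.
  by rewrite ltnS; apply: leq_trans (hN l); apply: leq_trans (fk l); rewrite leq_addr.
pose j : T := [ffun l => Ordinal (fN l)].
have jb : inbox k j by apply/forallP => l; rewrite ffunE; exact: fk.
have xj l : pt k j 0 l <= x 0 l < pt k j 0 l + wd l * tau.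
  rewrite mxE ffunE /= -/t; move: (fl l) (fu l).
  rewrite ler_pdivlMr ?wtau_gt0 // ltr_pdivrMr ?wtau_gt0 // -natr1 (mulrDl _ 1) mul1r.
  by move=> h1 h2; apply/andP; split; lra.
rewrite (bigD1 j) //=.
apply: (@le_trans _ _ (c j)).
  apply: (le_trans (sqr_enorm_le _)); rewrite /c ler_wpM2l //.
  rewrite (inbox0 jb) mul1r /on_lattice jb; apply: hv => //.
    exact: inbox_slice.
  move=> l; have /andP[h1 h2] := xj l.
  by rewrite ger0_norm ?subr_ge0 // lerBlDl ltW.
have -> : \prod_(l < m) \1_(`[pt k j 0 l, pt k j 0 l + wd l * tau[) (x 0 l) = 1 :> R.
  apply: big1 => l _; rewrite indicE mem_set //= in_itv /=; exact: xj.
by rewrite mulr1 lerDl; apply: sumr_ge0 => j' _; rewrite mulr_ge0 // prodr_ge0.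
Qed.

End Lattice.

End Scheme.

(** * Multilinear interpolation *)

Section Multilinear.
Context {R : realType} {d n : nat}.
Variable h : 'I_d -> R.
Hypothesis h0 : forall i, 0 < h i.
Implicit Types (c y : 'I_d -> nat) (x z : 'rV[R]_d) (F f : 'rV[R]_d -> 'cV[R]_n).

Definition sep_affine c F : Prop := forall x x' i,
  grid_cell h c x -> grid_cell h c x' -> (forall j, j != i -> x ord0 j = x' ord0 j) ->
  forall a : R, 0 <= a <= 1 -> F (a *: x + (1 - a) *: x') = a *: F x + (1 - a) *: F x'.

Definition corner c (b : 'I_d -> bool) : 'rV[R]_d := \row_i ((c i + b i)%:R * h i).

Definition set_coord x l (a : R) : 'rV[R]_d := \row_i (if i == l then a else x 0 i).

Definition convex_pred (P : set 'cV[R]_n) : Prop :=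
  forall u v a, P u -> P v -> 0 <= a <= 1 -> P (a *: u + (1 - a) *: v).

Lemma set_coord_cell c x l a : grid_cell h c x ->
  (c l)%:R * h l <= a <= (c l).+1%:R * h l -> grid_cell h c (set_coord x l a).
Proof. by move=> cx ca i; rewrite mxE; case: eqP => [->|_]. Qed.

Definition cell_frac c x i : R := x 0 i / h i - (c i)%:R.

Lemma cell_frac01 c x i : grid_cell h c x -> 0 <= cell_frac c x i <= 1.
Proof.
move=> /(_ i) /andP[h1 h2]; rewrite /cell_frac.
have h3 : (c i)%:R <= x 0 i / h i by rewrite ler_pdivlMr.
have h4 : x 0 i / h i <= (c i)%:R + 1 by rewrite natr1 ler_pdivrMr.
by apply/andP; split; lra.
Qed.

Lemma set_coord_comb c x l : x = (1 - cell_frac c x l) *: set_coord x l ((c l)%:R * h l) +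
  (1 - (1 - cell_frac c x l)) *: set_coord x l ((c l).+1%:R * h l).
Proof.
apply/rowP => i; rewrite !mxE; case: eqP => [->|_]; last by ring.
by rewrite -natr1 /cell_frac; field; rewrite gt_eqF.
Qed.

(** Coordinates are moved to the faces of the cell one at a time: a point lies between its
    projections to two opposite faces, and [F] is affine on the segment joining them. The list [s]
    holds the coordinates not yet moved. *)
Lemma cell_convex c F P : sep_affine c F -> convex_pred P ->
  (forall b, P (F (corner c b))) -> forall x, grid_cell h c x -> P (F x).
Proof.
move=> aF cP hP.
suff key : forall (s : seq 'I_d) x, grid_cell h c x ->
    (forall i, i \notin s -> x 0 i = (c i)%:R * h i \/ x 0 i = (c i).+1%:R * h i) ->
    P (F x).
  by move=> x cx; apply: (key (enum 'I_d)) => // i; rewrite mem_enum.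
elim=> [|l s IH] x cx hx.
  suff -> : x = corner c (fun i => x 0 i != (c i)%:R * h i) by [].
  apply/rowP => i; rewrite mxE; case: eqP => [e|ne] /=; first by rewrite addn0.
  by rewrite addn1; case: (hx i) => // /ne.
have cl : (c l)%:R * h l <= (c l).+1%:R * h l by rewrite ler_pM2r // ler_nat.
have c1 : grid_cell h c (set_coord x l ((c l)%:R * h l)).
  by apply: set_coord_cell => //; rewrite lexx.
have c2 : grid_cell h c (set_coord x l ((c l).+1%:R * h l)).
  by apply: set_coord_cell => //; rewrite lexx andbT.
have /andP[f0 f1] := cell_frac01 l cx.
rewrite (set_coord_comb c x l) (aF _ _ l) //; last 2 first.
- by move=> j jl; rewrite !mxE (negbTE jl).
- by apply/andP; split; lra.
apply: cP; last by apply/andP; split; lra.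
  apply: IH => // i il; rewrite mxE; case: eqP => [->|/eqP ne]; first by left.
  by apply: hx; rewrite inE negb_or ne.
apply: IH => // i il; rewrite mxE; case: eqP => [->|/eqP ne]; first by right.
by apply: hx; rewrite inE negb_or ne.
Qed.

Lemma sep_affineB c F F' : sep_affine c F -> sep_affine c F' ->
  sep_affine c (fun x => F x - F' x).
Proof.
move=> aF aF' x x' i cx cx' e a a01; rewrite (aF _ _ i) // (aF' _ _ i) //.
by apply/matrixP => p q; rewrite !mxE; ring.
Qed.

Lemma convex_ball (v : 'cV[R]_n) (e : R) : convex_pred [set u | `|u - v| <= e].
Proof.
move=> u w a /= hu hw /andP[a0 a1].
have -> : a *: u + (1 - a) *: w - v = a *: (u - v) + (1 - a) *: (w - v).
  by apply/matrixP => p q; rewrite !mxE; ring.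
apply: (le_trans (ler_normD _ _)); rewrite !normrZ ger0_norm // ger0_norm ?subr_ge0 //.
have h1 := ler_wpM2l a0 hu.
have h2 : (1 - a) * `|w - v| <= (1 - a) * e by apply: ler_wpM2l; rewrite ?subr_ge0.
by lra.
Qed.

Lemma convex_ball0 (e : R) : convex_pred [set u | `|u| <= e].
Proof. by have := @convex_ball 0 e; under eq_set do rewrite subr0. Qed.

Definition weight (b : bool) (t : R) : R := if b then t else 1 - t.

Definition corner_formula c (G : {ffun 'I_d -> bool} -> 'cV[R]_n) x : 'cV[R]_n :=
  \sum_(b : {ffun 'I_d -> bool}) (\prod_i weight (b i) (cell_frac c x i)) *: G b.

Lemma corner_formula_affine c G : sep_affine c (corner_formula c G).
Proof.
move=> x x' i cx cx' e a a01.
rewrite /corner_formula !scaler_sumr -big_split; apply: eq_bigr => b _ /=.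
rewrite !scalerA -scalerDl; congr (_ *: _).
rewrite (bigD1 i) //= [in RHS](bigD1 i) //= [X in _ = _ + (1 - a) * X](bigD1 i) //=.
have ej : forall y : 'rV[R]_d, (forall j, j != i -> y 0 j = x 0 j) ->
    \prod_(j | j != i) weight (b j) (cell_frac c y j) = \prod_(j | j != i) weight (b j) (cell_frac c x j).
  by move=> y hy; apply: eq_bigr => j ji; rewrite /cell_frac hy.
rewrite [in LHS](ej _) 1?(ej x') //; last 2 first.
- by move=> j ji; rewrite e.
- by move=> j ji; rewrite !mxE -e //; ring.
rewrite !mulrA -mulrDl; congr (_ * _); rewrite /weight /cell_frac !mxE.
by case: (b i); ring.
Qed.

Lemma frac_corner c b i : cell_frac c (corner c b) i = (b i)%:R.
Proof. by rewrite /cell_frac mxE mulfK ?gt_eqF // natrD addrAC subrr add0r. Qed.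

Lemma corner_formula_corner c G (b : {ffun 'I_d -> bool}) :
  corner_formula c G (corner c b) = G b.
Proof.
rewrite /corner_formula (bigD1 b) //= big1 ?scale1r; last first.
  by move=> i _; rewrite frac_corner /weight; case: (b i); rewrite ?subr0.
rewrite big1 ?addr0 // => b' bb'.
have [i hi] : exists i, b' i != b i.
  apply/existsP; move: bb'; apply: contraR; rewrite negb_exists => /forallP e.
  by apply/eqP/ffunP => i; apply/eqP; have := e i; rewrite negbK.
rewrite (bigD1 i) //= frac_corner /weight.
have -> : (if b' i then (b i)%:R else 1 - (b i)%:R) = 0 :> R.
  by move: hi; case: (b' i) (b i) => -[] //= _; rewrite subrr.
by rewrite mul0r scale0r.
Qed.

(** The difference of the two sides is separately affine and vanishes at the corners, so
    [cell_convex] applies with the convex set of zero alone. *)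
Lemma sep_affine_formula c F x : sep_affine c F -> grid_cell h c x ->
  F x = corner_formula c (fun b => F (corner c b)) x.
Proof.
move=> aF cx; apply/eqP; rewrite -subr_eq0; apply/eqP.
apply: (@cell_convex c (fun x => F x - corner_formula c (fun b => F (corner c b)) x)
   [set 0]) => //.
- exact: sep_affineB (corner_formula_affine _).
- by move=> u v a /= -> -> _; rewrite !scaler0 addr0.
- move=> b /=; have -> : corner c b = corner c (finfun b).
    by apply/rowP => i; rewrite !mxE ffunE.
  by rewrite corner_formula_corner subrr.
Qed.

(** The difference of [f] between the two faces orthogonal to [l] is again separately affine, so its
    distance from [h l *: G] is controlled by the edges. As [f] is affine along [l], an increment
    [s] receives the fraction [s / h l] of it. *)
Lemma slope_in_cell c f l (G : 'cV[R]_n) e z s : sep_affine c f ->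
  grid_cell h c z -> grid_cell h c (z + s *: delta_mx 0 l) ->
  (forall b : 'I_d -> bool, b l = false ->
    `|f (corner c (fun i => b i || (i == l))) - f (corner c b) - h l *: G| <= h l * e) ->
  `|f (z + s *: delta_mx 0 l) - f z - s *: G| <= `|s| * e.
Proof.
move=> af cz cz' hb.
have cl : (c l)%:R * h l <= (c l).+1%:R * h l by rewrite ler_pM2r // ler_nat.
pose lo x := set_coord x l ((c l)%:R * h l).
pose hi x := set_coord x l ((c l).+1%:R * h l).
have clo x : grid_cell h c x -> grid_cell h c (lo x).
  by move=> cx; apply: set_coord_cell => //; rewrite lexx.
have chi x : grid_cell h c x -> grid_cell h c (hi x).
  by move=> cx; apply: set_coord_cell => //; rewrite lexx andbT.
pose F x := f (hi x) - f (lo x) - h l *: G.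
have aF : sep_affine c F.
  move=> x x' i cx cx' ex a a01; rewrite /F.
  have comb (k : R) : set_coord (a *: x + (1 - a) *: x') l k =
      a *: set_coord x l k + (1 - a) *: set_coord x' l k.
    by apply/rowP => p; rewrite !mxE; case: eqP => // _; ring.
  have agree (k : R) j : j != i -> set_coord x l k ord0 j = set_coord x' l k ord0 j.
    by move=> ji; rewrite !mxE; case: eqP => // _; exact: ex.
  rewrite /hi /lo !comb (af (hi x) (hi x') i) //; try exact: agree; try exact: chi.
  rewrite (af (lo x) (lo x') i) //; try exact: agree; try exact: clo.
  by rewrite /hi /lo; apply/matrixP => p q; rewrite !mxE; ring.
have bnd : `|F z| <= h l * e.
  apply: (cell_convex aF (@convex_ball0 (h l * e))) => // b /=.
  have := hb (fun i => b i && (i != l)); rewrite eqxx andbF => /(_ erefl).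
  rewrite /F; congr (`|f _ - f _ - _| <= _); apply/rowP => i; rewrite !mxE.
    by case: eqP => [->|_]; rewrite ?eqxx ?orbT ?addn1 ?andbT ?orbF.
  by case: eqP => [->|_]; rewrite ?eqxx ?andbF ?addn0 ?andbT.
have line x : grid_cell h c x -> f x = (1 - cell_frac c x l) *: f (lo x) + cell_frac c x l *: f (hi x).
  move=> cx; have /andP[f0 f1] := cell_frac01 l cx.
  rewrite {1}(set_coord_comb c x l) (af _ _ l); first by congr (_ + _ *: _); ring.
  - exact: clo.
  - exact: chi.
  - by move=> j jl; rewrite !mxE (negbTE jl).
  - by apply/andP; split; lra.
have same k : set_coord (z + s *: delta_mx 0 l) l k = set_coord z l k.
  apply/rowP => i; rewrite !mxE; case: eqP => // /eqP il.
  by rewrite andbF mulr0 addr0.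
have fr : cell_frac c (z + s *: delta_mx 0 l) l = cell_frac c z l + s / h l.
  by rewrite /cell_frac !mxE !eqxx mulr1; ring.
rewrite (line _ cz') (line _ cz) /lo /hi !same -/(lo z) -/(hi z) fr.
have -> : (1 - (cell_frac c z l + s / h l)) *: f (lo z) + (cell_frac c z l + s / h l) *: f (hi z) -
   ((1 - cell_frac c z l) *: f (lo z) + cell_frac c z l *: f (hi z)) - s *: G = (s / h l) *: F z.
  apply/matrixP => p q; rewrite /F !mxE; have := h0 l.
  by move: (h l) => k k0; field; rewrite gt_eqF.
rewrite normrZ normrM normfV (gtr0_norm (h0 l)) -mulrA ler_wpM2l //.
by rewrite mulrC ler_pdivrMr // mulrC.
Qed.

Lemma box_cell (K : 'I_d -> nat) x : (forall i, 0 < K i)%N -> grid_box h K x ->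
  exists2 c, (forall i, c i < K i)%N & grid_cell h c x.
Proof.
move=> K0 bx; exists (fun i => minn (Num.truncn (x 0 i / h i)) (K i).-1) => i.
  by rewrite gtn_min orbC ltn_predL K0.
have /andP[x0 xK] := bx i.
have q0 : 0 <= x 0 i / h i by rewrite divr_ge0 // ltW.
have /andP[t1 t2] := truncn_itv q0.
have [le|gt] := leqP (Num.truncn (x 0 i / h i)) (K i).-1.
  apply/andP; split; first by rewrite -ler_pdivlMr.
  by rewrite -ler_pdivrMr //; exact: ltW.
rewrite prednK // xK andbT -ler_pdivlMr //; apply: le_trans t1.
by rewrite ler_nat ltnW.
Qed.

(** A segment no longer than [h l] can be covered by two adjacent cells and is cut at their common
    face; reversing it reduces to a non-negative [s]. *)
Lemma slope_in_box (K : 'I_d -> nat) f l (G : 'cV[R]_n) e z s :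
  (forall i, 0 < K i)%N ->
  (forall c, (forall i, c i < K i)%N -> sep_affine c f) ->
  grid_box h K z -> grid_box h K (z + s *: delta_mx 0 l) -> `|s| <= h l ->
  (forall c, (forall i, c i < K i)%N ->
    (exists2 a, 0 <= a <= 1 & grid_cell h c (z + (a * s) *: delta_mx 0 l)) ->
    forall b : 'I_d -> bool, b l = false ->
    `|f (corner c (fun i => b i || (i == l))) - f (corner c b) - h l *: G| <= h l * e) ->
  `|f (z + s *: delta_mx 0 l) - f z - s *: G| <= `|s| * e.
Proof.
move=> K0.
have coordE x r i : (x + r *: delta_mx 0 l : 'rV[R]_d) 0 i = x 0 i + r * (i == l)%:R.
  by rewrite !mxE eqxx.
have addE x (r r' : R) : x + r *: delta_mx 0 l + r' *: delta_mx 0 l =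
    x + (r + r') *: delta_mx 0 l :> 'rV[R]_d.
  by rewrite scalerDl addrA.
wlog s0 : z s / 0 <= s.
  move=> H af bz bz' sh hc; have [s0|s0] := leP 0 s; first exact: H.
  have := H (z + s *: delta_mx 0 l) (- s); rewrite addE subrr scale0r addr0 normrN.
  rewrite oppr_ge0 (ltW s0) => /(_ erefl af bz' bz sh) H'.
  rewrite -normrN; suff -> : - (f (z + s *: delta_mx 0 l) - f z - s *: G) =
      f z - f (z + s *: delta_mx 0 l) - - s *: G.
    apply: H' => c cK [a /andP[a0 a1] hcell]; apply: hc => //; exists (1 - a).
      by apply/andP; split; lra.
    by move: hcell; rewrite addE; congr (grid_cell h c (_ + _ *: _)); ring.
  by apply/matrixP => p q; rewrite !mxE; ring.
move=> af bz bz' sh hc.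
have [c cK cz] := box_cell K0 bz.
have hcz : exists2 a, 0 <= a <= 1 & grid_cell h c (z + (a * s) *: delta_mx 0 l).
  by exists 0; rewrite ?lexx ?ler01 // mul0r scale0r addr0.
have [le|gt] := leP (z 0 l + s) ((c l).+1%:R * h l).
  apply: (slope_in_cell (af c cK) cz) => [i|b bl]; last exact: hc.
  rewrite coordE; case: eqP => [->|_]; last by rewrite mulr0 addr0; exact: cz.
  have /andP[c1 c2] := cz l; rewrite mulr1 le andbT.
  by apply: (le_trans c1); rewrite lerDl.
have /andP[c1 c2] := cz l.
pose r := (c l).+1%:R * h l - z 0 l.
have r0 : 0 <= r by rewrite subr_ge0.
have rs : r <= s by rewrite /r; lra.
have cp : grid_cell h c (z + r *: delta_mx 0 l).
  move=> i; rewrite coordE; case: eqP => [->|_]; last by rewrite mulr0 addr0; exact: cz.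
  by rewrite mulr1 /r addrC subrK lexx andbT ler_pM2r // ler_nat.
have cK1 : ((c l).+1 < K l)%N.
  have /andP[_] := bz' l; rewrite coordE eqxx mulr1 => /(lt_le_trans gt).
  by rewrite ltr_pM2r // ltr_nat.
pose c' i := if i == l then (c l).+1 else c i.
have c'K i : (c' i < K i)%N by rewrite /c'; case: eqP => [->|_].
have zp i : i != l -> (c i)%:R * h i <= z 0 i <= (c i).+1%:R * h i by move=> _; exact: cz.
have cp' : grid_cell h c' (z + r *: delta_mx 0 l).
  move=> i; rewrite coordE /c'; case: eqP => [->|/eqP il]; last by rewrite mulr0 addr0 zp.
  by rewrite mulr1 /r addrC subrK lexx ler_pM2r // ler_nat /=.
have cq' : grid_cell h c' (z + r *: delta_mx 0 l + (s - r) *: delta_mx 0 l).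
  move=> i; rewrite addE coordE /c'; case: eqP => [->|/eqP il].
    rewrite (_ : r + (s - r) = s); last by rewrite addrC subrK.
    rewrite mulr1 (ltW gt) /=.
    by move: sh c2; rewrite ger0_norm // -[in X in _ -> _ -> X]natr1 mulrDl mul1r; lra.
  by rewrite mulr0 addr0 zp.
have h1 := slope_in_cell (af c cK) cz cp (hc c cK hcz).
have h2 : `|f (z + r *: delta_mx 0 l + (s - r) *: delta_mx 0 l) -
    f (z + r *: delta_mx 0 l) - (s - r) *: G| <= `|s - r| * e.
  apply: (slope_in_cell (af c' c'K) cp' cq'); apply: hc => //.
  have [s00|s00] := eqVneq s 0; last first.
    exists (r / s); last by rewrite divfK.
    have sp : 0 < s by rewrite lt_neqAle eq_sym s00.
    by rewrite divr_ge0 //= ler_pdivrMr // mul1r.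
  have r00 : r = 0 by apply/eqP; rewrite eq_le r0 andbT -s00.
  by exists 0; rewrite ?lexx ?ler01 // mul0r -r00.
rewrite addE addrCA subrr addr0 in h2.
have -> : f (z + s *: delta_mx 0 l) - f z - s *: G =
  (f (z + s *: delta_mx 0 l) - f (z + r *: delta_mx 0 l) - (s - r) *: G) +
  (f (z + r *: delta_mx 0 l) - f z - r *: G).
  by apply/matrixP => p q; rewrite !mxE; ring.
apply: (le_trans (ler_normD _ _)); apply: (le_trans (lerD h2 h1)).
by rewrite -mulrDl !ger0_norm ?subr_ge0 // subrK.
Qed.

Definition hat (t : R) : R := Num.max 0 (1 - `|t|).

Lemma hat_affine (c y : nat) t t' a : c%:R <= t <= c.+1%:R -> c%:R <= t' <= c.+1%:R ->
  0 <= a <= 1 ->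
  hat (a * t + (1 - a) * t' - y%:R) = a * hat (t - y%:R) + (1 - a) * hat (t' - y%:R).
Proof.
move=> ht ht' /andP[a0 a1].
have hc : c%:R <= a * t + (1 - a) * t' <= c.+1%:R.
  move: ht ht' => /andP[h1 h2] /andP[h3 h4]; have b0 : 0 <= 1 - a by lra.
  have := ler_wpM2l a0 h1; have := ler_wpM2l a0 h2.
  have := ler_wpM2l b0 h3; have := ler_wpM2l b0 h4.
  by move=> *; apply/andP; split; lra.
have [[yc|->]|[->|yc]] : ((y < c)%N \/ y = c) \/ (y = c.+1 \/ (c.+1 < y)%N).
- by lia.
- have H s : c%:R <= s <= c.+1%:R -> hat (s - y%:R) = 0.
    move=> /andP[s0 s1]; have : (y.+1)%:R <= c%:R :> R by rewrite ler_nat.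
    rewrite -natr1 => yc'; rewrite /hat ger0_norm; last by lra.
    by apply/max_idPl; lra.
  by rewrite !H // !mulr0 addr0.
- have H s : c%:R <= s <= c.+1%:R -> hat (s - c%:R) = 1 - (s - c%:R).
    rewrite -natr1 => /andP[s0 s1]; rewrite /hat ger0_norm; last by lra.
    by apply/max_idPr; lra.
  by rewrite !H //; ring.
- have H s : c%:R <= s <= c.+1%:R -> hat (s - c.+1%:R) = 1 + (s - c.+1%:R).
    rewrite -natr1 => /andP[s0 s1]; rewrite /hat ler0_norm; last by lra.
    by rewrite opprK; apply/max_idPr; lra.
  by rewrite !H //; ring.
- have H s : c%:R <= s <= c.+1%:R -> hat (s - y%:R) = 0.
    move=> /andP[s0 s1]; have : c.+2%:R <= y%:R :> R by rewrite ler_nat.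
    rewrite -natr1 => yc'; rewrite /hat ler0_norm; last by lra.
    by apply/max_idPl; lra.
  by rewrite !H // !mulr0 addr0.
Qed.

Lemma hat_nat (y y' : nat) : hat (y%:R - y'%:R) = (y == y')%:R.
Proof.
have [->|ne] := eqVneq y y'; first by rewrite /hat subrr normr0 subr0; apply/max_idPr.
rewrite /hat; apply/max_idPl; rewrite subr_le0.
have [lt|gt|e] := ltngtP y y'; last by rewrite e eqxx in ne.
  rewrite distrC ger0_norm ?subr_ge0 ?ler_nat ?(ltnW lt) // -natrB ?(ltnW lt) //.
  by rewrite ler1n subn_gt0.
rewrite ger0_norm ?subr_ge0 ?ler_nat ?(ltnW gt) // -natrB ?(ltnW gt) //.
by rewrite ler1n subn_gt0.
Qed.

Lemma hat_continuous : continuous hat.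
Proof.
move=> t; apply: (@continuous_max _ _ (cst 0) (fun t => 1 - `|t|)).
  exact: cst_continuous.
by apply: continuousB; [exact: cst_continuous|exact: norm_continuous].
Qed.

(** The usual tensor products of hat functions. The nodes range over a cube that contains the grid,
    so that the index type does not depend on the direction, and the sum is continuous on the whole
    space. *)
Definition hat_sum (M : nat) (g : ('I_d -> nat) -> 'cV[R]_n) x : 'cV[R]_n :=
  \sum_(y : {ffun 'I_d -> 'I_M.+1})
    (\prod_i hat (x 0 i / h i - (y i)%:R)) *: g (fun i => y i).

Lemma hat_sum_continuous M g : continuous (hat_sum M g).
Proof.
apply: (continuous_big (@add_continuous _)) => y _ x.
apply: continuousZr_tmp; move: x.
apply: (continuous_big (@mul_continuous R)) => i _ x.
apply: (@continuous_comp _ _ _ (fun x : 'rV[R]_d => x 0 i / h i - (y i)%:R) hat);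
  last exact: hat_continuous.
apply: continuousB; last exact: cst_continuous.
apply: (@continuousM _ _ (fun x : 'rV[R]_d => x 0 i) (cst (h i)^-1)).
  exact: coord_continuous.
exact: cst_continuous.
Qed.

Lemma hat_sum_affine M g c : sep_affine c (hat_sum M g).
Proof.
move=> x x' i cx cx' e a a01.
rewrite /hat_sum !scaler_sumr -big_split; apply: eq_bigr => b _ /=.
rewrite !scalerA -scalerDl; congr (_ *: _).
rewrite (bigD1 i) //= [in RHS](bigD1 i) //= [X in _ = _ + (1 - a) * X](bigD1 i) //=.
have ej : forall y : 'rV[R]_d, (forall j, j != i -> y 0 j = x 0 j) ->
    \prod_(j | j != i) hat (y 0 j / h j - (b j)%:R) =
    \prod_(j | j != i) hat (x 0 j / h j - (b j)%:R).
  by move=> y hy; apply: eq_bigr => j ji; rewrite hy.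
rewrite [in LHS](ej _) 1?(ej x') //; last 2 first.
- by move=> j ji; rewrite e.
- by move=> j ji; rewrite !mxE -e //; ring.
rewrite !mulrA -mulrDl; congr (_ * _); rewrite !mxE mulrDl -!mulrA.
have in01 (y : 'rV[R]_d) : grid_cell h c y -> (c i)%:R <= y 0 i / h i <= (c i).+1%:R.
  move=> /(_ i) /andP[h1 h2]; apply/andP; split; first by rewrite ler_pdivlMr.
  by rewrite ler_pdivrMr.
by apply: hat_affine => //; exact: in01.
Qed.

Lemma hat_sum_node M g y : (forall i, y i <= M)%N ->
  hat_sum M g (\row_i ((y i)%:R * h i)) = g y.
Proof.
move=> yK; have yM i : (y i < M.+1)%N by rewrite ltnS.
pose y' : {ffun 'I_d -> 'I_M.+1} := [ffun i => Ordinal (yM i)].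
rewrite /hat_sum (bigD1 y') //= big1 ?scale1r; last first.
  by move=> i _; rewrite !mxE mulfK ?gt_eqF // ffunE hat_nat eqxx.
rewrite big1 ?addr0; first by congr g; apply/funext => i; rewrite ffunE.
move=> b bb'; have [i hi] : exists i, b i != y' i.
  apply/existsP; move: bb'; apply: contraR; rewrite negb_exists => /forallP e.
  by apply/eqP/ffunP => i; apply/eqP; have := e i; rewrite negbK.
rewrite (bigD1 i) //= mxE mulfK ?gt_eqF // hat_nat.
have /negbTE -> : y i != b i.
  by apply: contraNneq hi => e; apply/eqP/val_inj; rewrite ffunE /= e.
by rewrite mul0r scale0r.
Qed.

Lemma multilinear_exists K g : exists2 f : 'rV[R]_d -> 'cV[R]_n,
  multilinear_interpolation h K g f & continuous f.
Proof.
exists (hat_sum (\max_i K i) g); last exact: hat_sum_continuous.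
split; first exact: continuous_subspaceT (@hat_sum_continuous _ g).
  move=> y yK; apply: hat_sum_node => i.
  by apply: leq_trans (yK i) _; apply: leq_bigmax.
by move=> c _ x x' i; exact: hat_sum_affine.
Qed.

End Multilinear.

(** * Dilated solutions *)

Section UniformContinuity.
Context {R : realType} {U V : normedModType R}.
Implicit Types (K : set U) (f : U -> V).

Lemma within_continuousP K f : {within K, continuous f} <->
  forall x, K x -> forall e : R, 0 < e -> exists2 del : R, 0 < del &
    forall y, K y -> `|x - y| < del -> `|f x - f y| < e.
Proof.
rewrite subspace_continuousP; split=> h x Kx.
  move=> e e0; have /cvgrPdist_lt /(_ e e0) := h x Kx.
  rewrite near_withinE => /nbhs_ballP[del /= del0 hd]; exists del => // y Ky xy.
  by apply: hd => //; rewrite -ball_normE.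
apply/cvgrPdist_lt => e e0; rewrite near_withinE.
have [del del0 hd] := h x Kx e e0; apply/nbhs_ballP; exists del => //= y.
by rewrite -ball_normE => xy Ky; exact: hd.
Qed.

(** Heine's theorem relative to [K], from the covering form of compactness applied to the filter of
    small positive radii. *)
Lemma compact_modulus K f : compact K -> {within K, continuous f} ->
  forall e : R, 0 < e -> exists2 del : R, 0 < del &
    forall x y, K x -> K y -> `|x - y| < del -> `|f x - f y| < e.
Proof.
move=> /compact_near_coveringP /near_covering_withinP cK /within_continuousP cf e e0.
have e20 : 0 < e / 2 by rewrite divr_gt0.
have hP : forall x, K x -> \forall x' \near x & d \near 0^'+, K x' ->
    forall y, K y -> `|x' - y| < d -> `|f x' - f y| < e.
  move=> x Kx; have [r r0 hr] := cf x Kx _ e20.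
  have r20 : 0 < r / 2 by rewrite divr_gt0.
  exists (ball x (r / 2), [set d | d < r / 2]).
    by split; [exact: nbhsx_ballx|exact: nbhs_right_lt].
  move=> [x' d] /= [xx' dr] Kx' y Ky x'y.
  rewrite -ball_normE /= in xx'.
  have -> : f x' - f y = (f x - f y) - (f x - f x').
    by rewrite opprB [RHS]addrC addrA subrK.
  have hxy : `|x - y| < r.
    have -> : x - y = (x - x') + (x' - y) by rewrite addrA subrK.
    apply: (le_lt_trans (ler_normD _ _)); have := lt_trans x'y dr; lra.
  have h1 := hr y Ky hxy.
  have h2 : `|f x - f x'| < e / 2 by apply: hr => //; lra.
  by apply: (le_lt_trans (ler_normB _ _)); lra.
have H := cK R (0^'+) _ (at_right_proper_filter _) hP.
have [d [d0 hd]] : exists d : R, 0 < d /\ (K `<=` (fun x => forall y, K y -> `|x - y| < d -> `|f x - f y| < e)).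
  have hh : \forall d \near 0^'+, 0 < d /\ (K `<=` (fun x => forall y, K y -> `|x - y| < d -> `|f x - f y| < e)).
    near=> d; split; first by near: d; exact: nbhs_right_gt.
    by near: d.
  by have [d hd] := filter_ex hh; exists d.
by exists d => // x y Kx Ky xy; apply: hd.
Unshelve. all: by end_near. Qed.

End UniformContinuity.

Section MeanValue.
Context {R : realType} {d n : nat}.
Implicit Types (K : set 'rV[R]_d) (f g : 'rV[R]_d -> 'cV[R]_n).

Lemma is_derive_line f (x v : 'rV[R]_d) (df : 'cV[R]_n) (y : 'rV[R]_d) r a :
  is_derive x v f df -> x = y + r *: v ->
  is_derive r 1 (fun s : R => f (y + s *: v) a 0) (df a 0).
Proof.
move=> [ex dv] xE.
have cv : h^-1 *: (f (h *: v + x) - f x) @[h --> 0^'] --> df.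
  by rewrite -dv; exact: ex.
have cv' : h^-1 *: ((fun s : R => f (y + s *: v) a 0) (h *: 1 + r) -
    (fun s : R => f (y + s *: v) a 0) r) @[h --> 0^'] --> df a 0.
  have -> : (fun h : R => h^-1 *: ((fun s : R => f (y + s *: v) a 0) (h *: 1 + r) -
    (fun s : R => f (y + s *: v) a 0) r)) =
    (fun M : 'cV[R]_n => M a 0) \o (fun h => h^-1 *: (f (h *: v + x) - f x)).
    apply/funext => h /=; rewrite !mxE xE; congr (h^-1 * (f _ a 0 - _)).
    by rewrite scaler1 scalerDl addrCA addrC.
  by apply: continuous_cvg cv; exact: coord_continuous.
by apply: DeriveDef; [apply: cvgP cv'|apply: cvg_lim].
Qed.

(** The mean value theorem is applied to each component. The intermediate point depends on the
    component, which is why the bound on [g] is assumed along the whole segment. *)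
Lemma axis_mean_value_ge0 K i f g (y : 'rV[R]_d) (s : R) (G : 'cV[R]_n) e :
  is_partial K i f g -> 0 <= s ->
  (forall r, 0 <= r <= s -> interior K (y + r *: delta_mx 0 i)) ->
  (forall r, 0 <= r <= s -> `|g (y + r *: delta_mx 0 i) - G| <= e) ->
  `|f (y + s *: delta_mx 0 i) - f y - s *: G| <= s * e.
Proof.
move=> [_ dfg] s0 intK gG; set v : 'rV[R]_d := delta_mx 0 i.
have e0 : 0 <= e by apply: (le_trans (normr_ge0 _) (gG 0 _)); rewrite lexx.
apply: mx_norm_le => [|a b]; first by rewrite mulr_ge0.
rewrite ord1 {b}.
pose phi (r : R) := f (y + r *: v) a 0.
have dphi (r : R) : 0 <= r <= s -> is_derive r 1 phi (g (y + r *: v) a 0).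
  by move=> r01; exact: (is_derive_line _ (dfg _ (intK r r01)) erefl).
have [|||c] := @MVT_segment R phi (fun r => g (y + r *: v) a 0) 0 s.
- exact: s0.
- by move=> r; rewrite in_itv /= => /andP[r0 rs]; apply: dphi; rewrite !ltW.
- apply: continuous_in_subspaceT => r; rewrite inE /= in_itv /= => r01.
  have [ex _] := dphi r r01.
  exact/differentiable_continuous/derivable1_diffP.
rewrite in_itv /= subr0 => cs; rewrite /phi scale0r addr0 => E.
have -> : (f (y + s *: v) - f y - s *: G) a 0 = s * (g (y + c *: v) - G) a 0.
  by rewrite !mxE E; ring.
rewrite normrM ger0_norm // ler_wpM2l //.
by apply: le_trans (gG c cs); exact: le_coord_norm.
Qed.

Lemma axis_mean_value K i f g (y : 'rV[R]_d) (s : R) (G : 'cV[R]_n) e :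
  is_partial K i f g ->
  (forall r, 0 <= r <= 1 -> interior K (y + (r * s) *: delta_mx 0 i)) ->
  (forall r, 0 <= r <= 1 -> `|g (y + (r * s) *: delta_mx 0 i) - G| <= e) ->
  `|f (y + s *: delta_mx 0 i) - f y - s *: G| <= `|s| * e.
Proof.
move=> pfg intK gG.
have key r : 0 <= r <= `|s| -> exists2 q, 0 <= q <= 1 &
    r = q * `|s|.
  move=> /andP[r0 rs]; have [s0|s0] := eqVneq s 0.
    exists 0; first by rewrite lexx ler01.
    by apply/eqP; rewrite mul0r eq_le r0 andbT; move: rs; rewrite s0 normr0.
  exists (r / `|s|); last by rewrite divfK // normr_eq0.
  rewrite divr_ge0 //= ler_pdivrMr ?mul1r // normr_gt0 //.
have [s0|s0] := leP 0 s.
  rewrite ger0_norm //; apply: (axis_mean_value_ge0 pfg) => // r.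
    by rewrite -{1}(ger0_norm s0) => /key[q q01 ->]; rewrite ger0_norm //; exact: intK.
  by rewrite -{1}(ger0_norm s0) => /key[q q01 ->]; rewrite ger0_norm //; exact: gG.
have flip r : y + s *: delta_mx 0 i + r *: delta_mx 0 i = y + (s + r) *: delta_mx 0 i :> 'rV[R]_d.
  by rewrite scalerDl addrA.
have flip2 r : 0 <= r <= `|s| -> exists2 q, 0 <= q <= 1 & s + r = q * s.
  move=> /key[q /andP[q0 q1] ->]; exists (1 - q); first by apply/andP; split; lra.
  by rewrite ltr0_norm //; ring.
have := @axis_mean_value_ge0 K i f g (y + s *: delta_mx 0 i) `|s| G e pfg (normr_ge0 _).
move=> /(_ _)/wrap [|].
  by move=> r /flip2[q q01 e1]; rewrite flip e1; exact: intK.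
move=> /(_ _)/wrap [|].
  by move=> r /flip2[q q01 e1]; rewrite flip e1; exact: gG.
rewrite flip ltr0_norm // subrr scale0r addr0 -normrN; congr (`|_| <= _).
by apply/matrixP => p q; rewrite !mxE; ring.
Qed.

End MeanValue.

Lemma shift_coord (R : realType) d (x : 'rV[R]_d) s k i :
  (x + s *: delta_mx 0 k) 0 i = x 0 i + s * (i == k)%:R.
Proof. by rewrite !mxE eqxx. Qed.

Lemma sub_coord (R : realType) d (x y : 'rV[R]_d) i : (x - y) 0 i = x 0 i - y 0 i.
Proof. by rewrite !mxE. Qed.

Lemma continuous_sub (R : realType) (T : topologicalType) (f g : T -> R) :
  continuous f -> continuous g -> continuous (fun x => f x - g x).
Proof. by move=> cf cg x; apply: continuousB; [exact: cf|exact: cg]. Qed.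

Lemma continuous_near_gt0 (R : realType) (T : topologicalType) (f : T -> R) y :
  continuous f -> 0 < f y -> \forall z \near y, 0 < f z.
Proof.
move=> cf fy; have := cf y [set r | 0 < r]; apply.
by apply: open_nbhs_nbhs; split; [exact: open_gt|exact: fy].
Qed.

(** * Space-time coordinates and the domain of correctness *)

Section SpaceTime.
Context {R : realType} {m : nat}.
Implicit Types (x : 'rV[R]_m) (y : 'rV[R]_(m + 1)).

Lemma st_point_space x t i : st_point x t 0 (space i) = x 0 i.
Proof. by rewrite /st_point row_mxEl. Qed.

Lemma st_point_time x t : st_point x t 0 (time m) = t.
Proof. by rewrite /st_point row_mxEr mxE mulr1n. Qed.

Lemma st_pointP y : exists x t, y = st_point x t.
Proof.
exists (lsubmx y), (rsubmx y 0 0); rewrite /st_point -[LHS]hsubmxK; congr row_mx.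
by apply/matrixP => i j; rewrite !ord1 [RHS]mxE eqxx mulr1n.
Qed.

Lemma st_coordP (P : 'I_(m + 1) -> Prop) :
  (forall i, P (space i)) -> P (time m) -> forall k, P k.
Proof.
move=> hs ht k; case: (split_ordP k) => [i ->|i ->]; first exact: hs.
by rewrite (ord1 i).
Qed.

Lemma st_rowP y y' : (forall i, y 0 (space i) = y' 0 (space i)) ->
  y 0 (time m) = y' 0 (time m) -> y = y'.
Proof. by move=> hs ht; apply/rowP; apply: st_coordP. Qed.

Lemma space_eq (i j : 'I_m) : (space i == space j) = (i == j).
Proof. by rewrite /space (inj_eq (@lshift_inj _ _)). Qed.

Lemma space_time (i : 'I_m) : (space i == time m) = false.
Proof. by rewrite /space /time eq_lrshift. Qed.

Lemma time_space (i : 'I_m) : (time m == space i) = false.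
Proof. by rewrite eq_sym space_time. Qed.

Lemma st_point_shift x t s i :
  st_point (x + s *: delta_mx 0 i) t = st_point x t + s *: delta_mx 0 (space i).
Proof.
apply: st_rowP => [j|]; first by rewrite !(st_point_space, shift_coord) space_eq.
by rewrite shift_coord !st_point_time time_space mulr0 addr0.
Qed.

Lemma st_point_later x t s :
  st_point x (t + s) = st_point x t + s *: delta_mx 0 (time m).
Proof.
apply: st_rowP => [j|]; first by rewrite shift_coord !st_point_space space_time mulr0 addr0.
by rewrite shift_coord !st_point_time eqxx mulr1.
Qed.

Lemma st_norm_le y e : 0 <= e -> (forall i, `|y 0 (space i)| <= e) ->
  `|y 0 (time m)| <= e -> `|y| <= e.
Proof.
by move=> e0 hs ht; apply: mx_norm_le => // i; rewrite ord1; apply: st_coordP.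
Qed.

End SpaceTime.

Section Domain.
Context {R : realType} {m n : nat} (A : 'M[R]_n) (B : 'I_m -> 'M[R]_n).
Let lM i := lambda_max A (B i).
Let lm i := lambda_min A (B i).
Let H := correctness_domain A B.
Hypothesis lM0 : forall i, 0 < lM i.
Hypothesis lm0 : forall i, lm i < 0.
Variable Lam : R.
Hypothesis LamM : forall l, lM l <= Lam.
Hypothesis Lamm : forall l, - lm l <= Lam.
Hypothesis Lam0 : 0 < Lam.

Lemma domain_slice x t : H (st_point x t) <-> 0 <= t /\ slice lM lm t x.
Proof.
rewrite /H /correctness_domain /= st_point_time; split=> -[t0 h]; split=> // i.
  have [] := h i; rewrite st_point_space -/(lM i) -/(lm i) => a b.
  by apply/andP; split; lra.
have /andP[] := h i; rewrite st_point_space -/(lM i) -/(lm i) => a b.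
by split; lra.
Qed.

(** The domain widened by [rho] in space only. The nodes inspected by the test lie in such a set,
    and a dilation brings it back into the interior of [H]. *)
Definition ext_domain (rho : R) : set 'rV[R]_(m + 1) :=
  [set y | 0 <= y 0 (time m) /\ forall i,
     - rho <= y 0 (space i) - lM i * y 0 (time m) /\
     y 0 (space i) - 1 - lm i * y 0 (time m) <= rho].

Lemma domain_ext rho y : 0 <= rho -> H y -> ext_domain rho y.
Proof.
move=> rho0 [t0 h]; split=> // i; have [a b] := h i.
by move: a b; rewrite -/(lM i) -/(lm i) => a b; split; lra.
Qed.

Lemma ext_domain_convex rho y y' a : 0 <= a <= 1 ->
  ext_domain rho y -> ext_domain rho y' -> ext_domain rho ((1 - a) *: y + a *: y').
Proof.
move=> /andP[a0 a1] [t0 h] [t0' h']; have b0 : 0 <= 1 - a by lra.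
split; first by rewrite !mxE addr_ge0 // mulr_ge0.
move=> i; have [h1 h2] := h i; have [h3 h4] := h' i; rewrite !mxE.
have := ler_wpM2l b0 h1; have := ler_wpM2l b0 h2.
have := ler_wpM2l a0 h3; have := ler_wpM2l a0 h4.
move: (y 0 (space i)) (y' 0 (space i)) (y 0 (time m)) (y' 0 (time m)) => p q r s.
by move=> *; split; lra.
Qed.

Lemma ext_domain_segment rho y k s a : 0 <= a <= 1 ->
  ext_domain rho y -> ext_domain rho (y + s *: delta_mx 0 k) ->
  ext_domain rho (y + (a * s) *: delta_mx 0 k).
Proof.
move=> a01 h1 h2; have := ext_domain_convex a01 h1 h2.
congr (ext_domain rho _); apply/rowP => i; rewrite !mxE; ring.
Qed.

Lemma coord_cont (k : 'I_(m + 1)) : continuous (fun y : 'rV[R]_(m + 1) => y 0 k).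
Proof. exact: coord_continuous. Qed.

Lemma left_cont i :
  continuous (fun y : 'rV[R]_(m + 1) => y 0 (space i) - lM i * y 0 (time m)).
Proof.
apply: continuous_sub; first exact: coord_cont.
by apply: continuous_mul; [exact: cst_continuous|exact: coord_cont].
Qed.

Lemma right_cont i :
  continuous (fun y : 'rV[R]_(m + 1) => y 0 (space i) - 1 - lm i * y 0 (time m)).
Proof.
apply: continuous_sub.
  by apply: continuous_sub; [exact: coord_cont|exact: cst_continuous].
by apply: continuous_mul; [exact: cst_continuous|exact: coord_cont].
Qed.

Lemma strict_interior (y : 'rV[R]_(m + 1)) : 0 < y 0 (time m) ->
  (forall i, 0 < y 0 (space i) - lM i * y 0 (time m)) ->
  (forall i, y 0 (space i) - 1 - lm i * y 0 (time m) < 0) -> interior H y.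
Proof.
move=> t0 hM hm; rewrite /interior.
have n0 : \forall z \near y, 0 < (z : 'rV[R]_(m + 1)) 0 (time m).
  exact: (continuous_near_gt0 (coord_cont (k := time m)) t0).
have nM : \forall z \near y, forall i,
    0 < (z : 'rV[R]_(m + 1)) 0 (space i) - lM i * z 0 (time m).
  apply: (@filter_forall _ _ _ _ (nbhs_filter y)) => i.
  exact: (continuous_near_gt0 (left_cont (i := i)) (hM i)).
have nm : \forall z \near y, forall i,
    (z : 'rV[R]_(m + 1)) 0 (space i) - 1 - lm i * z 0 (time m) < 0.
  apply: (@filter_forall _ _ _ _ (nbhs_filter y)) => i.
  pose f (z : 'rV[R]_(m + 1)) : R := 0 - (z 0 (space i) - 1 - lm i * z 0 (time m)).
  have fy : 0 < f y by rewrite subr_gt0.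
  have cf : continuous f by apply: continuous_sub; [exact: cst_continuous|exact: right_cont].
  by apply: filterS (continuous_near_gt0 cf fy) => z; rewrite subr_gt0.
near=> z; split; first by apply: ltW; near: z.
move=> i; split; apply: ltW.
  by have : forall i, 0 < z 0 (space i) - lM i * z 0 (time m) by near: z.
by have : forall i, z 0 (space i) - 1 - lm i * z 0 (time m) < 0 by near: z.
Unshelve. all: by end_near. Qed.

Lemma domain_closed : closed H.
Proof.
have -> : H = (fun y : 'rV[R]_(m + 1) => y 0 (time m)) @^-1` [set t | 0 <= t] `&`
  \bigcap_i ((fun y : 'rV[R]_(m + 1) => y 0 (space i) - lM i * y 0 (time m)) @^-1` [set t | 0 <= t]
   `&` (fun y : 'rV[R]_(m + 1) => y 0 (space i) - 1 - lm i * y 0 (time m)) @^-1` [set t | t <= 0]).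
  apply/seteqP; split=> [y [t0 h]|y [t0 h]]; split=> // i; first by move=> _; exact: h.
  exact: (h i I).
apply: closedI.
  by apply: preimage_closed; [move=> ? _; exact: coord_cont|exact: closed_ge].
apply: closed_bigI => i _; apply: closedI.
  by apply: preimage_closed; [move=> ? _; exact: left_cont|exact: closed_ge].
by apply: preimage_closed; [move=> ? _; exact: right_cont|exact: closed_le].
Qed.

Lemma domain_unit y i : H y -> 0 <= y 0 (space i) <= 1.
Proof.
move=> [t0 h]; have [] := h i; rewrite -/(lM i) -/(lm i) => a b.
have := mulr_ge0 (ltW (lM0 i)) t0; have := mulr_le0_ge0 (ltW (lm0 i)) t0.
by move=> c d; apply/andP; split; lra.
Qed.

Lemma domain_time i y : H y -> y 0 (time m) * (lM i - lm i) <= 1.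
Proof.
move=> [t0 h]; have [] := h i; rewrite -/(lM i) -/(lm i) => a b.
by rewrite mulrBr mulrC (mulrC _ (lm i)); lra.
Qed.

Lemma domain_compact : (0 < m)%N -> compact H.
Proof.
move=> m0; apply: bounded_closed_compact; last exact: domain_closed.
(* The left and right characteristic planes of a single direction meet at the time [T]. *)
pose i0 := Ordinal m0; pose T := (lM i0 - lm i0)^-1.
have w0 : 0 < lM i0 - lm i0 by have := lM0 i0; have := lm0 i0; lra.
have T0 : 0 < T by rewrite invr_gt0.
exists (1 + T); split; first exact: num_real.
move=> M hM y Hy; apply: le_trans (ltW hM); apply: st_norm_le.
- by lra.
- move=> i; have /andP[a b] := domain_unit i Hy; rewrite ger0_norm //; lra.
have := domain_time i0 Hy; case: Hy => t0 _; rewrite ger0_norm //.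
by rewrite -ler_pdivlMr // div1r -/T; lra.
Qed.

(** Up to the time 1 / (4 Lam) a characteristic travels at most 1/4, so at this point the
    inequalities of the sides hold with a margin of at least 1/4. This is the origin of the bound (1
    - th) / 4 on the widening that a dilation absorbs. *)
Definition dom_center : 'rV[R]_(m + 1) := st_point (const_mx (1 / 2)) (4 * Lam)^-1.
Definition dilate (th : R) (y : 'rV[R]_(m + 1)) := dom_center + th *: (y - dom_center).

Lemma dilate_coord th y k : dilate th y 0 k = (1 - th) * dom_center 0 k + th * y 0 k.
Proof. by rewrite !mxE; ring. Qed.

Lemma dilate_interior th rho y : 0 <= th < 1 -> 0 <= rho < (1 - th) / 4 ->
  ext_domain rho y -> interior H (dilate th y).
Proof.
move=> /andP[th0 th1] /andP[rho0 rho1] [t0 h].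
have L4 : Lam * (4 * Lam)^-1 = 1 / 4 by field; rewrite gt_eqF.
have q0 : 0 < (4 * Lam)^-1 by rewrite invr_gt0 mulr_gt0.
have s0 : 0 < 1 - th by lra.
have thr : th * rho <= rho by rewrite ler_piMl // ltW.
have ct : dom_center 0 (time m) = (4 * Lam)^-1 by rewrite /dom_center st_point_time.
have cs i : dom_center 0 (space i) = 1 / 2 by rewrite /dom_center st_point_space mxE.
apply: strict_interior => [|i|i]; rewrite !dilate_coord ct ?cs.
- by rewrite ltr_pwDl ?mulr_gt0 // mulr_ge0.
- have := ler_wpM2r (ltW q0) (LamM i); rewrite L4 => a.
  have [b _] := h i; have := ler_wpM2l th0 b; have := ler_wpM2l (ltW s0) a.
  move: (y 0 (space i)) (y 0 (time m)) (4 * Lam)^-1 => p q r; lra.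
have := ler_wpM2r (ltW q0) (Lamm i); rewrite L4 => a.
have [_ b] := h i; have := ler_wpM2l th0 b; have := ler_wpM2l (ltW s0) a.
move: (y 0 (space i)) (y 0 (time m)) (4 * Lam)^-1 => p q r; lra.
Qed.

Lemma dilate_shift th y s k :
  dilate th (y + s *: delta_mx 0 k) = dilate th y + (th * s) *: delta_mx 0 k.
Proof. by apply/rowP => i; rewrite !mxE; ring. Qed.

Lemma dilate_dist th y y' : dilate th y - dilate th y' = th *: (y - y').
Proof. by apply/rowP => i; rewrite !mxE; ring. Qed.

(** The factor [th] is the derivative of the dilation, which maps segments of the widened domain
    into the interior of [H], where [f] is known to have its partial derivative. *)
Lemma dilate_mean_value f g th rho k y s (G : 'cV[R]_n) e :
  is_partial H k f g -> 0 <= th < 1 -> 0 <= rho < (1 - th) / 4 ->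
  ext_domain rho y -> ext_domain rho (y + s *: delta_mx 0 k) ->
  (forall a, 0 <= a <= 1 -> `|g (dilate th (y + (a * s) *: delta_mx 0 k)) - G| <= e) ->
  `|f (dilate th (y + s *: delta_mx 0 k)) - f (dilate th y) - s *: (th *: G)| <= `|s| * e.
Proof.
move=> pf th01 rho01 ey eys hG; have /andP[th0 th1] := th01.
have e0 : 0 <= e by apply: le_trans (hG 0 _); rewrite ?lexx ?ler01.
have shE a : dilate th (y + (a * s) *: delta_mx 0 k) =
    dilate th y + (a * (th * s)) *: delta_mx 0 k by rewrite dilate_shift mulrCA.
have := @axis_mean_value _ _ _ H k f g (dilate th y) (th * s) G e pf.
move=> /(_ _)/wrap [|].
  move=> a a01; rewrite -shE; apply: (dilate_interior th01 rho01).
  exact: ext_domain_segment.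
move=> /(_ _)/wrap [|]; first by move=> a a01; rewrite -shE; exact: hG.
rewrite dilate_shift scalerA (mulrC s) => h; apply: (le_trans h).
rewrite ler_wpM2r // normrM ger0_norm // ler_piMl // ltW //.
Qed.

End Domain.

Lemma fin_common_pos (R : realType) (I : finType) (P : I -> R -> Prop) :
  (forall i d d', 0 < d' -> d' <= d -> P i d -> P i d') ->
  (forall i, exists2 d, 0 < d & P i d) -> exists2 d, 0 < d & forall i, P i d.
Proof.
move=> mono hP; suff [d d0 hd] : exists2 d, 0 < d & forall i, i \in enum I -> P i d.
  by exists d => // i; apply: hd; rewrite mem_enum.
elim: (enum I) => [|i s [d d0 hd]]; first by exists 1.
have [d' d'0 hd'] := hP i; exists (Num.min d d'); first by rewrite lt_min d0.
have m0 : 0 < Num.min d d' by rewrite lt_min d0.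
move=> j; rewrite inE => /orP[/eqP ->|js].
  by apply: (mono i d') hd' => //; rewrite ge_min lexx orbT.
by apply: (mono j d) (hd j js) => //; rewrite ge_min lexx.
Qed.

Lemma integral_Rd0 (R : realType) d : integral_Rd (fun _ : 'rV[R]_d => 0%E) = 0%E.
Proof. by elim: d => //= d IH; rewrite (eq_integral (cst 0%E)) // integral0. Qed.

(** * Comparison of approximate solutions with the solution *)

Section Solution.
Context {R : realType} {m n : nat} (A : 'M[R]_n) (B : 'I_m -> 'M[R]_n) (K Lam : R).
Let lM i := lambda_max A (B i).
Let lm i := lambda_min A (B i).
Let H := correctness_domain A B.
Hypothesis m_gt0 : (0 < m)%N.
Hypothesis n_gt0 : (0 < n)%N.
Hypothesis pA : posdef_mx A.
Hypothesis symB : forall i, (B i)^T = B i.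
Hypothesis K0 : 0 <= K.
Hypothesis cA : coercive K A.
Hypothesis lM0 : forall i, 0 < lM i.
Hypothesis lm0 : forall i, lm i < 0.
Hypothesis LamM : forall l, lM l <= Lam.
Hypothesis Lamm : forall l, - lm l <= Lam.
Hypothesis Lam0 : 0 < Lam.

Let asol tau del v := approx_sol A B lM lm tau Lam del v.
Definition spread (f : 'rV[R]_(m + 1) -> 'cV[R]_n) : 'rV[R]_m -> R -> 'cV[R]_n :=
  fun x t => f (st_point x t).

Lemma approx_solB tau del del' v v' : asol tau del v -> asol tau del' v' ->
  asol tau (del + del') (fun x t => v x t - v' x t).
Proof.
move=> h h' x t t0 xs; have [gt [g [h1 h2 h3]]] := h x t t0 xs.
have [gt' [g' [h1' h2' h3']]] := h' x t t0 xs.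
exists (gt - gt'), (fun l => g l - g' l); split.
- have -> : A *m (gt - gt') + \sum_l B l *m (g l - g' l) =
     (A *m gt + \sum_l B l *m g l) - (A *m gt' + \sum_l B l *m g' l).
    under eq_bigr do rewrite mulmxBr.
    by rewrite mulmxBr sumrB opprD addrACA.
  by apply: (le_trans (ler_normB _ _)); exact: lerD.
- rewrite mulrDl; apply: le_trans (lerD h2 h2'); apply: le_trans (ler_normB _ _).
  by rewrite le_eqVlt; apply/orP; left; apply/eqP; congr `|_|; apply/matrixP => p q;
    rewrite !mxE; ring.
- move=> z l s zs zs' zn sn; rewrite mulrDl.
  apply: le_trans (lerD (h3 z l s zs zs' zn sn) (h3' z l s zs zs' zn sn)).
  apply: le_trans (ler_normB _ _).
  by rewrite le_eqVlt; apply/orP; left; apply/eqP; congr `|_|; apply/matrixP => p q;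
    rewrite !mxE; ring.
Qed.

Lemma dilate_domain th y : 0 <= th < 1 -> H y -> H (dilate Lam th y).
Proof.
move=> th01 Hy; apply: interior_subset.
apply: (@dilate_interior _ _ _ A B Lam LamM Lamm Lam0 th 0 y th01).
  by rewrite lexx /= divr_gt0 // subr_gt0; case/andP: th01.
exact: domain_ext.
Qed.

(** The equation is homogeneous with constant coefficients, so a dilation, which multiplies all
    derivatives by [th], preserves it exactly. Only the variation of the derivatives over distances
    of order [tau] remains, and their uniform continuity on [H] makes it small. *)
Lemma dilated_approx u ut ux th del :
  is_partial H (time m) u ut -> (forall i, is_partial H (space i) u (ux i)) ->
  (forall y, H y -> A *m ut y + \sum_i B i *m ux i y = 0) ->
  0 <= th < 1 -> 0 < del ->
  exists2 tau0, 0 < tau0 & forall tau, 0 < tau < tau0 ->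
    asol tau del (spread (fun y => u (dilate Lam th y))).
Proof.
move=> put pux pde th01 del0.
have cH : compact H by exact: domain_compact.
(* Increments in time have length [tau], those in space up to [Lam * tau]; both [e] and [Lam * e]
   have to be at most [del]. *)
pose e := del / (Lam + 1).
have e0 : 0 < e by rewrite divr_gt0 // addr_gt0.
have eL : Lam * e <= del.
  by rewrite /e mulrCA ler_piMr // ?(ltW del0) // ler_pdivrMr ?mul1r ?addr_gt0 //; lra.
have ee : e <= del by rewrite /e ler_pdivrMr ?addr_gt0 // ler_peMr ?(ltW del0) // lerDr ltW.
have [d1 d10 hd1] := compact_modulus cH (proj1 put) e0.
have [d2 d20 hd2] : exists2 d, 0 < d & forall i x y, H x -> H y -> `|x - y| < d ->
    `|ux i x - ux i y| < e.
  apply: (@fin_common_pos R 'I_m (fun i d => forall x y, H x -> H y -> `|x - y| < d ->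
    `|ux i x - ux i y| < e)).
    by move=> i d d' _ dd' h x y Hx Hy xy; apply: h => //; exact: lt_le_trans dd'.
  by move=> i; have [d d0 hd] := compact_modulus cH (proj1 (pux i)) e0; exists d.
pose d := Num.min d1 d2.
have d0 : 0 < d by rewrite lt_min d10.
(* A point of a segment is at most [Lam * tau] from [z], which is at most [Lam * tau] from [x]; with
   the time step this stays below [d]. *)
exists (d / (2 * Lam + 1)); first by rewrite divr_gt0 // addr_gt0 // mulr_gt0.
move=> tau /andP[tau0 taud].
have tauL : 2 * (Lam * tau) + tau < d.
  move: taud; rewrite ltr_pdivlMr ?addr_gt0 ?mulr_gt0 //; lra.
have Lt0 : 0 < Lam * tau by rewrite mulr_gt0.
move=> x t t0 xs'; have xs := slice_le lM0 lm0 tau0 xs'.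
have HY : H (st_point x t) by apply/domain_slice.
have HY' : H (st_point x (t + tau)).
  by apply/domain_slice; split=> //; rewrite addr_ge0 // ltW.
have rho01 : 0 <= (0 : R) < (1 - th) / 4.
  by rewrite lexx /= divr_gt0 // subr_gt0; case/andP: th01.
have ext0 y : H y -> ext_domain A B 0 y by exact: domain_ext.
have HDY := dilate_domain th01 HY.
have ext_H y : ext_domain A B 0 y -> H y.
  by move=> [h1 h2]; split=> // i; have [a b] := h2 i; rewrite oppr0 in a.
have near y : H y -> `|y - st_point x t| < d -> `|dilate Lam th y - dilate Lam th (st_point x t)| < d.
  move=> Hy; rewrite dilate_dist normrZ; apply: le_lt_trans; rewrite ler_piMl //.
  by case/andP: th01 => a b; rewrite ger0_norm // ltW.
exists (th *: ut (dilate Lam th (st_point x t))), (fun i => th *: ux i (dilate Lam th (st_point x t))).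
split.
- have -> : A *m (th *: ut (dilate Lam th (st_point x t))) +
      \sum_l B l *m (th *: ux l (dilate Lam th (st_point x t))) = 0.
    under eq_bigr do rewrite -scalemxAr.
    by rewrite -scalemxAr -scaler_sumr -scalerDr pde // scaler0.
  by rewrite normr0 ltW.
- rewrite /spread st_point_later.
  apply: (le_trans (dilate_mean_value LamM Lamm Lam0 (e := e) put th01 rho01 _ _ _)).
  + exact: ext0.
  + by rewrite -st_point_later; exact: ext0.
  + move=> a a01; have Hp : H (st_point x t + (a * tau) *: delta_mx 0 (time m)).
      apply: ext_H; apply: ext_domain_segment => //; first exact: ext0.
      by rewrite -st_point_later; exact: ext0.
    apply: ltW; apply: hd1; [exact: dilate_domain|exact: HDY|].
    apply: lt_le_trans (near _ Hp _) _; last by rewrite ge_min lexx.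
    rewrite addrAC subrr add0r normrZ.
    have := @mx_norm_le R _ _ (delta_mx 0 (time m) : 'rV[R]_(m + 1)) 1 ler01.
    move=> /(_ _)/wrap [|h].
      by move=> p q; rewrite mxE; case: (_ && _); rewrite ?normr1 ?normr0.
    case/andP: a01 => a0 a1; rewrite normrM (ger0_norm a0) (gtr0_norm tau0).
    have := ler_wpM2l (mulr_ge0 a0 (ltW tau0)) h; have := ler_wpM2r (ltW tau0) a1.
    by move: (`|delta_mx 0 (time m)|) => D; lra.
  by rewrite gtr0_norm // mulrC ler_wpM2r // ltW.
move=> z l s zs zs' zn sn; rewrite /spread st_point_shift.
have Hz : H (st_point z t) by apply/domain_slice.
have Hz' : H (st_point z t + s *: delta_mx 0 (space l)).
  by rewrite -st_point_shift; apply/domain_slice.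
apply: (le_trans (dilate_mean_value LamM Lamm Lam0 (e := e) (pux l) th01 rho01 _ _ _)).
- exact: ext0.
- exact: ext0.
- move=> a a01; have Hp : H (st_point z t + (a * s) *: delta_mx 0 (space l)).
    by apply: ext_H; apply: ext_domain_segment => //; exact: ext0.
  apply: ltW; apply: hd2; [exact: dilate_domain|exact: HDY|].
  apply: lt_le_trans (near _ Hp _) _; last by rewrite ge_min lexx orbT.
  apply: (@le_lt_trans _ _ (2 * (Lam * tau))); last by lra.
  have b0 : 0 <= 2 * (Lam * tau) by rewrite mulr_ge0 // ltW.
  case/andP: a01 => a0 a1; apply: st_norm_le => // [i|].
    have -> : (st_point z t + (a * s) *: delta_mx 0 (space l) - st_point x t) 0 (space i) =
       (z 0 i - x 0 i) + (a * s) * (i == l)%:R.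
      rewrite -addrA [X in _ + X]addrC addrA shift_coord space_eq.
      congr (_ + _); rewrite -[LHS]/((st_point z t - st_point x t) 0 (space i)).
      by rewrite sub_coord !st_point_space.
    apply: (le_trans (ler_normD _ _)).
    have : `|a * s * (i == l)%:R| <= Lam * tau.
      case: eqP => _; rewrite ?mulr0 ?mulr1 ?normr0 ?(ltW Lt0) // normrM (ger0_norm a0).
      by apply: le_trans sn; rewrite ler_piMl.
    by have := zn i; lra.
  have -> : (st_point z t + (a * s) *: delta_mx 0 (space l) - st_point x t) 0 (time m) = 0.
    rewrite -addrA [X in _ + X]addrC addrA shift_coord time_space mulr0 addr0.
    rewrite sub_coord !st_point_time subrr //.
  by rewrite normr0.
by apply: (le_trans (ler_wpM2r (ltW e0) sn)); rewrite mulrAC ler_wpM2r // ltW.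
Qed.

Lemma dilate_close (u : 'rV[R]_(m + 1) -> 'cV[R]_n) (eta : R) : {within H, continuous u} -> 0 < eta ->
  exists2 th, 0 <= th < 1 & forall y, H y -> `|u (dilate Lam th y) - u y| <= eta.
Proof.
move=> cu eta0; have cH : compact H by exact: domain_compact.
have [d d0 hd] := compact_modulus cH cu eta0.
have [D D0 hD] : exists2 D : R, 0 < D & forall y, H y -> `|dom_center Lam - y| <= D.
  have [M [_ hM]] := compact_bounded cH.
  exists (`|dom_center Lam : 'rV[R]_(m + 1)| + (`|M| + 1)); first by rewrite ltr_pwDr // ltr_pwDr.
  move=> y Hy; apply: (le_trans (ler_normB _ _)); rewrite lerD2l.
  by apply: (hM (`|M| + 1)) => //; apply: le_lt_trans (ler_norm M) _; rewrite ltrDl.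
(* A dilation by 1 - c moves the points of [H] by at most c D, which is less than d, and c is less
   than 1. *)
pose c := d / (d + D).
have c0 : 0 < c by rewrite divr_gt0 // addr_gt0.
have c1 : c < 1 by rewrite /c ltr_pdivrMr ?addr_gt0 // mul1r ltrDl.
have th01 : 0 <= 1 - c < 1 by apply/andP; split; lra.
exists (1 - c) => // y Hy; apply/ltW/hd => //; first exact: dilate_domain.
have -> : dilate Lam (1 - c) y - y = c *: (dom_center Lam - y).
  by apply/rowP => i; rewrite /dilate !mxE; ring.
rewrite normrZ (gtr0_norm c0).
apply: (@le_lt_trans _ _ (c * D)); last first.
  by rewrite /c mulrAC ltr_pdivrMr ?addr_gt0 // ltr_pM2l // ltrDr.
by rewrite ler_wpM2l ?(ltW c0) // hD.
Qed.

(* Squared L2 norms of the slices, computed on all fine enough lattices. *)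
Definition lat_le (T : R) (v : 'rV[R]_m -> R -> 'cV[R]_n) (c : R) : Prop :=
  exists2 tau0, 0 < tau0 & forall tau N k, 0 < tau < tau0 ->
    (forall l, ncell lM lm tau l <= N)%N -> k%:R * tau <= T ->
    lsum lM lm N tau v k <= c.

Lemma lat_leD T v v' c c' : lat_le T v c -> lat_le T v' c' ->
  lat_le T (fun x t => v x t + v' x t) (2 * (c + c')).
Proof.
move=> [t1 t10 h1] [t2 t20 h2]; exists (Num.min t1 t2); first by rewrite lt_min t10.
move=> tau N k /andP[tau0]; rewrite lt_min => /andP[tt1 tt2] hN kT.
apply: (le_trans (@lsumD R m n lM lm lM0 lm0 N tau tau0 v v' k)); rewrite ler_wpM2l //.
by apply: lerD; [apply: h1|apply: h2] => //; rewrite tau0.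
Qed.

Lemma width_le l tau : 0 < tau -> (lM l - lm l) * tau <= (2 * Lam + 1) * tau.
Proof.
by move=> tau0; rewrite ler_wpM2r ?ltW //; have := LamM l; have := Lamm l; have := Lam0; lra.
Qed.

Let C := @stab_const R m n K.

(** The error is split at a dilated solution: [w] minus it is an approximate solution with initial
    values up to 2 eps, and the dilated solution is uniformly within [eps] of [u]. With [lsumD] the
    two parts give 2 (4 K^2 + 1), hence the constant 8 K^2 + 2. The dilation determines how fine the
    lattices must be but leaves no trace in the bound. *)
Lemma error_lat w u ut ux del eps T :
  is_partial H (time m) u ut -> (forall i, is_partial H (space i) u (ux i)) ->
  (forall y, H y -> A *m ut y + \sum_i B i *m ux i y = 0) ->
  {within H, continuous u} -> 0 < del -> 0 < eps -> 0 <= T ->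
  (exists2 tau0, 0 < tau0 & forall tau, 0 < tau < tau0 -> asol tau del (spread w)) ->
  (forall x, unit_cube x -> `|w (st_point x 0) - u (st_point x 0)| <= eps) ->
  lat_le T (spread (fun y => w y - u y)) (2 ^+ m * (8 * K ^+ 2 + 2) * (eps + C * del * T) ^+ 2).
Proof.
move=> put pux pde cu del0 eps0 T0 [t1 t10 hw] hw0.
have [th th01 hth] := dilate_close cu eps0.
have [t2 t20 hu] := dilated_approx put pux pde th01 del0.
pose t3 := (2 * Lam + 1)^-1.
have t30 : 0 < t3 by rewrite invr_gt0 addr_gt0 // mulr_gt0.
have C0 : 0 < C by exact: stab_const_gt0.
exists (Num.min (Num.min t1 t2) t3); first by rewrite !lt_min t10 t20.
move=> tau N k /andP[tau0]; rewrite !lt_min => /andP[/andP[tt1 tt2] tt3] hN kT.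
have w1 l : (lM l - lm l) * tau <= 1.
  apply: (le_trans (width_le l tau0)).
  by rewrite mulrC -ler_pdivlMr ?addr_gt0 ?mulr_gt0 // div1r ltW.
have a1 := hw tau (introT andP (conj tau0 tt1)).
have a2 := hu tau (introT andP (conj tau0 tt2)).
have a3 := approx_solB a1 a2.
pose v1 := fun x t => spread w x t - spread (fun y => u (dilate Lam th y)) x t.
pose v2 := fun x t => spread (fun y => u (dilate Lam th y)) x t - spread u x t.
have -> : spread (fun y => w y - u y) = (fun x t => v1 x t + v2 x t).
  by apply/funext => x; apply/funext => t; rewrite /v1 /v2 /spread addrA subrK.
apply: (le_trans (@lsumD R m n lM lm lM0 lm0 N tau tau0 v1 v2 k)).
have psdM l : psd (lM l *: A - B l) by case: (lambda_maxP n_gt0 pA (symB l)).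
have psdm l : psd (B l - lm l *: A) by case: (lambda_minP n_gt0 pA (symB l)).
have kt0 : 0 <= k%:R * tau by rewrite mulr_ge0 // ltW.
have l1 : lsum lM lm N tau v1 k <=
    2 ^+ m * K ^+ 2 * (2 * eps + C * (2 * del) * (k%:R * tau)) ^+ 2.
  apply: (lsum_energy (posdef_unit pA) (proj1 pA) K0 cA psdM psdm lM0 lm0 tau0 LamM Lamm hN k w1) => //.
  - by rewrite mulr_gt0.
  - by rewrite mulr_gt0.
  - by rewrite -[2 * del]/((1 + 1) * del) mulrDl !mul1r.
  move=> x xs; have Hx : H (st_point x 0) by apply/domain_slice.
  have cx : unit_cube x by move=> i; have := xs i; rewrite !mulr0 addr0.
  have -> : v1 x 0 = (w (st_point x 0) - u (st_point x 0)) -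
     (u (dilate Lam th (st_point x 0)) - u (st_point x 0)).
    by rewrite /v1 /spread opprB addrA subrK.
  apply: (le_trans (ler_normB _ _)); have := hw0 x cx; have := hth _ Hx; lra.
have l2 : lsum lM lm N tau v2 k <= 2 ^+ m * eps ^+ 2.
  apply: lsum_sup => // [|x xs]; first exact: ltW.
  by apply: hth; apply/domain_slice.
apply: (le_trans (ler_wpM2l _ (lerD l1 l2))) => //.
set p := 2 ^+ m; have p0 : 0 <= p by rewrite exprn_ge0.
set q := eps + C * del * T.
have q1 : 2 * eps + C * (2 * del) * (k%:R * tau) <= 2 * q.
  have := ler_wpM2l (mulr_ge0 (ltW C0) (ltW del0)) kT; rewrite /q; lra.
have q2 : (2 * eps + C * (2 * del) * (k%:R * tau)) ^+ 2 <= (2 * q) ^+ 2.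
  rewrite ler_pXn2r ?nnegrE //; last by apply: le_trans q1; rewrite addr_ge0 // !mulr_ge0 // ltW.
  by rewrite addr_ge0 // !mulr_ge0 // ltW.
have q3 : eps ^+ 2 <= q ^+ 2.
  have h : 0 <= C * del * T by rewrite !mulr_ge0 // ltW.
  have q0 : 0 <= q by rewrite /q addr_ge0 // ltW.
  by rewrite ler_pXn2r ?nnegrE ?q0 ?(ltW eps0) // /q lerDl.
have h1 := ler_wpM2l (mulr_ge0 p0 (sqr_ge0 K)) q2.
have h2 := ler_wpM2l p0 q3.
have -> : p * (8 * K ^+ 2 + 2) * q ^+ 2 = 2 * (p * K ^+ 2 * (2 * q) ^+ 2 + p * q ^+ 2) by ring.
by rewrite ler_wpM2l // lerD.
Qed.

(** Every time is a multiple of arbitrarily small steps [tau], so every slice is seen by fine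
    lattices. There the integral exceeds the Riemann sum at most by the oscillation on a cell, which
    uniform continuity makes small enough to add at most another [c]. *)
Lemma lat_sL2 T v c : {within H, continuous v} -> 0 < c -> lat_le T (spread v) c ->
  (forall y, H y -> y 0 (time m) <= T) ->
  (sL2_norm H v <= (Num.sqrt (n%:R * (2 * c)))%:E)%E.
Proof.
move=> cv c0 [t1 t10 hl] hT; apply: ge_ereal_sup => _ [t _ <-].
set F := (fun x : 'rV[R]_m => _).
have [[t0 tT]|tbad] := pselect (0 <= t /\ t <= T); last first.
  suff -> : F = (fun=> 0%E) by rewrite integral_Rd0 sqrte0 lee_fin sqrtr_ge0.
  apply/funext => x; rewrite /F indicE; case: (boolP (_ \in H)) => [|_]; last by rewrite mul0r.
  rewrite inE => Hx; case: tbad; have := hT _ Hx; rewrite st_point_time => ->; split=> //.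
  by move/domain_slice : Hx => [].
have cH : compact H by exact: domain_compact.
pose f (y : 'rV[R]_(m + 1)) : R := `|v y| ^+ 2.
have cf : {within H, continuous f}.
  have cn : continuous (fun y : subspace H => `|v y|).
    move=> y; apply: (@continuous_comp (subspace H) 'cV[R]_n R v (fun x => `|x|)).
      exact: cv.
    exact: norm_continuous.
  exact: (continuous_mul cn cn).
pose eta := c / 2 ^+ m; have p0 : 0 < 2 ^+ m :> R by rewrite exprn_gt0.
have eta0 : 0 < eta by rewrite divr_gt0.
have [d d0 hd] := @compact_modulus R _ R H f cH cf eta eta0.
have L0 : 0 < 2 * Lam + 1 by rewrite addr_gt0 // mulr_gt0.
pose t2 := Num.min t1 (Num.min (d / (2 * Lam + 1)) (2 * Lam + 1)^-1).
have t20 : 0 < t2 by rewrite !lt_min t10 divr_gt0 // invr_gt0.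
have [tau [k [tau0 tt2 tE]]] : exists tau k, [/\ 0 < tau, tau < t2 & k%:R * tau = t].
  have [->|tn0] := eqVneq t 0.
    by exists (t2 / 2), 0%N; split; [rewrite divr_gt0|lra|rewrite mul0r].
  have tp : 0 < t by rewrite lt_neqAle eq_sym tn0.
  pose k := (Num.truncn (t / t2)).+1.
  have q0 : 0 <= t / t2 by rewrite divr_ge0 // ltW.
  have /andP[_ hk] := truncn_itv q0.
  have k0 : 0 < k%:R :> R by rewrite ltr0n.
  exists (t / k%:R), k; split; first by rewrite divr_gt0.
    by rewrite ltr_pdivrMr // mulrC -ltr_pdivrMr.
  by rewrite mulrC divfK // gt_eqF.
move: tt2; rewrite !lt_min => /andP[tt1 /andP[ttd ttL]].
have wb l : (lM l - lm l) * tau < d.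
  by apply: (le_lt_trans (width_le l tau0)); rewrite mulrC -ltr_pdivlMr.
have w1 l : (lM l - lm l) * tau <= 1.
  by apply: (le_trans (width_le l tau0)); rewrite mulrC -ler_pdivlMr // div1r ltW.
pose N := (\max_l ncell lM lm tau l)%N.
have hN l : (ncell lM lm tau l <= N)%N by exact: leq_bigmax.
have hls : lsum lM lm N tau (spread v) k <= c by apply: hl; rewrite ?tau0 ?tE.
have -> : F = (fun x => (\1_(slice lM lm (k%:R * tau)) x *
    enorm (spread v x (k%:R * tau)) ^+ 2)%:E).
  apply/funext => x; rewrite /F tE !indicE; congr (((nat_of_bool _)%:R * _)%:E).
  apply/idP/idP; rewrite !inE; first by move/domain_slice => [].
  by move=> xs; apply/domain_slice.
have := integral_slice_le lM0 lm0 tau0 hN (v := spread v) (k := k) w1 (ltW eta0).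
move=> /(_ _)/wrap [|hI].
  move=> x y xs ys xy.
  have Hx : H (st_point x (k%:R * tau)) by apply/domain_slice; split=> //; rewrite tE.
  have Hy : H (st_point y (k%:R * tau)) by apply/domain_slice; split=> //; rewrite tE.
  suff /hd -/(_ Hx Hy) : `|st_point x (k%:R * tau) - st_point y (k%:R * tau)| < d.
    by rewrite ltr_norml /f /spread => /andP[_]; rewrite ltrBlDr addrC => /ltW.
  pose b := \big[Num.max/0]_l ((lM l - lm l) * tau).
  apply: (@le_lt_trans _ _ b); last by apply/bigmax_ltP; split.
  have b0 : 0 <= b by apply: bigmax_ge_id.
  apply: st_norm_le => // [i|].
    rewrite sub_coord !st_point_space; apply: (le_trans (xy i)).
    by apply: le_bigmax.
  by rewrite sub_coord !st_point_time subrr normr0.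
apply: (@le_trans _ _ (sqrte (n%:R * (2 * c))%:E)); last by [].
have c20 : 0 <= n%:R * (2 * c) by rewrite !mulr_ge0 // ltW.
rewrite lee_sqrt ?lee_fin //; apply: (le_trans hI); rewrite lee_fin ler_wpM2l //.
rewrite /eta mulrCA divff ?mulr1 ?gt_eqF //; lra.
Qed.

End Solution.

(** * Uniqueness of the solution *)

Lemma sL2_norm_lower (R : realType) m n (H : set 'rV[R]_(m + 1))
    (g : 'rV[R]_(m + 1) -> 'cV[R]_n) (x0 : 'rV[R]_m) (t r a : R) : 0 < r -> 0 <= a ->
  (forall x : 'rV[R]_m, (forall i, `|x 0 i - x0 0 i| <= r) ->
    H (st_point x t) /\ a <= `|g (st_point x t)|) ->
  ((Num.sqrt (a ^+ 2 * (2 * r) ^+ m))%:E <= sL2_norm H g)%E.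
Proof.
move=> r0 a0 hg.
have r20 : 0 < 2 * r by rewrite mulr_gt0.
apply: (@le_trans _ _ (sqrte (integral_Rd (fun x =>
      (\1_H (st_point x t) * enorm (g (st_point x t)) ^+ 2)%:E)))); last first.
  by apply: ereal_sup_ubound; exists t.
rewrite -[X in (X <= _)%E]/(sqrte (a ^+ 2 * (2 * r) ^+ m)%:E) lee_sqrt; last first.
  by apply: integral_Rd_ge0 => x; rewrite lee_fin mulr_ge0 ?sqr_ge0 // indicE.
have := @integral_Rd_cells R m unit (fun _ => a ^+ 2) (fun _ l => x0 0 l - r)
  (fun _ _ => 2 * r) (fun _ => sqr_ge0 a) (fun _ _ => r20).
have eI : \sum_(i : unit) a ^+ 2 * \prod_(l < m) (2 * r) = a ^+ 2 * (2 * r) ^+ m.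
  by rewrite (big_pred1 tt) ?prodr_const ?card_ord // => -[].
rewrite eI => <-; apply: le_integral_Rd => x; rewrite lee_fin (big_pred1 tt); try by case.
  by rewrite mulr_ge0 ?sqr_ge0 // prodr_ge0.
have [inb|nin] := pselect (forall l, x0 0 l - r <= x 0 l < x0 0 l + r); last first.
  have [l hl] : exists l, ~ (x0 0 l - r <= x 0 l < x0 0 l + r).
    by apply: contrapT => h; apply: nin => l; apply: contrapT => h'; apply: h; exists l.
  rewrite (bigD1 l) //= indicE memNset ?mul0r ?mulr0; last first.
    rewrite /= in_itv /= => h; apply: hl; move: h; congr (_ <= _ < _); ring.
  by rewrite mulr_ge0 ?sqr_ge0 // indicE.
have [|Hx ax] := hg x.
  by move=> i; have /andP[h1 h2] := inb i; rewrite ler_norml; apply/andP; split; lra.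
rewrite [X in _ * X]big1 ?mulr1; last first.
  move=> l _; rewrite indicE mem_set //= in_itv /=.
  by have /andP[h1 h2] := inb l; apply/andP; split; lra.
rewrite indicE mem_set // mul1r ler_pXn2r ?nnegrE ?enorm_ge0 //.
by apply: (le_trans ax); exact: norm_le_enorm.
Qed.

Section Uniqueness.
Context {R : realType} {m n : nat} (A : 'M[R]_n) (B : 'I_m -> 'M[R]_n) (K Lam : R).
Let H := correctness_domain A B.
Hypothesis m_gt0 : (0 < m)%N.
Hypothesis n_gt0 : (0 < n)%N.
Hypothesis pA : posdef_mx A.
Hypothesis symB : forall i, (B i)^T = B i.
Hypothesis K0 : 0 <= K.
Hypothesis cA : coercive K A.
Hypothesis lM0 : forall i, 0 < lambda_max A (B i).
Hypothesis lm0 : forall i, lambda_min A (B i) < 0.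
Hypothesis LamM : forall l, lambda_max A (B l) <= Lam.
Hypothesis Lamm : forall l, - lambda_min A (B l) <= Lam.
Hypothesis Lam0 : 0 < Lam.

Lemma domain_time_bound : exists2 T, 0 < T & forall y, H y -> y 0 (time m) <= T.
Proof.
pose i0 := Ordinal m_gt0; pose w := lambda_max A (B i0) - lambda_min A (B i0).
have w0 : 0 < w by rewrite /w; have := lM0 i0; have := lm0 i0; lra.
exists w^-1; first by rewrite invr_gt0.
by move=> y Hy; have := domain_time i0 Hy; rewrite -/w -ler_pdivlMr // div1r.
Qed.

Lemma dilate_continuous (u : 'rV[R]_(m + 1) -> 'cV[R]_n) th : 0 <= th < 1 ->
  {within H, continuous u} -> {within H, continuous (fun y => u (dilate Lam th y))}.
Proof.
move=> th01 /within_continuousP cu; apply/within_continuousP => y Hy e e0.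
have [d d0 hd] := cu _ (dilate_domain LamM Lamm Lam0 th01 Hy) e e0.
exists d => // z Hz yz; apply: hd; first exact: dilate_domain.
rewrite dilate_dist normrZ; apply: le_lt_trans yz; rewrite ler_piMl //.
by case/andP: th01 => a b; rewrite ger0_norm // ltW.
Qed.

Lemma small_error (M V C T : R) : 0 <= M -> 0 < V -> 0 < C -> 0 < T ->
  exists eps del, [/\ 0 < eps, 0 < del & M * (eps + C * del * T) ^+ 2 < V].
Proof.
move=> M0 V0 C0 T0; pose s := Num.min 1 (V / (M + 1)).
have M1 : 0 < M + 1 by rewrite ltr_pwDr.
have s0 : 0 < s by rewrite lt_min ltr01 divr_gt0.
have s1 : s <= 1 by rewrite ge_min lexx.
have sV : s <= V / (M + 1) by rewrite ge_min lexx orbT.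
exists (s / 2), (s / (2 * C * T)); split.
- by rewrite divr_gt0.
- by rewrite divr_gt0 // !mulr_gt0.
have -> : s / 2 + C * (s / (2 * C * T)) * T = s by field; rewrite !gt_eqF.
have h1 : s ^+ 2 <= s by rewrite expr2 ler_piMl // ltW.
have h2 := ler_wpM2l M0 h1; move: sV; rewrite ler_pdivlMr // => h3; lra.
Qed.

(** A dilation of [u] is an approximate solution and may be compared with the solution [v] by
    [error_lat]. A point where [u] and [v] differ is moved into the interior; there they differ on a
    whole cube of a slice, and [sL2_norm_lower] contradicts an arbitrarily small error. *)
Lemma solution_unique (u v : 'rV[R]_(m + 1) -> 'cV[R]_n) phi :
  {within H, continuous u} -> {within H, continuous v} ->
  solves_cauchy_problem A B phi u -> solves_cauchy_problem A B phi v ->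
  forall y, H y -> u y = v y.
Proof.
move=> cu cv [[ut [ux [put pux pdeu]]] iu] [[vt [vx [pvt pvx pdev]]] iv] y Hy.
apply: contrapT => ne; pose f := fun y => u y - v y.
have cf : {within H, continuous f} by move=> z; apply: continuousB; [exact: cu|exact: cv].
have fy : 0 < `|f y| by rewrite normr_gt0 subr_eq0; apply/eqP.
have a40 : 0 < `|f y| / 4 by rewrite divr_gt0.
have [th th01 hth] := dilate_close m_gt0 lM0 lm0 LamM Lamm Lam0 cf a40.
pose y0 := dilate Lam th y.
have : interior H y0.
  apply: (@dilate_interior _ _ _ A B Lam LamM Lamm Lam0 th 0 y th01); last exact: domain_ext.
  by rewrite lexx /= divr_gt0 // subr_gt0; case/andP: th01.
move=> /nbhs_ballP[r1 /= r10 hr1].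
have Hy0 : H y0 by apply: hr1; exact: ballxx.
have /within_continuousP /(_ y0 Hy0 _ a40) [r2 r20 hr2] := cf.
pose r := Num.min r1 r2 / 2.
have r0 : 0 < r by rewrite divr_gt0 // lt_min r10.
have [rr1 rr2] : r < r1 /\ r < r2.
  have := ge_min r1 r1 r2; have := ge_min r2 r1 r2; rewrite !lexx orbT /= /r => h1 h2.
  by split; lra.
have [x0 [t0 y0E]] := st_pointP y0.
pose a := `|f y| / 4.
have fa (x : 'rV[R]_m) : (forall i, `|x 0 i - x0 0 i| <= r) ->
    H (st_point x t0) /\ 2 * a <= `|f (st_point x t0)|.
  move=> hx; have d : `|y0 - st_point x t0| <= r.
    rewrite y0E; apply: st_norm_le => [|i|]; first exact: ltW.
      by rewrite sub_coord !st_point_space distrC.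
    by rewrite sub_coord !st_point_time subrr normr0 ltW.
  have Hx : H (st_point x t0).
    by apply: hr1; rewrite -ball_normE /=; apply: le_lt_trans rr1.
  split=> //; have h1 := hr2 _ Hx (le_lt_trans d rr2); have h2 := hth y Hy.
  have : `|f y| <= `|f (st_point x t0)| + `|f y0 - f (st_point x t0)| + `|f y0 - f y|.
    have e : f y = f (st_point x t0) + (f y0 - f (st_point x t0)) - (f y0 - f y).
      by rewrite addrC -addrA; apply/matrixP => p q; rewrite !mxE; ring.
    by rewrite {1}e; apply: (le_trans (ler_normB _ _)); rewrite lerD2r ler_normD.
  by rewrite -/y0 in h2; rewrite /a; lra.
have a0 : 0 < a by [].
have [T T0 hT] := domain_time_bound.
pose V := a ^+ 2 * (2 * r) ^+ m.
have V0 : 0 < V by rewrite mulr_gt0 ?exprn_gt0 // mulr_gt0.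
pose C := @stab_const R m n K.
have C0 : 0 < C by exact: stab_const_gt0.
pose M := n%:R * (2 * (2 ^+ m * (8 * K ^+ 2 + 2))).
have K2 : 0 < 8 * K ^+ 2 + 2 by rewrite ltr_pwDr // mulr_ge0 // sqr_ge0.
have M0 : 0 < M by rewrite /M !mulr_gt0 ?ltr0n // exprn_gt0.
have [eps [del [eps0 del0 small]]] := small_error (ltW M0) V0 C0 T0.
(* The dilated [u] must be within [eps] of [u] initially, and within [a] on the cube, where the gap
   between [u] and [v] is at least 2 a. *)
pose eps' := Num.min eps a.
have eps'0 : 0 < eps' by rewrite lt_min eps0.
have [th' th'01 hth'] := dilate_close m_gt0 lM0 lm0 LamM Lamm Lam0 cu eps'0.
pose w := fun y => u (dilate Lam th' y).
have hlat := @error_lat R m n A B K Lam m_gt0 n_gt0 pA symB K0 cA lM0 lm0 LamM Lamm Lam0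
  w v vt vx del eps T pvt pvx pdev cv del0 eps0 (ltW T0)
  (dilated_approx m_gt0 lM0 lm0 LamM Lamm Lam0 put pux pdeu th'01 del0).
move: hlat => /(_ _)/wrap [|hlat].
  move=> x cx; have Hx : H (st_point x 0).
    apply/domain_slice; split=> // l; rewrite !mulr0 addr0; exact: cx.
  have -> : v (st_point x 0) = u (st_point x 0) by rewrite iu // iv.
  by apply: le_trans (hth' _ Hx) _; rewrite ge_min lexx.
have cw : {within H, continuous (fun y => w y - v y)}.
  by move=> z; apply: continuousB; [exact: dilate_continuous|exact: cv].
have c0 : 0 < 2 ^+ m * (8 * K ^+ 2 + 2) * (eps + C * del * T) ^+ 2.
  by rewrite !mulr_gt0 ?exprn_gt0 // addr_gt0 // !mulr_gt0.
have up := lat_sL2 m_gt0 lM0 lm0 LamM Lamm Lam0 cw c0 hlat hT.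
have lo : ((Num.sqrt V)%:E <= sL2_norm H (fun y => (w y - v y)%R))%E.
  apply: (@sL2_norm_lower R m n H _ x0 t0 r a r0 (ltW a0)) => x hx.
  have [Hx fx] := fa x hx; split=> //.
  have h1 := hth' _ Hx.
  have h2 : eps' <= a by rewrite ge_min lexx orbT.
  have e : f (st_point x t0) = (w (st_point x t0) - v (st_point x t0)) -
     (w (st_point x t0) - u (st_point x t0)).
    by apply/matrixP => p q; rewrite !mxE; ring.
  move: fx; rewrite e => fx; have := le_trans fx (ler_normB _ _).
  by rewrite -/(w _) in h1; lra.
have := le_trans lo up; rewrite lee_fin ler_psqrt ?nnegrE ?(ltW V0) //; last first.
  by apply: mulr_ge0 => //; apply: mulr_ge0 => //; exact: ltW c0.
rewrite leNgt => /negP; apply; move: small; rewrite /M.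
by congr (_ < _); ring.
Qed.

End Uniqueness.

(** * Certificates and their soundness *)

Section Certificate.
Context {F : realFieldType} {m n : nat}.
Variables (N L : nat) (al be : 'I_m -> F) (rho e dj : F).
Variables (Aq : 'I_n -> 'I_n -> F) (Bq : 'I_m -> 'I_n -> 'I_n -> F).
Variable W : ('I_(m + 1) -> nat) -> 'I_n -> F.
Implicit Type y : 'I_(m + 1) -> nat.

Definition grid_size (k : 'I_(m + 1)) : nat := if (k < m)%N then (2 ^ N)%N else L.
Definition mesh : F := 2 ^- N.
Definition next_node (k : 'I_(m + 1)) y : 'I_(m + 1) -> nat := fun l => (y l + (l == k))%N.
Definition node y (k : 'I_(m + 1)) : F := (y k)%:R * mesh.

(** The eigenvalues are replaced by the bounds [al] from below and [be] from above, which enlarges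
    the polyhedron, and [rho] leaves room for the cells that meet its boundary. *)
Definition near_node y : bool := [forall i : 'I_m,
  (al i * node y (time m) <= node y (space i) + rho) &&
  (node y (space i) <= 1 + be i * node y (time m) + rho)].

Definition in_grid y : bool := [forall k, (y k <= grid_size k)%N].

Definition slope y k a : F := (W (next_node k y) a - W y a) * 2 ^+ N.

Definition edge y k : bool :=
  [&& in_grid y, (y k < grid_size k)%N, near_node y & near_node (next_node k y)].

(** The second clause pays for the replacement of the matrices by rational ones: an error [dj] in an
    entry changes its product with a slope by at most [e]. *)
Definition small_residual y : bool := [forall k, edge y k] ==>
  [forall a, (`|\sum_b Aq a b * slope y (time m) b +
      \sum_i \sum_b Bq i a b * slope y (space i) b| <= e) &&
    [forall k, dj * `|slope y k a| <= e]].

(** Two is the index distance from the base corner of a cell that corners of the cells met by a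
    movement shorter than the mesh may have. *)
Definition small_oscillation y y' : bool := [forall k,
  [&& edge y k, edge y' k & [forall l, (y l <= y' l + 2) && (y' l <= y l + 2)]%N] ==>
  [forall a, `|slope y k a - slope y' k a| <= e]].

Definition at_zero (y : 'I_m -> nat) : 'I_(m + 1) -> nat :=
  fun k => if fintype.split k is inl i then y i else 0%N.

Definition wt (b : bool) (t : F) : F := if b then t else 1 - t.

(* The value at the node y of the fine grid of the interpolation of G on the
   grid with mesh 2^-N', computed in the coarse cell c. *)
Definition coarse_value N' (G : ('I_m -> nat) -> 'I_n -> F) (c y : 'I_m -> nat) a : F :=
  \sum_(b : {ffun 'I_m -> bool})
    (\prod_i wt (b i) ((y i)%:R * 2 ^- (N - N') - (c i)%:R)) * G (fun i => (c i + b i)%N) a.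

Definition small_initial N' G e0 (c y : 'I_m -> nat) : bool :=
  [forall i, (c i * 2 ^ (N - N') <= y i)%N && (y i <= (c i).+1 * 2 ^ (N - N'))%N] ==>
  [forall a, `|W (at_zero y) a - coarse_value N' G c y a| <= e0].

(** The left-hand sides bound the effect of errors [dj] in the entries, so that the forms remain
    positive for the true matrices. *)
Definition rayleigh (v v' : 'I_m -> 'I_n -> F) : bool := [forall i,
  (dj * (1 + `|al i|) * (\sum_a `|v i a|) ^+ 2 <
     \sum_a \sum_b v i a * (Bq i a b - al i * Aq a b) * v i b) &&
  (dj * (1 + `|be i|) * (\sum_a `|v' i a|) ^+ 2 <
     \sum_a \sum_b v' i a * (be i * Aq a b - Bq i a b) * v' i b)].

(** The conditions on the mesh make all corners of a cell that meets the domain satisfy [near_node];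
    the last condition makes the grid at least as high as the domain. *)
Definition geometry : bool := [forall i,
  [&& 0 <= al i, be i <= 0, mesh * (1 + al i) <= rho, mesh * (1 - be i) <= rho
    & 1 <= L%:R * mesh * (al i - be i)]].

End Certificate.

Lemma at_zero_space m (y : 'I_m -> nat) i : at_zero y (space i) = y i.
Proof. by rewrite /at_zero -[space i]/(unsplit (inl i : 'I_m + 'I_1)) unsplitK. Qed.

Lemma at_zero_time m (y : 'I_m -> nat) : at_zero y (time m) = 0%N.
Proof. by rewrite /at_zero -[time m]/(unsplit (inr ord0 : 'I_m + 'I_1)) unsplitK. Qed.

Lemma close_nat (a b : nat) (t : bool) : (a < b.+2)%N -> (b < a.+2)%N ->
  (a + t <= b + 2)%N && (b <= a + t + 2)%N.
Proof. by case: t => h1 h2; apply/andP; split; lia. Qed.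

(** Dyadic grids are nested, so a fine node lies in a coarse cell, and the multilinear corner
    formula has rational weights there. *)
Lemma coarse_valueE (R : realType) m n N N' (G : ('I_m -> nat) -> 'I_n -> R)
    (g : 'rV[R]_m -> 'cV[R]_n) (c y : 'I_m -> nat) : (N' <= N)%N ->
  multilinear_interpolation (fun=> 2 ^- N') (fun=> (2 ^ N')%N) (fun y => \col_a G y a) g ->
  (forall i, c i < 2 ^ N')%N ->
  (forall i, (c i * 2 ^ (N - N') <= y i)%N && (y i <= (c i).+1 * 2 ^ (N - N'))%N) ->
  g (\row_i ((y i)%:R * mesh N)) = \col_a coarse_value N N' G c y a.
Proof.
move=> NN hg cN cy; pose P := (2 ^ (N - N'))%N.
have h'0 : 0 < 2 ^- N' :> R by rewrite invr_gt0 exprn_gt0.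
have hP : 2 ^- N' = P%:R * mesh N :> R.
  by rewrite /mesh /P natrX -{2}(subnK NN) exprD invfM mulrA divff ?mul1r // expf_neq0.
have h0 : 0 < mesh N :> R by rewrite invr_gt0 exprn_gt0.
have ag : sep_affine (fun=> 2 ^- N') c g by case: hg => _ _ /(_ c cN).
have cell : grid_cell (fun=> 2 ^- N') c (\row_i ((y i)%:R * mesh N) : 'rV[R]_m).
  move=> i; rewrite mxE hP !mulrA -!natrM !ler_pM2r // !ler_nat; exact: cy.
rewrite (sep_affine_formula (fun _ => h'0) ag cell).
apply/matrixP => a j; rewrite ord1 [RHS]mxE /corner_formula summxE; apply: eq_bigr => b' _.
rewrite mxE; congr (_ * _).
  apply: eq_bigr => i _; rewrite /wt /weight /cell_frac mxE.
  have -> : (y i)%:R * mesh N / 2 ^- N' = (y i)%:R * 2 ^- (N - N') :> R.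
    have P00 : P%:R != 0 :> R by rewrite pnatr_eq0 -lt0n expn_gt0.
    by rewrite hP -natrX -/P; field; rewrite P00 gt_eqF.
  by [].
have [_ hn _] := hg.
have := hn (fun i => c i + b' i)%N; move=> /(_ _)/wrap[|].
  by move=> i; have := cN i; case: (b' i); rewrite ?addn1 ?addn0 // => /ltnW.
rewrite -[corner _ c b']/(\row_i ((c i + b' i)%:R * 2 ^- N')) => ->.
by rewrite mxE.
Qed.

Section Soundness.
Context {R : realType} {m n : nat} (A : 'M[R]_n) (B : 'I_m -> 'M[R]_n) (Lam : R).
Let lM i := lambda_max A (B i).
Let lm i := lambda_min A (B i).
Let H := correctness_domain A B.
Hypothesis m_gt0 : (0 < m)%N.
Hypothesis n_gt0 : (0 < n)%N.
Hypothesis pA : posdef_mx A.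
Hypothesis symB : forall i, (B i)^T = B i.
Hypothesis lM0 : forall i, 0 < lM i.
Hypothesis lm0 : forall i, lm i < 0.
Hypothesis Lam0 : 0 < Lam.
Variables (N L : nat) (al be : 'I_m -> R) (rho e dj : R).
Variables (Aq : 'I_n -> 'I_n -> R) (Bq : 'I_m -> 'I_n -> 'I_n -> R).
Variable W : ('I_(m + 1) -> nat) -> 'I_n -> R.
Hypothesis e0 : 0 < e.
Hypothesis dj0 : 0 <= dj.
Hypothesis hA : forall a b, `|Aq a b - A a b| <= dj.
Hypothesis hB : forall i a b, `|Bq i a b - B i a b| <= dj.

Let K : 'I_(m + 1) -> nat := grid_size N L.
Let h : R := mesh N.

Lemma mesh_gt0 : 0 < h. Proof. by rewrite invr_gt0 exprn_gt0. Qed.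

Lemma rayleigh_bounds v v' : rayleigh al be dj Aq Bq v v' ->
  forall i, al i < lM i /\ lm i < be i.
Proof.
move=> /forallP hr i; have /andP[h1 h2] := hr i.
(* The sign [sg] treats both eigenvalue bounds at once. *)
have key (c : R) (p : 'I_n -> R) (sg : R) : `|sg| = 1 ->
    dj * (1 + `|c|) * (\sum_a `|p a|) ^+ 2 <
     \sum_a \sum_b p a * (sg * (Bq i a b - c * Aq a b)) * p b ->
    0 < sg * (qf (B i) (\col_a p a) - c * qf A (\col_a p a)).
  move=> sg1 hp.
  pose E : 'M[R]_n := \matrix_(a, b) ((B i a b - Bq i a b) - c * (A a b - Aq a b)).
  have Ec a b : `|E a b| <= dj * (1 + `|c|).
    rewrite mxE (_ : dj * _ = dj + `|c| * dj); last by ring.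
    apply: (le_trans (ler_normB _ _)).
    by rewrite normrM distrC (distrC (A a b)); apply: lerD => //; rewrite ler_wpM2l.
  have := @abs_qf_le _ _ E (\col_a p a) _ Ec.
  have -> : \sum_a `|(\col_a0 p a0) a 0| = \sum_a `|p a|.
    by apply: eq_bigr => a _; rewrite mxE.
  have -> : sg * (qf (B i) (\col_a p a) - c * qf A (\col_a p a)) =
     \sum_a \sum_b p a * (sg * (Bq i a b - c * Aq a b)) * p b + sg * qf E (\col_a p a).
    rewrite /qf !bilE !mulr_sumr -sumrB mulr_sumr -big_split; apply: eq_bigr => a _ /=.
    rewrite !mulr_sumr -sumrB mulr_sumr -big_split; apply: eq_bigr => b _ /=.
    by rewrite !mxE; ring.
  move=> hE; have : `|sg * qf E (\col_a p a)| <= dj * (1 + `|c|) * (\sum_a `|p a|) ^+ 2.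
    by rewrite normrM sg1 mul1r.
  by rewrite ler_norml => /andP[hE1 _]; lra.
split.
  apply/(lambda_max_gt (al i) n_gt0 pA (symB i)); exists (\col_a v i a).
  have := key (al i) (v i) 1 (normr1 _); rewrite mul1r; apply.
  apply: (lt_le_trans h1); rewrite le_eqVlt; apply/orP; left; apply/eqP.
  by apply: eq_bigr => a _; apply: eq_bigr => b _; ring.
apply/(lambda_min_lt (be i) n_gt0 pA (symB i)); exists (\col_a v' i a).
have := key (be i) (v' i) (-1); rewrite normrN1 => /(_ erefl).
rewrite mulN1r opprB; apply.
apply: (lt_le_trans h2); rewrite le_eqVlt; apply/orP; left; apply/eqP.
by apply: eq_bigr => a _; apply: eq_bigr => b _; ring.
Qed.

Hypothesis geo : geometry N L al be rho.
Hypothesis al_lM : forall i, al i <= lM i.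
Hypothesis lm_be : forall i, lm i <= be i.

Lemma grid_size_space i : K (space i) = (2 ^ N)%N.
Proof. by rewrite /K /grid_size /= ltn_ord. Qed.

Lemma grid_size_time : K (time m) = L.
Proof. by rewrite /K /grid_size /= addn0 ltnn. Qed.

Lemma domain_box : H `<=` grid_box (fun=> h) K.
Proof.
move=> y Hy; apply: st_coordP => [i|].
  rewrite grid_size_space /h /mesh natrX divff ?expf_neq0 //.
  exact: (domain_unit lM0 lm0).
rewrite grid_size_time; have [t0 _] := Hy; rewrite t0 /=.
pose i0 := Ordinal m_gt0; have := domain_time i0 Hy; rewrite -/(lM i0) -/(lm i0).
have /forallP/(_ i0)/and5P[_ _ _ _ g5] := geo.
have ab : 0 < al i0 - be i0.
  rewrite ltNge; apply/negP => le; have Lh : 0 <= L%:R * h by rewrite mulr_ge0 // ltW // mesh_gt0.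
  by have := mulr_ge0_le0 Lh le; rewrite -/h in g5; lra.
have wab : al i0 - be i0 <= lM i0 - lm i0 by have := al_lM i0; have := lm_be i0; lra.
move=> h1; rewrite -(ler_pM2r ab); apply: le_trans g5.
by apply: le_trans h1; rewrite ler_wpM2l.
Qed.

Lemma grid_size_gt0 k : (0 < K k)%N.
Proof.
rewrite /K /grid_size; case: ifP => _; first by rewrite expn_gt0.
rewrite lt0n; apply/negP => /eqP L0.
have /forallP/(_ (Ordinal m_gt0))/and5P[_ _ _ _] := geo.
by rewrite L0 !mul0r ler10.
Qed.

Lemma near_corner p c (b : 'I_(m + 1) -> bool) : H p -> grid_cell (fun=> h) c p ->
  near_node N al be rho (fun k => (c k + b k)%N).
Proof.
move=> Hp cp; have h0 := mesh_gt0.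
have dist k : - h <= node N (fun k => (c k + b k)%N) k - p 0 k <= h.
  have /andP[c1 c2] := cp k; rewrite /node -/h natrD.
  have b01 : 0 <= (b k)%:R * h <= h by case: (b k); rewrite ?mul1r ?mul0r ?lexx ?ltW.
  by move: c1 c2 b01; rewrite -natr1 !mulrDl mul1r => c1 c2 /andP[b0 b1]; apply/andP; split; lra.
have [t0 hp] := Hp.
apply/forallP => i; have [hp1 hp2] := hp i.
rewrite -/(lM i) -/(lm i) in hp1 hp2.
have /forallP/(_ i)/and5P[g1 g2 g3 g4 _] := geo; rewrite -/h in g3 g4.
have /andP[d1 d2] := dist (space i); have /andP[d3 d4] := dist (time m).
move: (node N _ (space i)) (node N _ (time m)) d1 d2 d3 d4 => X T d1 d2 d3 d4.
have a1 := ler_wpM2r t0 (al_lM i); have a2 := ler_wpM2r t0 (lm_be i).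
have a3 : al i * (T - p 0 (time m)) <= al i * h by rewrite ler_wpM2l.
have a4 : be i * h <= be i * (T - p 0 (time m)).
  by rewrite -subr_ge0 -mulrBr mulr_le0 // subr_le0.
by apply/andP; split; lra.
Qed.

Section Interpolant.
Variable f : 'rV[R]_(m + 1) -> 'cV[R]_n.
Hypothesis hf : multilinear_interpolation (fun=> h) K (fun y => \col_a W y a) f.
Hypothesis res : forall y, in_grid N L y -> small_residual N L al be rho e dj Aq Bq W y.
Hypothesis osc : forall y y', in_grid N L y -> in_grid N L y' ->
  small_oscillation N L al be rho e W y y'.

Let aff c : (forall i, (c i < K i)%N) -> sep_affine (fun=> h) c f.
Proof. by move=> cK; case: hf => _ _ /(_ c cK). Qed.

Lemma edge_corner p c k (b : 'I_(m + 1) -> bool) : H p ->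
  (forall i, (c i < K i)%N) -> grid_cell (fun=> h) c p -> b k = false ->
  edge N L al be rho (fun i => (c i + b i)%N) k.
Proof.
move=> Hp cK cp bk; apply/and4P; split.
- apply/forallP => i; rewrite -/(K i); have := cK i; case: (b i); rewrite ?addn1 ?addn0 //.
  exact: ltnW.
- by rewrite bk addn0 cK.
- exact: near_corner Hp cp.
suff -> : next_node k (fun i => (c i + b i)%N) = (fun i => (c i + (b i || (i == k)))%N).
  exact: near_corner Hp cp.
apply/funext => i; rewrite /next_node -addnA; congr (_ + _)%N.
by case: eqP => [->|_]; rewrite ?bk ?orbF ?addn0.
Qed.

Lemma edge_in_grid y k : edge N L al be rho y k -> in_grid N L y.
Proof. by case/and4P. Qed.

Lemma edge_next_in_grid y k : edge N L al be rho y k -> in_grid N L (next_node k y).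
Proof.
case/and4P => /forallP g yk _ _; apply/forallP => l; rewrite /next_node.
by case: eqP => [->|_]; rewrite ?addn1 ?addn0.
Qed.

Lemma interpolant_node y : in_grid N L y -> f (\row_i ((y i)%:R * h)) = \col_a W y a.
Proof. by move=> /forallP g; case: hf => _ /(_ y) hn _; apply: hn. Qed.

(** The cells met by the segment have corners at index distance at most two from [c], so [osc]
    compares all their slopes in direction [k] with the one at [c]. *)
Lemma interpolant_step p c k s : H p -> (forall i, (c i < K i)%N) ->
  grid_cell (fun=> h) c p ->
  forall z, grid_box (fun=> h) K z -> H z -> H (z + s *: delta_mx 0 k) -> `|s| <= h ->
  (forall i, `|z 0 i - p 0 i| + `|s| < h) ->
  `|f (z + s *: delta_mx 0 k) - f z - s *: \col_a slope N W c k a| <= `|s| * e.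
Proof.
move=> Hp cK cp z bz Hz Hz' sh zp.
apply: (@slope_in_box R (m + 1) n (fun=> h) (fun _ => mesh_gt0) K) => //.
- exact: grid_size_gt0.
- exact: domain_box.
move=> c' cK' [a a01 cell'] b bk.
set q := z + (a * s) *: delta_mx 0 k in cell'.
have Hq : H q.
  have ext0 y : H y -> ext_domain A B 0 y by exact: domain_ext.
  have [q0 hq] := ext_domain_segment a01 (ext0 _ Hz) (ext0 _ Hz').
  by split=> // i; have := hq i; rewrite oppr0.
have E1 := edge_corner Hq cK' cell' bk.
have E2 : edge N L al be rho c k.
  have := @edge_corner p c k (fun=> false) Hp cK cp erefl.
  by congr edge; apply/funext => i; rewrite addn0.
have close l : ((c' l + b l)%N <= c l + 2)%N && (c l <= (c' l + b l)%N + 2)%N.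
  have h0 := mesh_gt0.
  have /andP[p1 p2] := cp l; have /andP[q1 q2] := cell' l.
  have d : `|q 0 l - p 0 l| < h.
    rewrite /q shift_coord addrAC; apply: le_lt_trans (zp l).
    apply: (le_trans (ler_normD _ _)); rewrite lerD2l normrM.
    have D : `|(l == k)%:R| <= 1 :> R by case: (l == k); rewrite ?normr1 ?normr0.
    case/andP: a01 => a0 a1; apply: (le_trans (ler_piMr (normr_ge0 _) D)).
    by rewrite normrM (ger0_norm a0) ler_piMl.
  move: d; rewrite ltr_norml => /andP[d1 d2].
  have l1 : (c' l)%:R * h < (c l).+2%:R * h.
    by rewrite -[(c l).+2%:R]natr1 mulrDl mul1r; lra.
  have l2 : (c l)%:R * h < (c' l).+2%:R * h.
    by rewrite -[(c' l).+2%:R]natr1 mulrDl mul1r; lra.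
  move: l1 l2; rewrite !ltr_pM2r // !ltr_nat => l1 l2.
  exact: close_nat.
have /forallP/(_ k) := osc (edge_in_grid E1) (edge_in_grid E2).
rewrite E1 E2 /= => /implyP/(_ _)/wrap[|/forallP hosc]; first exact/forallP.
rewrite -[corner _ c' _]/(\row_i (((c' i + (b i || (i == k)))%N)%:R * h)).
rewrite -[corner _ c' b]/(\row_i (((c' i + b i)%N)%:R * h)).
have nx : (fun i => (c' i + (b i || (i == k)))%N) = next_node k (fun i => (c' i + b i)%N).
  apply/funext => i; rewrite /next_node -addnA; congr (_ + _)%N.
  by case: eqP => [->|_]; rewrite ?bk ?orbF ?addn0.
have := interpolant_node (edge_next_in_grid E1); rewrite -nx => ->.
rewrite (interpolant_node (edge_in_grid E1)) nx.
have h0 := mesh_gt0.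
apply: mx_norm_le => [|a' j]; first by rewrite mulr_ge0 // ltW.
have hN : h * 2 ^+ N = 1 by rewrite /h /mesh mulVf // expf_neq0.
have -> : (\col_a0 W (next_node k (fun i => (c' i + b i)%N)) a0 - \col_a0 W (fun i => (c' i + b i)%N) a0 -
   h *: \col_a0 slope N W c k a0) a' j =
   h * (slope N W (fun i => (c' i + b i)%N) k a' - slope N W c k a').
  by rewrite !mxE mulrBr; congr (_ - _); rewrite [in RHS]/slope mulrCA hN mulr1.
by rewrite normrM gtr0_norm // ler_wpM2l // ltW.
Qed.

(** The slopes at the base corner of the cell that contains (x, t) serve as gradient. The residual
    costs [e] for the test and [(m + 1) * n] times [e] for the replaced matrix entries; increments
    in space, of length up to [Lam * tau], cost [Lam * e]. *)
Lemma interpolant_approx : exists2 tau0, 0 < tau0 & forall tau, 0 < tau < tau0 ->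
  approx_sol A B lM lm tau Lam ((1 + ((m + 1) * n)%:R + Lam) * e) (spread f).
Proof.
have h0 := mesh_gt0; have L1 : 0 < 2 * Lam + 1 by rewrite addr_gt0 // mulr_gt0.
exists (h / (2 * Lam + 1)); first by rewrite divr_gt0.
move=> tau /andP[tau0]; rewrite ltr_pdivlMr // => tauh x t t0 xs'.
have Lt : 0 < tau * Lam by rewrite mulr_gt0.
have xs := slice_le lM0 lm0 tau0 xs'.
have HY : H (st_point x t) by apply/domain_slice.
have HY' : H (st_point x (t + tau)).
  by apply/domain_slice; split=> //; rewrite addr_ge0 // ltW.
have [c cK cY] := box_cell (fun _ => mesh_gt0) grid_size_gt0 (domain_box HY).
have Ec k : edge N L al be rho c k.
  have := @edge_corner _ c k (fun=> false) HY cK cY erefl.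
  by congr edge; apply/funext => i; rewrite addn0.
exists (\col_a slope N W c (time m) a), (fun i => \col_a slope N W c (space i) a).
have e_ge0 := ltW e0.
have del_e (k : R) : 0 <= k -> k <= 1 + ((m + 1) * n)%:R + Lam ->
    k * e <= (1 + ((m + 1) * n)%:R + Lam) * e by move=> _ hk; rewrite ler_wpM2r.
split.
- have := res (edge_in_grid (Ec (time m))) => /implyP/(_ _)/wrap[|/forallP hres].
    by apply/forallP.
  apply: (@le_trans _ _ ((1 + ((m + 1) * n)%:R) * e)); last first.
    by apply: del_e; rewrite ?addr_ge0 // lerDl ltW.
  apply: mx_norm_le => [|a j]; first by rewrite mulr_ge0 // addr_ge0.
  rewrite ord1; have /andP[h1 h2] := hres a.
  have sl k b : dj * `|slope N W c k b| <= e.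
    by have /andP[_ /forallP] := hres b; apply.
  have diff (M : 'I_n -> R) M' k : (forall b, `|M b - M' b| <= dj) ->
      `|\sum_b (M' b - M b) * slope N W c k b| <= n%:R * e.
    move=> hM; apply: (le_trans (ler_norm_sum _ _ _)).
    rewrite -[n in n%:R]card_ord mulr_natl -sumr_const; apply: ler_sum => b _.
    by rewrite normrM distrC; apply: le_trans (sl k b); rewrite ler_wpM2r.
  have -> : (A *m \col_a0 slope N W c (time m) a0 +
      \sum_l B l *m \col_a0 slope N W c (space l) a0) a 0 =
    (\sum_b Aq a b * slope N W c (time m) b +
      \sum_i \sum_b Bq i a b * slope N W c (space i) b) +
    (\sum_b (A a b - Aq a b) * slope N W c (time m) b +
      \sum_i \sum_b (B i a b - Bq i a b) * slope N W c (space i) b).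
    rewrite addrACA -big_split -big_split /= [LHS]mxE; congr (_ + _).
      by rewrite mxE; apply: eq_bigr => b _; rewrite mxE; ring.
    rewrite summxE; apply: eq_bigr => i _; rewrite mxE -big_split.
    by apply: eq_bigr => b _; rewrite mxE /=; ring.
  apply: (le_trans (ler_normD _ _)); rewrite mulrDl mul1r; apply: lerD => //.
  apply: (le_trans (ler_normD _ _)).
  have -> : ((m + 1) * n)%:R * e = n%:R * e + m%:R * (n%:R * e).
    by rewrite natrM natrD; ring.
  apply: lerD; first exact: diff.
  apply: (le_trans (ler_norm_sum _ _ _)).
  rewrite -[m in m%:R]card_ord mulr_natl -sumr_const; apply: ler_sum => i _.
  exact: diff.
- rewrite /spread st_point_later.
  apply: (le_trans (@interpolant_step _ c (time m) tau HY cK cY _ (domain_box HY) HY _ _ _)).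
  + by rewrite -st_point_later.
  + by rewrite gtr0_norm //; lra.
  + by move=> i; rewrite subrr normr0 add0r gtr0_norm //; lra.
  rewrite gtr0_norm // mulrC ler_wpM2r ?(ltW tau0) // -[leLHS]mul1r; apply: del_e => //.
  by rewrite -addrA lerDl addr_ge0 // ltW.
move=> z l s zs zs' zn sn; rewrite /spread st_point_shift.
have Hz : H (st_point z t) by apply/domain_slice.
have Hz' : H (st_point z t + s *: delta_mx 0 (space l)).
  by rewrite -st_point_shift; apply/domain_slice.
apply: (le_trans (@interpolant_step _ c (space l) s HY cK cY _ (domain_box Hz) Hz Hz' _ _)).
- by apply: (le_trans sn); lra.
- apply: st_coordP => [i|]; rewrite ?st_point_space ?st_point_time.
    by have := zn i; lra.
  by rewrite subrr normr0; lra.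
apply: (@le_trans _ _ (Lam * e * tau)); first by rewrite mulrAC ler_wpM2r.
rewrite ler_wpM2r ?(ltW tau0) //; apply: del_e; first exact: ltW.
by rewrite lerDr addr_ge0.
Qed.

(** The fine grid refines the coarse one, so at t = 0 both interpolants are separately affine on
    fine cells, and their difference is controlled by its values at the fine nodes. *)
Lemma initial_error N' (G : ('I_m -> nat) -> 'I_n -> R) e1 g : (N' <= N)%N -> 0 <= e1 ->
  multilinear_interpolation (fun=> 2 ^- N') (fun=> (2 ^ N')%N) (fun y => \col_a G y a) g ->
  (forall c y : 'I_m -> nat, (forall i, c i < 2 ^ N')%N -> (forall i, y i <= 2 ^ N)%N ->
    small_initial N W N' G e1 c y) ->
  forall x, unit_cube x -> `|f (st_point x 0) - g x| <= e1.
Proof.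
move=> NN e10 hg hin x cx; have h0 := mesh_gt0.
have bx : grid_box (fun=> h) (fun=> (2 ^ N)%N) x.
  by move=> i; rewrite /h /mesh natrX divff ?expf_neq0.
have [c' c'N cell'] := box_cell (fun _ => mesh_gt0) (fun _ : 'I_m => expn_gt0 2 N) bx.
pose P := (2 ^ (N - N'))%N; have P0 : (0 < P)%N by rewrite expn_gt0.
pose c i := (c' i %/ P)%N.
have cN i : (c i < 2 ^ N')%N by rewrite /c ltn_divLR // /P -expnD subnKC.
have cP (b : 'I_m -> bool) i : (c i * P <= c' i + b i)%N && (c' i + b i <= (c i).+1 * P)%N.
  rewrite (leq_trans (leq_divM _ _)) ?leq_addr //=.
  by have := ltn_ceil (c' i) P0; case: (b i); rewrite ?addn1 ?addn0 // => /ltnW.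
have hP : 2 ^- N' = P%:R * h :> R.
  by rewrite /h /mesh /P natrX -{2}(subnK NN) exprD invfM mulrA divff ?mul1r // expf_neq0.
have cell_sub : grid_cell (fun=> h) c' `<=` grid_cell (fun=> 2 ^- N') c.
  move=> z hz i; have /andP[z1 z2] := hz i.
  have /andP[p1 _] := cP (fun=> false) i; have /andP[_ p2] := cP (fun=> true) i.
  rewrite hP !mulrA -!natrM; apply/andP; split.
    by apply: le_trans z1; rewrite ler_pM2r // ler_nat; move: p1; rewrite addn0.
  by apply: (le_trans z2); rewrite ler_pM2r // ler_nat; move: p2; rewrite addn1.
have ag : sep_affine (fun=> 2 ^- N') c g by case: hg => _ _ /(_ c cN).
have ag' : sep_affine (fun=> h) c' g.
  by move=> z z' i hz hz' e' a a01; exact: (ag _ _ i (cell_sub _ hz) (cell_sub _ hz') e' a a01).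
have af : sep_affine (fun=> h) c' (fun x => f (st_point x 0)).
  pose cc k := at_zero c' k.
  have ccs i : cc (space i) = c' i.
    exact: at_zero_space.
  have cct : cc (time m) = 0%N.
    exact: at_zero_time.
  have ccK k : (cc k < K k)%N.
    move: k; apply: st_coordP => [i|]; first by rewrite ccs grid_size_space.
    by rewrite cct grid_size_gt0.
  have cell_st z : grid_cell (fun=> h) c' z -> grid_cell (fun=> h) cc (st_point z 0).
    move=> hz; apply: st_coordP => [i|]; first by rewrite ccs st_point_space.
    by rewrite cct st_point_time mul0r lexx mul1r ltW.
  move=> z z' i hz hz' e' a a01.
  have := aff ccK (cell_st _ hz) (cell_st _ hz') (i := space i) _ a01.
  move=> /(_ _)/wrap[|<-].
    apply: st_coordP => [j|]; rewrite ?st_point_space ?st_point_time //.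
    by rewrite space_eq => ji; exact: e'.
  have cvx q (X Y : 'rV[R]_q) k : (a *: X + (1 - a) *: Y) 0 k = a * X 0 k + (1 - a) * Y 0 k.
    by rewrite !mxE.
  congr f; apply: st_rowP => [j|]; first by rewrite cvx !st_point_space cvx.
  by rewrite cvx !st_point_time; ring.
apply: (cell_convex (fun _ => mesh_gt0) (sep_affineB af ag') (@convex_ball0 R n e1)) cell' => b /=.
pose y i := (c' i + b i)%N.
have yN i : (y i <= 2 ^ N)%N.
  by have := c'N i; rewrite /y; case: (b i); rewrite ?addn1 ?addn0 // => /ltnW.
have := hin c y cN yN => /implyP/(_ _)/wrap[|/forallP hi].
  by apply/forallP => i; exact: cP.
have fE : f (st_point (corner (fun=> h) c' b) 0) = \col_a W (at_zero y) a.
  have yg : in_grid N L (at_zero y).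
    apply/forallP; apply: st_coordP => [i|]; last by rewrite at_zero_time.
    by rewrite at_zero_space -/(K _) grid_size_space.
  rewrite -(interpolant_node yg); congr f; apply: st_rowP => [i|].
    by rewrite st_point_space !mxE at_zero_space.
  by rewrite st_point_time mxE at_zero_time mul0r.
have gE : g (corner (fun=> h) c' b) = \col_a coarse_value N N' G c y a.
  exact: (coarse_valueE NN hg cN (cP b)).
rewrite fE gE; apply: mx_norm_le => // a j; rewrite !mxE; exact: hi.
Qed.

End Interpolant.

End Soundness.

(** * Existence of certificates *)

Section Transfer.
Context {R : realType} {m n : nat}.
Variables (N L : nat) (al be : 'I_m -> rat) (rho e dj : rat).
Variables (Aq : 'I_n -> 'I_n -> rat) (Bq : 'I_m -> 'I_n -> 'I_n -> rat).
Variable W : ('I_(m + 1) -> nat) -> 'I_n -> rat.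

Local Notation r := (@ratr R).
Local Notation alR := (fun i => r (al i)).
Local Notation beR := (fun i => r (be i)).
Local Notation AR := (fun a b => r (Aq a b)).
Local Notation BR := (fun i a b => r (Bq i a b)).
Local Notation WR := (fun y a => r (W y a)).

Let ratrD x y : r (x + y) = r x + r y. Proof. exact: rmorphD. Qed.
Let ratrM x y : r (x * y) = r x * r y. Proof. exact: rmorphM. Qed.
Let ratrN x : r (- x) = - r x. Proof. exact: rmorphN. Qed.
Let ratrV x : r (x^-1) = (r x)^-1. Proof. exact: fmorphV. Qed.
Let ratrX x k : r (x ^+ k) = r x ^+ k. Proof. exact: rmorphXn. Qed.
Let ratr1 : r 1 = 1. Proof. exact: rmorph1. Qed.
Let ratr0 : r 0 = 0. Proof. exact: rmorph0. Qed.
Let ratr_normE x : r `|x| = `|r x|. Proof. exact: ratr_norm. Qed.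
Let ratr_sum (I : finType) (f : I -> rat) : r (\sum_i f i) = \sum_i r (f i).
Proof. exact: rmorph_sum. Qed.
Let ratr_prod (I : finType) (f : I -> rat) : r (\prod_i f i) = \prod_i r (f i).
Proof. exact: rmorph_prod. Qed.
Let ratrE := (ratrX, ratrD, ratrM, ratrN, ratrV, ratr1, ratr0, ratr_nat, ratr_normE, ratr_sum,
  ratr_prod).

Lemma ratr_mesh : r (mesh N) = mesh N.
Proof. by rewrite /mesh !ratrE. Qed.

Lemma ratr_node (y : 'I_(m + 1) -> nat) k : r (node N y k) = node N y k.
Proof. by rewrite /node !(ratr_mesh, ratrE). Qed.

Lemma ratr_slope y k a : r (slope N W y k a) = slope N WR y k a.
Proof. by rewrite /slope !ratrE. Qed.

(** The program evaluates the tests over the rationals, the analysis reads them over the reals. As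
    [ratr] is a field morphism that preserves and reflects the order, both yield the same
    boolean. *)
Lemma ratr_near_node y : near_node N alR beR (r rho) y = near_node N al be rho y.
Proof. by apply: eq_forallb => i; rewrite -!(ler_rat R) !(ratr_node, ratrE). Qed.

Lemma ratr_edge y k : edge N L alR beR (r rho) y k = edge N L al be rho y k.
Proof. by rewrite /edge !ratr_near_node. Qed.

Lemma ratr_small_residual y :
  small_residual N L alR beR (r rho) (r e) (r dj) AR BR WR y =
  small_residual N L al be rho e dj Aq Bq W y.
Proof.
congr (_ ==> _); first by apply: eq_forallb => k; rewrite ratr_edge.
apply: eq_forallb => a; congr (_ && _).
  rewrite -(ler_rat R) !ratrE; congr (`|_ + _| <= _).
    by apply: eq_bigr => b _; rewrite !(ratr_slope, ratrE).
  apply: eq_bigr => i _; rewrite ratrE; apply: eq_bigr => b _.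
  by rewrite !(ratr_slope, ratrE).
by apply: eq_forallb => k; rewrite -(ler_rat R) !(ratr_slope, ratrE).
Qed.

Lemma ratr_small_oscillation y y' :
  small_oscillation N L alR beR (r rho) (r e) WR y y' =
  small_oscillation N L al be rho e W y y'.
Proof.
apply: eq_forallb => k; rewrite !ratr_edge; congr (_ ==> _).
by apply: eq_forallb => a; rewrite -(ler_rat R) !(ratr_slope, ratrE).
Qed.

Lemma ratr_coarse_value N' (G : ('I_m -> nat) -> 'I_n -> rat) c y a :
  r (coarse_value N N' G c y a) = coarse_value N N' (fun y a => r (G y a)) c y a.
Proof.
rewrite ratrE; apply: eq_bigr => b _; rewrite !ratrE; congr (_ * _).
by apply: eq_bigr => i _; rewrite /wt; case: (b i); rewrite !ratrE.
Qed.

Lemma ratr_small_initial N' (G : ('I_m -> nat) -> 'I_n -> rat) c y :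
  small_initial N WR N' (fun y a => r (G y a)) (r e) c y = small_initial N W N' G e c y.
Proof.
congr (_ ==> _); apply: eq_forallb => a.
by rewrite -(ler_rat R) !(ratr_coarse_value, ratrE).
Qed.

Lemma ratr_rayleigh v v' :
  rayleigh alR beR (r dj) AR BR (fun i a => r (v i a)) (fun i a => r (v' i a)) =
  rayleigh al be dj Aq Bq v v'.
Proof.
have sumN (w : 'I_n -> rat) : r (\sum_a `|w a|) = \sum_a `|r (w a)|.
  by rewrite ratrE; apply: eq_bigr => a _; rewrite ratrE.
apply: eq_forallb => i; rewrite -!(ltr_rat R) !(sumN, ratrE).
have lt2 (C X Y : R) : X = Y -> (C < X) = (C < Y) by move=> ->.
congr (_ && _); apply: lt2; apply: eq_bigr => a _; rewrite !ratrE;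
  by apply: eq_bigr => b _; rewrite !ratrE.
Qed.

Lemma ratr_geometry : geometry N L alR beR (r rho) = geometry N L al be rho.
Proof. by apply: eq_forallb => i; rewrite -!(ler_rat R) !(ratr_mesh, ratrE). Qed.

End Transfer.

Section Approximation.
Context {R : realType}.

Lemma rat_approx (x eps : R) : 0 < eps -> exists q : rat, `|ratr q - x| < eps.
Proof.
move=> e0; have /rat_in_itvoo[q] : x - eps < x + eps by lra.
by rewrite in_itv /= => /andP[a b]; exists q; rewrite ltr_norml; apply/andP; split; lra.
Qed.

Lemma rat_between (x y : R) : x < y -> exists q : rat, x < ratr q < y.
Proof. by move=> /rat_in_itvoo[q]; rewrite in_itv /=; exists q. Qed.

Lemma exp2V_small (eps : R) : 0 < eps -> exists j0, forall j, (j0 <= j)%N -> 2 ^- j <= eps.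
Proof.
move=> e0; exists (Num.truncn eps^-1).+1 => j hj.
have ei : 0 <= eps^-1 by rewrite invr_ge0 ltW.
rewrite -(invrK eps) lef_pV2 ?posrE ?invr_gt0 ?exprn_gt0 //.
have := truncnS_gt eps^-1; move=> /ltW h; apply: (le_trans h).
by rewrite -natrX ler_nat (leq_trans hj) // ltnW // ltn_expl.
Qed.

Lemma continuous_bigsum (T : topologicalType) (I : finType) (f : I -> T -> R) :
  (forall i, continuous (f i)) -> continuous (fun x => \sum_i f i x).
Proof.
move=> cf x; elim: (index_enum _) => [|a s IH].
  rewrite (_ : (fun z => _) = fun=> 0); first exact: cst_continuous.
  by apply/funext => z; rewrite big_nil.
rewrite (_ : (fun z => _) = fun z => f a z + \sum_(b <- s) f b z).
  by apply: continuousD => //; exact: cf.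
by apply/funext => z; rewrite big_cons.
Qed.

(** Positivity of a form is an open condition on the vector, and rational vectors are dense. *)
Lemma rat_qf_gt0 n (E : 'M[R]_n) (v : 'cV[R]_n) : 0 < qf E v ->
  exists q : 'I_n -> rat, 0 < \sum_a \sum_b ratr (q a) * E a b * ratr (q b).
Proof.
move=> hv.
have cq : continuous (fun w : 'cV[R]_n => \sum_a \sum_b w a 0 * E a b * w b 0).
  apply: continuous_bigsum => a; apply: continuous_bigsum => b.
  apply: continuous_mul; last exact: coord_continuous.
  by apply: continuous_mul; [exact: coord_continuous|exact: cst_continuous].
have hv' : 0 < \sum_a \sum_b v a 0 * E a b * v b 0 by rewrite -bilE.
have /nbhs_ballP[eps /= eps0 hb] := continuous_near_gt0 cq hv'.
have /choice[q hq] : forall a, exists q : rat, `|ratr q - v a 0| < eps.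
  by move=> a; exact: rat_approx.
exists q; have := hb (\col_a ratr (q a)); rewrite /=.
under eq_bigr do under eq_bigr do rewrite !mxE.
apply; split=> // a j; rewrite ord1 /ball /= mxE distrC; exact: hq.
Qed.

End Approximation.

Lemma fin_common_le (R : realType) (I : finType) (b : I -> R) :
  (forall i, 0 < b i) -> exists2 d, 0 < d & forall i, d <= b i.
Proof.
move=> b0; apply: (@fin_common_pos R I (fun i d => d <= b i)) => [i d d' _|i].
  exact: le_trans.
by exists (b i).
Qed.

Lemma compact_norm_bound (R : realType) (U V : normedModType R) (K : set U) (f : U -> V) :
  compact K -> {within K, continuous f} -> exists G, forall x, K x -> `|f x| <= G.
Proof.
move=> cK cf; have /compact_bounded[M [_ hM]] := continuous_compact cf cK.
exists (M + 1) => x Kx; apply: (hM (M + 1)); first by rewrite ltrDl.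
by exists x.
Qed.

Lemma le_mul_small (R : realFieldType) (c e x : R) : 0 <= c -> 0 <= x ->
  x <= e / (c + 1) -> c * x <= e.
Proof.
move=> c0 x0; rewrite ler_pdivlMr; last by lra.
by rewrite mulrDr mulr1 mulrC => h; lra.
Qed.

Lemma quarters (R : realFieldType) (x : R) : 2 * (x / 4) + x / 2 = x.
Proof. by field. Qed.

Lemma twice_lt_third (R : realFieldType) (h d : R) : 0 < d -> h <= d / 3 -> 2 * h < d.
Proof. by move=> *; lra. Qed.

Lemma close_natr (R : realFieldType) (a b : nat) : (a <= b + 2)%N -> (b <= a + 2)%N ->
  `|a%:R - b%:R| <= 2 :> R.
Proof.
rewrite -!(ler_nat R) !natrD => h1 h2.
by rewrite ler_norml; apply/andP; split; lra.
Qed.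

Lemma ext_bounds (R : realFieldType) (a b c x : R) :
  a <= x + c -> x <= 1 + b + c -> - c <= x - a /\ x - 1 - b <= c.
Proof. by move=> *; split; lra. Qed.

Lemma oscillation_bound (R : realFieldType) (s s' x x' er e : R) :
  `|s - x| <= er -> `|s' - x'| <= er -> `|x - x'| <= er / 2 -> 3 * er <= e -> `|s - s'| <= e.
Proof.
rewrite !ler_norml => /andP[? ?] /andP[? ?] /andP[? ?] ?.
by apply/andP; split; lra.
Qed.

Lemma initial_bound (R : realFieldType) (w x p c d e : R) :
  `|w - x| < e / 8 -> `|x - p| <= e / 8 -> `|c - p| <= d -> d <= e / 8 -> 0 < e -> `|w - c| <= e.
Proof.
rewrite ltr_norml !ler_norml => /andP[? ?] /andP[? ?] /andP[? ?] ? ?.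
by apply/andP; split; lra.
Qed.

(** Residuals accumulate linearly in time and [L%:R * mesh N] bounds the height of the domain, so
    the second inequality bounds the total effect of [e] by [e0]. *)
Definition certified m n (N L : nat) (al be : 'I_m -> rat) (rho e dj : rat)
    (Aq : 'I_n -> 'I_n -> rat) (Bq : 'I_m -> 'I_n -> 'I_n -> rat)
    (W : ('I_(m + 1) -> nat) -> 'I_n -> rat) (v v' : 'I_m -> 'I_n -> rat)
    (N' : nat) (G : ('I_m -> nat) -> 'I_n -> rat) (e0 : rat) : Prop :=
  [/\ [/\ 0 < e, e * (1 + L%:R * mesh N) <= e0, dj <= e0, (N' <= N)%N
        & geometry N L al be rho],
      rayleigh al be dj Aq Bq v v',
      forall y, in_grid N L y -> small_residual N L al be rho e dj Aq Bq W y,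
      forall y y', in_grid N L y -> in_grid N L y' -> small_oscillation N L al be rho e W y y'
    & forall c y : 'I_m -> nat, (forall i, c i < 2 ^ N')%N -> (forall i, y i <= 2 ^ N)%N ->
        small_initial N W N' G e0 c y].

Section Completeness.
Context {R : realType} {m n : nat} (A : 'M[R]_n) (B : 'I_m -> 'M[R]_n) (Lam C : R).
Let lM i := lambda_max A (B i).
Let lm i := lambda_min A (B i).
Let H := correctness_domain A B.
Hypothesis m_gt0 : (0 < m)%N.
Hypothesis n_gt0 : (0 < n)%N.
Hypothesis pA : posdef_mx A.
Hypothesis symB : forall i, (B i)^T = B i.
Hypothesis lM0 : forall i, 0 < lM i.
Hypothesis lm0 : forall i, lm i < 0.
Hypothesis LamM : forall l, lM l <= Lam.
Hypothesis Lamm : forall l, - lm l <= Lam.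
Hypothesis Lam0 : 0 < Lam.
Hypothesis C0 : 0 <= C.
Hypothesis AC : forall a b, `|A a b| <= C.
Hypothesis BC : forall i a b, `|B i a b| <= C.

Local Notation r := (@ratr R).

(** The bounds are taken within [d2] of the eigenvalues. As [d2] is at most d / 2, the width
    [al - be] stays above [d], so the height [T0] is known before the bounds; as [T0%:R * d2] is at
    most kap / 4, tilting the planes costs at most kap / 4 up to that height, and [rho] costs as
    much again. *)
Lemma bounds_choice d (T0 : nat) kap : (forall i, 2 * d <= lM i - lm i) -> 0 < d ->
  1 <= T0%:R * d -> 0 < kap ->
  exists al be (rho : rat), [/\ 0 < rho,
    forall i : 'I_m, [/\ 0 <= r (al i), r (al i) < lM i, lm i < r (be i) & r (be i) <= 0],
    forall i, 1 <= T0%:R * (r (al i) - r (be i))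
  & forall i (x t : R), 0 <= t -> t <= T0%:R ->
    (r (al i) * t <= x + r rho -> lM i * t <= x + kap / 2) /\
    (x <= 1 + r (be i) * t + r rho -> x <= 1 + lm i * t + kap / 2)].
Proof.
move=> dw d0 T0d kap0; pose d2 := Num.min (d / 2) (kap / 4 / (T0%:R + 1)).
have T01 : 0 < T0%:R + 1 :> R by rewrite ltr_wpDl.
have d20 : 0 < d2 by rewrite lt_min !divr_gt0.
have d2d : d2 <= d / 2 by rewrite ge_min lexx.
have d2k : T0%:R * d2 <= kap / 4.
  by apply: le_mul_small; rewrite ?ler0n ?(ltW d20) // ge_min lexx orbT.
have /choice[al hal] : forall i, exists q : rat, Num.max 0 (lM i - d2) < r q < lM i.
  move=> i; apply: rat_between; rewrite gt_max lM0 /=; lra.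
have /choice[be hbe] : forall i, exists q : rat, lm i < r q < Num.min 0 (lm i + d2).
  move=> i; apply: rat_between; rewrite lt_min lm0 /=; lra.
have [rho] : exists q : rat, 0 < r q < kap / 4 by apply: rat_between; rewrite divr_gt0.
case/andP => rho0 rhok; exists al, be, rho.
have al_ i : [/\ 0 <= r (al i), r (al i) < lM i & lM i - d2 <= r (al i)].
  by have := hal i; rewrite gt_max => /andP[/andP[/ltW a /ltW b] c].
have be_ i : [/\ r (be i) <= 0, lm i < r (be i) & r (be i) <= lm i + d2].
  by have := hbe i; rewrite lt_min => /andP[a /andP[/ltW b /ltW c]].
split.
- by move: rho0; rewrite ltr0q.
- by move=> i; have [? ? _] := al_ i; have [? ? _] := be_ i.
- move=> i; have [_ _ a] := al_ i; have [_ _ b] := be_ i; have w := dw i.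
  by apply: (le_trans T0d); rewrite ler_wpM2l //; lra.
move=> i x t t0 tT; have td : t * d2 <= kap / 4.
  by apply: le_trans d2k; rewrite ler_wpM2r // ltW.
have [_ _ a] := al_ i; have [_ _ b] := be_ i.
have := ler_wpM2r t0 a; have := ler_wpM2r t0 b.
rewrite mulrBl mulrDl (mulrC d2) => h1 h2.
by split=> h3; lra.
Qed.

Lemma half_width : exists2 d, 0 < d & forall i, 2 * d <= lM i - lm i.
Proof.
have w0 i : 0 < (lM i - lm i) / 2 by have := lM0 i; have := lm0 i; lra.
by have [d d0 hd] := fin_common_le w0; exists d => // i; have := hd i; lra.
Qed.

(** The vectors are fixed before the precision of the matrices: they have a positive margin for the
    exact matrices, which any sufficiently good approximation inherits. *)
Lemma rayleigh_vectors (al be : 'I_m -> rat) :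
  (forall i, r (al i) < lM i) -> (forall i, lm i < r (be i)) ->
  exists v v' : 'I_m -> 'I_n -> rat, exists2 d, 0 < d & forall dj Aq Bq,
    0 <= dj <= d -> (forall a b, `|Aq a b - A a b| <= dj) ->
    (forall i a b, `|Bq i a b - B i a b| <= dj) ->
    rayleigh (fun i => r (al i)) (fun i => r (be i)) dj Aq Bq
      (fun i a => r (v i a)) (fun i a => r (v' i a)).
Proof.
move=> hal hbe.
have quad (c c' : R) i (v : 'cV[R]_n) : c * qf (B i) v + c' * qf A v =
    qf (\matrix_(a, b) (c * B i a b + c' * A a b)) v.
  rewrite /qf !bilE !mulr_sumr -big_split; apply: eq_bigr => a _ /=.
  rewrite !mulr_sumr -big_split; apply: eq_bigr => b _ /=.
  by rewrite mxE; ring.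
have /choice[v hv] i : exists q : 'I_n -> rat,
    0 < \sum_a \sum_b r (q a) * (B i a b - r (al i) * A a b) * r (q b).
  have [w hw] := (lambda_max_gt (r (al i)) n_gt0 pA (symB i)).2 (hal i).
  have : 0 < qf (\matrix_(a, b) (1 * B i a b + (- r (al i)) * A a b)) w.
    by rewrite -quad; lra.
  case/rat_qf_gt0 => q hq; exists q; apply: (lt_le_trans hq).
  rewrite le_eqVlt; apply/orP; left; apply/eqP.
  by apply: eq_bigr => a _; apply: eq_bigr => b _; rewrite mxE; ring.
have /choice[v' hv'] i : exists q : 'I_n -> rat,
    0 < \sum_a \sum_b r (q a) * (r (be i) * A a b - B i a b) * r (q b).
  have [w hw] := (lambda_min_lt (r (be i)) n_gt0 pA (symB i)).2 (hbe i).
  have : 0 < qf (\matrix_(a, b) ((-1) * B i a b + r (be i) * A a b)) w.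
    by rewrite -quad; lra.
  case/rat_qf_gt0 => q hq; exists q; apply: (lt_le_trans hq).
  rewrite le_eqVlt; apply/orP; left; apply/eqP.
  by apply: eq_bigr => a _; apply: eq_bigr => b _; rewrite mxE; ring.
exists v, v'.
pose X i := \sum_a \sum_b r (v i a) * (B i a b - r (al i) * A a b) * r (v i b).
pose X' i := \sum_a \sum_b r (v' i a) * (r (be i) * A a b - B i a b) * r (v' i b).
pose c i := (1 + `|r (al i)|) * (\sum_a `|r (v i a)|) ^+ 2.
pose c' i := (1 + `|r (be i)|) * (\sum_a `|r (v' i a)|) ^+ 2.
have c0 i : 0 <= c i by rewrite mulr_ge0 ?addr_ge0 // sqr_ge0.
have c'0 i : 0 <= c' i by rewrite mulr_ge0 ?addr_ge0 // sqr_ge0.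
have pos i : 0 < Num.min (X i / 2 / (2 * c i + 1)) (X' i / 2 / (2 * c' i + 1)).
  have := c0 i; have := c'0 i => h h'.
  by rewrite lt_min !divr_gt0 ?hv ?hv' //; lra.
have [d d0 hd] := fin_common_le pos.
exists d => // dj Aq Bq /andP[dj0 djd] hA hB.
have err (sg cc : R) i (w : 'I_n -> rat) (Y Yq : R) : `|sg| = 1 ->
    Y = \sum_a \sum_b r (w a) * (sg * (B i a b - cc * A a b)) * r (w b) ->
    Yq = \sum_a \sum_b r (w a) * (sg * (Bq i a b - cc * Aq a b)) * r (w b) ->
    Y <= Yq + dj * ((1 + `|cc|) * (\sum_a `|r (w a)|) ^+ 2).
  move=> sg1 -> ->; rewrite mulrA.
  pose E : 'M[R]_n := \matrix_(a, b) (sg * ((B i a b - Bq i a b) - cc * (A a b - Aq a b))).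
  have Ec a b : `|E a b| <= dj * (1 + `|cc|).
    rewrite mxE normrM sg1 mul1r (_ : dj * _ = dj + `|cc| * dj); last by ring.
    apply: (le_trans (ler_normB _ _)).
    by rewrite normrM distrC (distrC (A a b)); apply: lerD => //; rewrite ler_wpM2l.
  have := @abs_qf_le _ _ E (\col_a r (w a)) _ Ec.
  have -> : \sum_a `|(\col_a0 r (w a0)) a 0| = \sum_a `|r (w a)|.
    by apply: eq_bigr => a _; rewrite mxE.
  have -> : qf E (\col_a r (w a)) =
     \sum_a \sum_b r (w a) * (sg * (B i a b - cc * A a b)) * r (w b) -
     \sum_a \sum_b r (w a) * (sg * (Bq i a b - cc * Aq a b)) * r (w b).
    rewrite /qf bilE -sumrB; apply: eq_bigr => a _ /=.
    by rewrite -sumrB; apply: eq_bigr => b _ /=; rewrite !mxE; ring.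
  by rewrite ler_norml => /andP[_]; lra.
(* The factor two: [dj * x] is lost in passing to the approximate matrices, and what is left must
   still exceed [dj * x]. *)
have small (x Y : R) : 0 <= x -> 0 < Y -> dj <= Y / 2 / (2 * x + 1) -> 2 * (dj * x) < Y.
  move=> x0 Y0 h; have : 2 * x * dj <= Y / 2 by apply: le_mul_small; rewrite ?mulr_ge0.
  by lra.
apply/forallP => i; have := hd i; rewrite le_min => /andP[h1 h2].
have s1 := small _ _ (c0 i) (hv i) (le_trans djd h1).
have s2 := small _ _ (c'0 i) (hv' i) (le_trans djd h2).
apply/andP; split.
  have := err 1 (r (al i)) i (v i) (X i) _ (normr1 _).
  move=> /(_ _ _ erefl)/wrap[|].
    by apply: eq_bigr => a _; apply: eq_bigr => b _; rewrite mul1r.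
  under [in X in _ <= X]eq_bigr do under eq_bigr do rewrite mul1r.
  rewrite -/(c i) -mulrA -/(c i) => h; rewrite /X in h; lra.
have := err (-1) (r (be i)) i (v' i) (X' i) _ (normrN1 _).
move=> /(_ _ _ erefl)/wrap[|].
  by apply: eq_bigr => a _; apply: eq_bigr => b _; rewrite mulN1r opprB.
under [in X in _ <= X]eq_bigr do under eq_bigr do rewrite mulN1r opprB.
rewrite -/(c' i) -mulrA -/(c' i) => h; rewrite /X' in h; lra.
Qed.

Variables (u : 'rV[R]_(m + 1) -> 'cV[R]_n) (g : 'I_(m + 1) -> 'rV[R]_(m + 1) -> 'cV[R]_n).
Hypothesis gu : forall k, is_partial H k u (g k).
Hypothesis pde : forall y, H y -> A *m g (time m) y + \sum_i B i *m g (space i) y = 0.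

Definition node_row N (y : 'I_(m + 1) -> nat) : 'rV[R]_(m + 1) := \row_k node N y k.

Lemma node_row_next N y k :
  node_row N (next_node k y) = node_row N y + mesh N *: delta_mx 0 k.
Proof.
apply/rowP => l; rewrite shift_coord !mxE /node /next_node natrD mulrDl.
by case: (l == k); rewrite ?mul1r ?mulr1 // mul0r mulr0.
Qed.

Section Slope.
Variables (th rho' : R) (N : nat) (W : ('I_(m + 1) -> nat) -> 'I_n -> R) (eta e1 : R).
Hypothesis th01 : 0 <= th < 1.
Hypothesis rho01 : 0 <= rho' < (1 - th) / 4.
Hypothesis hW : forall y a, `|W y a - u (dilate Lam th (node_row N y)) a 0| <= eta * mesh N.

(** The values are rounded with a tolerance proportional to the mesh, by which a slope divides;
    rounding at two nodes costs 2 eta and the mean value theorem costs [e1]. *)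
Lemma slope_error k y :
  (forall z z', H z -> H z' -> `|z - z'| <= mesh N -> `|g k z - g k z'| <= e1) ->
  ext_domain A B rho' (node_row N y) -> ext_domain A B rho' (node_row N (next_node k y)) ->
  forall a, `|slope N W y k a - th * g k (dilate Lam th (node_row N y)) a 0| <= 2 * eta + e1.
Proof.
move=> hg ey ey' a; set G := g k _.
have h0 : 0 < mesh N :> R by rewrite invr_gt0 exprn_gt0.
have hN : mesh N * 2 ^+ N = 1 :> R by rewrite mulVf // expf_neq0.
have := dilate_mean_value LamM Lamm Lam0 (gu k) th01 rho01 ey.
move=> /(_ (mesh N) G e1); rewrite -node_row_next => /(_ ey' _)/wrap[|mv].
  move=> b /andP[b0 b1]; apply: hg.
  - apply: interior_subset; apply: (dilate_interior LamM Lamm Lam0 th01 rho01).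
    apply: ext_domain_segment => //; first by rewrite b0.
    by rewrite -node_row_next.
  - by apply: interior_subset; exact: (dilate_interior LamM Lamm Lam0 th01 rho01).
  rewrite dilate_dist addrC addKr; apply: mx_norm_le => [|i l]; first exact: ltW.
  rewrite !mxE !normrM; case/andP: th01 => t0 t1; rewrite (ger0_norm t0) (ger0_norm b0) (gtr0_norm h0).
  have d1 : `|((i == 0) && (l == k))%:R| <= 1 :> R by case: (_ && _); rewrite ?normr1 ?normr0.
  have bh0 : 0 <= b * mesh N by rewrite mulr_ge0 // ltW.
  apply: (@le_trans _ _ (b * mesh N * `|((i == 0) && (l == k))%:R|)).
    by rewrite ler_piMl ?mulr_ge0 // ltW.
  by apply: (le_trans (ler_piMr bh0 d1)); rewrite ler_piMl // ltW.
have := le_trans (le_coord_norm _ a 0) mv; rewrite !mxE (gtr0_norm h0) => mv'.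
have := hW (next_node k y) a; have := hW y a.
set U := u _ a 0 in mv' *; set U' := u _ a 0 in mv' *; move=> w w'.
rewrite -(ler_pM2l h0) -[X in X * `|_|](gtr0_norm h0) -normrM.
have -> : mesh N * (slope N W y k a - th * G a 0) =
   (W (next_node k y) a - U') - (W y a - U) + (U' - U - mesh N * (th * G a 0)).
  by rewrite mulrBr /slope mulrCA hN; ring.
apply: (le_trans (ler_normD _ _)); have := ler_normB (W (next_node k y) a - U') (W y a - U).
by move=> nb; lra.
Qed.

End Slope.

Lemma gradient_bound : exists2 G, 0 <= G & forall k y, H y -> `|g k y| <= G.
Proof.
have cH : compact H := domain_compact lM0 lm0 m_gt0.
have /choice[G hG] : forall k, exists G, forall y, H y -> `|g k y| <= G.
  by move=> k; apply: compact_norm_bound cH _; case: (gu k).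
exists (\sum_k `|G k|); first exact: sumr_ge0.
move=> k y Hy; apply: (le_trans (hG k y Hy)); apply: (le_trans (ler_norm _)).
by rewrite (bigD1 k) //= lerDl sumr_ge0.
Qed.

Lemma gradient_modulus eps : 0 < eps -> exists2 del, 0 < del &
  forall k y y', H y -> H y' -> `|y - y'| < del -> `|g k y - g k y'| <= eps.
Proof.
move=> eps0; have cH : compact H := domain_compact lM0 lm0 m_gt0.
apply: (@fin_common_pos R 'I_(m + 1) (fun k d => forall y y', H y -> H y' ->
    `|y - y'| < d -> `|g k y - g k y'| <= eps)) => [k d d' _ dd h y y' Hy Hy' hd|k].
  by apply: h => //; exact: lt_le_trans hd dd.
have [cg _] := gu k; have [d d0 hd] := compact_modulus cH cg eps0.
by exists d => // y y' Hy Hy' /(hd _ _ Hy Hy')/ltW.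
Qed.

Lemma perturbed_sum (M M' s s' : 'I_n -> R) dj S er : 0 <= dj -> 
  (forall b, `|M' b - M b| <= dj) -> (forall b, `|s b| <= S) ->
  (forall b, `|M b| <= C) -> (forall b, `|s b - s' b| <= er) ->
  `|\sum_b M' b * s b - \sum_b M b * s' b| <= n%:R * (dj * S + C * er).
Proof.
move=> dj0 hM hs hC he; rewrite -sumrB; apply: (le_trans (ler_norm_sum _ _ _)).
rewrite -[n in n%:R]card_ord mulr_natl -sumr_const; apply: ler_sum => b _.
rewrite (_ : _ - _ = (M' b - M b) * s b + M b * (s b - s' b)); last by ring.
apply: (le_trans (ler_normD _ _)); rewrite !normrM.
by apply: lerD; apply: ler_pM.
Qed.

(** The gradient of the solution multiplied by [th] satisfies the equation exactly; subtracting that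
    equation leaves only the perturbations of matrices and slopes. *)
Lemma small_slopes_residual (Aq : 'I_n -> 'I_n -> R) Bq (sl : 'I_(m + 1) -> 'I_n -> R)
    th y dj S er a : H y -> 0 <= dj ->
  (forall a b, `|Aq a b - A a b| <= dj) -> (forall i a b, `|Bq i a b - B i a b| <= dj) ->
  (forall k b, `|sl k b| <= S) -> (forall k b, `|sl k b - th * g k y b 0| <= er) ->
  `|\sum_b Aq a b * sl (time m) b + \sum_i \sum_b Bq i a b * sl (space i) b| <=
    ((m + 1) * n)%:R * (dj * S + C * er).
Proof.
move=> Hy dj0 hA hB hS her.
have /matrixP/(_ a 0) := pde Hy; rewrite !mxE summxE => p0.
have E0 : \sum_b A a b * (th * g (time m) y b 0) +
    \sum_i \sum_b B i a b * (th * g (space i) y b 0) = 0.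
  transitivity (th * 0); last by rewrite mulr0.
  rewrite -[in RHS]p0 mulrDr !mulr_sumr; congr (_ + _).
    by apply: eq_bigr => b _; rewrite mulrCA.
  apply: eq_bigr => i _; rewrite mxE mulr_sumr; by apply: eq_bigr => b _; rewrite mulrCA.
have sub0 x : x = x - (\sum_b A a b * (th * g (time m) y b 0) +
    \sum_i \sum_b B i a b * (th * g (space i) y b 0)) by rewrite E0 subr0.
rewrite [X in `|X|]sub0.
rewrite opprD addrACA.
apply: (le_trans (ler_normD _ _)).
rewrite natrM natrD -mulrA mulrDl mul1r [leRHS]addrC; apply: lerD; last first.
  rewrite -sumrB; apply: (le_trans (ler_norm_sum _ _ _)).
  rewrite -[m in m%:R]card_ord mulr_natl -sumr_const; apply: ler_sum => i _.
  exact: perturbed_sum.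
exact: perturbed_sum.
Qed.

Section Search.
Variables (phi : 'rV[R]_m -> 'cV[R]_n) (Aq : nat -> 'I_n -> 'I_n -> rat).
Variables (Bq : nat -> 'I_m -> 'I_n -> 'I_n -> rat) (N' : nat -> nat).
Variables (G : nat -> ('I_m -> nat) -> 'I_n -> rat) (pj : nat -> 'rV[R]_m -> 'cV[R]_n).
Hypothesis uc : {within H, continuous u}.
Hypothesis uphi : forall x, unit_cube x -> u (st_point x 0) = phi x.
Hypothesis hA : forall j a b, `|r (Aq j a b) - A a b| <= 2 ^- j.
Hypothesis hB : forall j i a b, `|r (Bq j i a b) - B i a b| <= 2 ^- j.
Hypothesis hp : forall j, multilinear_interpolation (fun=> 2 ^- N' j) (fun=> (2 ^ N' j)%N)
  (fun y => \col_a r (G j y a)) (pj j).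
Hypothesis hphi : forall j x, unit_cube x -> `|pj j x - phi x| <= 2 ^- j.

(** The order of the choices matters: the height [T0] determines [e]; the dilation determines how
    close the eigenvalue bounds must be; these bounds determine the Rayleigh vectors and with them
    the index [j] of the data; only then is the grid level [N] taken, above the level of the j-th
    initial function; the rounding of the values comes last. *)
Lemma certificate_exists (e0 : rat) : 0 < e0 ->
  exists j N L al be rho e v v' W,
    certified N L al be rho e (2 ^- j) (Aq j) (Bq j) W v v' (N' j) (G j) e0.
Proof.
move=> e00; have re0 : 0 < r e0 by rewrite ltr0q.
have [d d0 hd] := half_width.
pose T0 := (Num.truncn d^-1).+1.
have T0d : 1 <= T0%:R * d.
  by rewrite -ler_pdivrMr // mul1r ltW // truncnS_gt.
(* The grid will have height [T0] exactly, so that e (1 + T0) = e0. *)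
pose e := e0 / (1 + T0%:R).
have e_gt0 : 0 < e by rewrite divr_gt0 // ltr_pwDl.
have re : 0 < r e by rewrite ltr0q.
have re2 : 0 < r e / 2 by rewrite divr_gt0.
have re3 : 0 < r e / 3 by rewrite divr_gt0.
have re8 : 0 < r e0 / 8 by rewrite divr_gt0.
have [th th01 hth] := dilate_close m_gt0 lM0 lm0 LamM Lamm Lam0 uc re8.
have kap0 : 0 < (1 - th) / 4 by case/andP: th01 => *; lra.
(* For kap = (1 - th) / 4, [bounds_choice] puts the inspected nodes into the domain widened by kap /
   2, strictly within what the dilation absorbs. *)
pose rho' := (1 - th) / 4 / 2.
have rho'01 : 0 <= rho' < (1 - th) / 4 by rewrite /rho'; apply/andP; split; lra.
have [al [be [rho [rho0 ab hT hnear]]]] := bounds_choice hd d0 T0d kap0.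
have ab1 i : r (al i) < lM i by have [] := ab i.
have ab2 i : lm i < r (be i) by have [] := ab i.
have [v [v' [dr dr0 hray]]] := rayleigh_vectors ab1 ab2.
have [Gb Gb0 hGb] := gradient_bound.
pose S := Gb + 1; have S0 : 0 < S by rewrite ltr_wpDl.
pose nn : R := ((m + 1) * n)%:R.
have nn0 : 0 <= nn by exact: ler0n.
(* Accuracy of the slopes: 1 keeps them below [S], the third of [e] covers two slopes and the change
   of the gradient between them, and the last term leaves half of [e] to the errors of the
   matrices. *)
pose er := Num.min 1 (Num.min (r e / 3) (r e / 2 / (nn * C + 1))).
have er0 : 0 < er.
  have nC : 0 < nn * C + 1 by rewrite ltr_wpDl // mulr_ge0.
  by rewrite /er !lt_min ltr01 re3 (divr_gt0 re2 nC).
have er1 : er <= 1 by rewrite ge_min lexx.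
have er3 : 3 * er <= r e.
  have h : er <= r e / 3 by rewrite ge_min ge_min lexx orbT.
  by rewrite mulrC -ler_pdivlMr.
have erC : nn * C * er <= r e / 2.
  by apply: le_mul_small; rewrite ?mulr_ge0 ?(ltW er0) // ge_min ge_min lexx !orbT.
have er20 : 0 < er / 2 by rewrite divr_gt0.
have [del del0 hdel] := gradient_modulus er20.
have dj0 : 0 < Num.min (Num.min dr (r e0 / 8)) (Num.min (r e / (S + 1)) (r e / 2 / (nn * S + 1))).
  have nS : 0 < nn * S + 1 by rewrite ltr_wpDl // mulr_ge0 // ltW.
  have S1 : 0 < S + 1 by rewrite addr_gt0.
  by rewrite !lt_min dr0 re8 (divr_gt0 re S1) (divr_gt0 re2 nS).
have [j /(_ _ (leqnn j))] := exp2V_small dj0.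
rewrite !le_min => /andP[/andP[j1 j2] /andP[j3 j4]].
have j5 : S * 2 ^- j <= r e by apply: le_mul_small => //; rewrite ltW // ?invr_gt0 ?exprn_gt0.
have j6 : nn * S * 2 ^- j <= r e / 2.
  by apply: le_mul_small => //; rewrite ?mulr_ge0 // ltW // ?invr_gt0 ?exprn_gt0.
have ra i : 0 < Num.min (r rho / (1 + r (al i))) (r rho / (1 - r (be i))).
  have [a1 _ _ b1] := ab i; have a2 : 0 < 1 + r (al i) by rewrite ltr_pwDl.
  have b2 : 0 < 1 - r (be i) by rewrite subr_gt0 (le_lt_trans b1).
  have rr0 : 0 < r rho by rewrite ltr0q.
  by rewrite lt_min (divr_gt0 rr0 a2) (divr_gt0 rr0 b2).
have [hm hm0 hmr] := fin_common_le ra.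
(* Nodes at index distance two must be closer than [del]; the bound [hm] gives the mesh conditions
   of [geometry]. *)
have hh0 : 0 < Num.min hm (del / 3) by rewrite lt_min hm0 divr_gt0.
have [N1 hN1] := exp2V_small hh0.
pose N := maxn (N' j) N1; have := hN1 N (leq_maxr _ _).
rewrite -/(mesh N) le_min => /andP[h1 h2].
have h0 : 0 < mesh N :> R by rewrite invr_gt0 exprn_gt0.
pose L := (T0 * 2 ^ N)%N.
have Lh (F : realFieldType) : L%:R * mesh N = T0%:R :> F.
  by rewrite /L natrM natrX /mesh -mulrA divff ?mulr1 // expf_neq0.
pose U y := u (dilate Lam th (node_row N y)).
(* Rounding by a quarter of [er] at both ends of an edge, and half of [er] for the mean value
   theorem, make up [er]. *)
have tol0 : 0 < Num.min (er / 4 * mesh N) (r e0 / 8).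
  by rewrite lt_min re8 andbT mulr_gt0 // divr_gt0.
have /choice[W hW] y : exists w : 'I_n -> rat, forall a,
    `|r (w a) - U y a 0| < Num.min (er / 4 * mesh N) (r e0 / 8).
  have /choice[w hw] a : exists q : rat, `|r q - U y a 0| < Num.min (er / 4 * mesh N) (r e0 / 8).
    exact: rat_approx.
  by exists w.
exists j, N, L, al, be, rho, e, v, v', W.
have geo : geometry N L (fun i => r (al i)) (fun i => r (be i)) (r rho).
  apply/forallP => i; have [a1 _ _ b1] := ab i; rewrite Lh hT a1 b1 andbT /=.
  have := hmr i; rewrite le_min => /andP[r1 r2].
  have a2 : 0 < 1 + r (al i) by rewrite ltr_pwDl.
  have b2 : 0 < 1 - r (be i) by rewrite subr_gt0 (le_lt_trans b1).
  by rewrite -!ler_pdivlMr // (le_trans h1 r1) (le_trans h1 r2).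
have rj : r (2 ^- j) = 2 ^- j by rewrite fmorphV rmorphXn /= ratr_nat.
have near_ext y : in_grid N L y -> near_node N (fun i => r (al i)) (fun i => r (be i)) (r rho) y ->
    ext_domain A B rho' (node_row N y).
  move=> /forallP gy /forallP ny; have t0 : 0 <= node N y (time m) :> R.
    by rewrite mulr_ge0 // ltW.
  have tT : node N y (time m) <= T0%:R :> R.
    rewrite -Lh ler_pM2r // ler_nat; have := gy (time m).
    by rewrite /grid_size /= addn0 ltnn.
  split; first by rewrite mxE.
  move=> i; rewrite !mxE; have /andP[n1 n2] := ny i.
  have [f1 _] := hnear i (node N y (space i)) _ t0 tT.
  have [_ f2] := hnear i (node N y (space i)) _ t0 tT.
  have := f1 n1; have := f2 n2; rewrite -/(lM i) -/(lm i) => g1 g2.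
  exact: ext_bounds.
have edge_ext y k : edge N L (fun i => r (al i)) (fun i => r (be i)) (r rho) y k ->
    ext_domain A B rho' (node_row N y) /\ ext_domain A B rho' (node_row N (next_node k y)).
  case/and4P => gy yk n1 n2; split; first exact: near_ext.
  apply: near_ext n2; apply/forallP => l; rewrite /next_node.
  by case: eqP => [->|_]; rewrite ?addn1 ?addn0 //; move/forallP: gy.
have sl y k a : edge N L (fun i => r (al i)) (fun i => r (be i)) (r rho) y k ->
    `|slope N (fun y a => r (W y a)) y k a - th * g k (dilate Lam th (node_row N y)) a 0| <= er.
  move=> /edge_ext[x1 x2].
  have hW1 z b : `|r (W z b) - U z b 0| <= er / 4 * mesh N.
    by have := hW z b; rewrite lt_min => /andP[/ltW].
  have ee : 2 * (er / 4) + er / 2 <= er by rewrite quarters.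
  apply: le_trans (slope_error th01 rho'01 hW1 _ x1 x2 a) ee.
  move=> z z' Hz Hz' zz; apply: hdel => //; apply: (le_lt_trans zz); apply: (le_lt_trans h2).
  by rewrite ltr_pdivrMr // ltr_pMr // ltr1n.
have in_H y k : edge N L (fun i => r (al i)) (fun i => r (be i)) (r rho) y k ->
    H (dilate Lam th (node_row N y)).
  move=> /edge_ext[x1 _]; apply: interior_subset.
  exact: (dilate_interior LamM Lamm Lam0 th01 rho'01).
have slS y k a : edge N L (fun i => r (al i)) (fun i => r (be i)) (r rho) y k ->
    `|slope N (fun y a => r (W y a)) y k a| <= S.
  move=> ey; have s1 := sl y k a ey; have Hy := in_H _ _ ey.
  have g1 := le_trans (le_coord_norm _ a 0) (hGb k _ Hy).
  rewrite -[slope _ _ _ _ _](subrK (th * g k (dilate Lam th (node_row N y)) a 0)).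
  apply: (le_trans (ler_normD _ _)); rewrite /S addrC; apply: lerD; last exact: le_trans s1 er1.
  rewrite normrM; case/andP: th01 => t0 t1; rewrite (ger0_norm t0).
  by apply: le_trans g1; rewrite ler_piMl // ltW.
split.
- split=> //.
  + by rewrite Lh /e divfK // gt_eqF // ltr_pwDl.
  + by rewrite -(ler_rat R) rj (le_trans j2) // ler_pdivrMr // ler_peMr ?ler1n // ltW.
  + exact: leq_maxl.
  + by rewrite -(ratr_geometry (R := R)).
- rewrite -(ratr_rayleigh (R := R)) rj; apply: hray => //.
  by rewrite j1 invr_ge0 exprn_ge0.
- move=> y _; rewrite -(ratr_small_residual (R := R)) rj; apply/implyP => /forallP ey.
  apply/forallP => a; apply/andP; split.
    have dj_ge0 : 0 <= 2 ^- j :> R by rewrite invr_ge0 exprn_ge0.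
    have slS' k b : `|slope N (fun y a => r (W y a)) y k b| <= S by exact: slS.
    have sl' k b : `|slope N (fun y a => r (W y a)) y k b -
        th * g k (dilate Lam th (node_row N y)) b 0| <= er by exact: sl.
    apply: (le_trans (small_slopes_residual a (in_H _ _ (ey (time m))) dj_ge0 (hA j) (hB j) slS' sl')).
    rewrite -/nn mulrDr (_ : nn * (2 ^- j * S) = nn * S * 2 ^- j); last by ring.
    by rewrite mulrA [leRHS]splitr lerD.
  apply/forallP => k; apply: le_trans j5; rewrite mulrC ler_wpM2r ?invr_ge0 ?exprn_ge0 //.
  exact: slS.
- move=> y y' _ _; rewrite -(ratr_small_oscillation (R := R)); apply/forallP => k.
  apply/implyP => /and3P[ey ey' /forallP hl]; apply/forallP => a.
  have s1 := sl y k a ey; have s2 := sl y' k a ey'.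
  have Hy := in_H _ _ ey; have Hy' := in_H _ _ ey'; case/andP: th01 => t0 t1.
  have gg : `|g k (dilate Lam th (node_row N y)) - g k (dilate Lam th (node_row N y'))| <= er / 2.
    apply: hdel => //; apply: (@le_lt_trans _ _ (2 * mesh N)); last exact: twice_lt_third.
    rewrite dilate_dist; apply: mx_norm_le => [|i l]; first by rewrite mulr_ge0 // ltW.
    rewrite !mxE normrM (ger0_norm t0) -mulrBl normrM (gtr0_norm h0).
    have /andP[c1 c2] := hl l.
    have : `|(y l)%:R - (y' l)%:R| <= 2 :> R.
      exact: close_natr.
    have P0 : 0 <= `|(y l)%:R - (y' l)%:R| * mesh N :> R by rewrite mulr_ge0 // ltW.
    move=> c; apply: (@le_trans _ _ (`|(y l)%:R - (y' l)%:R| * mesh N)).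
      by rewrite ler_piMl // ltW.
    by rewrite ler_pM2r.
  have := le_trans (le_coord_norm _ a 0) gg; rewrite !mxE.
  move=> XX; apply: oscillation_bound s1 s2 _ er3.
  by rewrite -mulrBr normrM (ger0_norm t0); apply: le_trans XX; rewrite ler_piMl // ltW.
move=> c y cN yN; rewrite -(ratr_small_initial (R := R)); apply/implyP => /forallP cy.
apply/forallP => a.
pose x : 'rV[R]_m := \row_i ((y i)%:R * mesh N).
have cx : unit_cube x.
  move=> i; rewrite mxE mulr_ge0 ?(ltW h0) //= -[leRHS](_ : (2 ^+ N) * mesh N = 1).
    by rewrite ler_pM2r // -natrX ler_nat.
  by rewrite /mesh divff // expf_neq0.
have yx : node_row N (at_zero y) = st_point x 0.
  apply: st_rowP => [i|]; first by rewrite st_point_space !mxE /node at_zero_space.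
  by rewrite st_point_time mxE /node at_zero_time mul0r.
have Hx : H (st_point x 0).
  apply/domain_slice; split=> // i; have := cx i; rewrite !mulr0 addr0; exact.
have := hW (at_zero y) a; rewrite lt_min => /andP[_ w1].
have := hth _ Hx; rewrite -yx -/(U _) yx (uphi cx) => w2.
have := hphi j cx; rewrite (coarse_valueE (leq_maxl _ _) (hp j) cN cy) => w3.
have := le_trans (le_coord_norm _ a 0) w2; have := le_trans (le_coord_norm _ a 0) w3.
rewrite !mxE => w5 w4; exact: initial_bound w1 w4 w5 j2 _.
Qed.

End Search.

End Completeness.

(** * The test of certificates as a program *)

Lemma cmpq_const D (c : nat) : cmpq D (fun _ _ => c%:R).
Proof. exact: cmpq_nat (cmp_const _ _). Qed.

Lemma cmpq_sqr D F : cmpq D F -> cmpq D (fun o xs => F o xs ^+ 2).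
Proof. by move=> h; apply: cmpq_ext (cmpq_mul h h) => o xs; rewrite expr2. Qed.

Lemma cmpq_exp2 D f : cmp D f -> cmpq D (fun o xs => 2 ^+ f o xs).
Proof.
move=> h; apply: cmpq_ext (cmpq_nat (cmp_exp2 h)) => o xs.
by rewrite natrX.
Qed.

(** [off] is the length of the header that precedes the values in a code: 3 in space-time, 1 for
    initial functions. *)
Definition grid_value n d (K : 'I_d -> nat) (off c : nat) (y : 'I_d -> nat) (a : 'I_n) : rat :=
  rat_of_code (dnth c (off + (node_index K y * n + a))).

Definition code_entry n (c : nat) (a b : 'I_n) : rat := rat_of_code (dnth c (a * n + b)).

Lemma cmpq_entry D n f (a b : 'I_n) : cmp D f -> cmpq D (fun o xs => code_entry (f o xs) a b).
Proof. by move=> h; apply: cmpq_code; apply: cmp_dnth => //; exact: cmp_const. Qed.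

Lemma cmpq_grid_value D n d (K Y : 'I_d -> cfun nat) off f (a : 'I_n) :
  (forall k, cmp D (K k)) -> (forall k, cmp D (Y k)) -> cmp D f ->
  cmpq D (fun o xs => grid_value (fun k => K k o xs) off (f o xs) (fun k => Y k o xs) a).
Proof.
move=> hK hY hf; apply: cmpq_code; apply: cmp_dnth => //.
apply: cmp_add; first exact: cmp_const.
apply: cmp_add; last exact: cmp_const.
apply: cmp_mul; last exact: cmp_const.
apply: cmp_bigsum => i; apply: cmp_mul => //; apply: cmp_bigprod => j.
exact: cmp_succ.
Qed.

Section Program.
Context {m n : nat}.
Variable D : nat.

Section Nodes.
Variables (Nf Lf : cfun nat) (alf bef : 'I_m -> cfun rat) (rhof ef djf : cfun rat).
Variables (Af : 'I_n -> 'I_n -> cfun rat) (Bf : 'I_m -> 'I_n -> 'I_n -> cfun rat).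
Variable cf : cfun nat.
Hypothesis hN : cmp D Nf.
Hypothesis hL : cmp D Lf.
Hypothesis hal : forall i, cmpq D (alf i).
Hypothesis hbe : forall i, cmpq D (bef i).
Hypothesis hrho : cmpq D rhof.
Hypothesis he : cmpq D ef.
Hypothesis hdj : cmpq D djf.
Hypothesis hA : forall a b, cmpq D (Af a b).
Hypothesis hB : forall i a b, cmpq D (Bf i a b).
Hypothesis hc : cmp D cf.

Implicit Type Y : 'I_(m + 1) -> cfun nat.

Let al o xs i := alf i o xs.
Let be o xs i := bef i o xs.
Let Aq o xs a b := Af a b o xs.
Let Bq o xs i a b := Bf i a b o xs.
Let W o xs : ('I_(m + 1) -> nat) -> 'I_n -> rat :=
  grid_value (grid_size (Nf o xs) (Lf o xs)) 3 (cf o xs).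

Let hal' i : cmpq D (fun o xs => al o xs i) := hal i.
Let hbe' i : cmpq D (fun o xs => be o xs i) := hbe i.
Let hA' a b : cmpq D (fun o xs => Aq o xs a b) := hA a b.
Let hB' i a b : cmpq D (fun o xs => Bq o xs i a b) := hB i a b.

Lemma cmp_grid_size (k : 'I_(m + 1)) : cmp D (fun o xs => grid_size (Nf o xs) (Lf o xs) k).
Proof. by rewrite /grid_size; case: (k < m)%N => //; exact: cmp_exp2. Qed.

(** A node is given by one computable function per coordinate. The same lemmas then serve for nodes
    read from the arguments, for their successors and for the nodes at t = 0. *)
Lemma cmpq_node Y k : (forall l, cmp D (Y l)) ->
  cmpq D (fun o xs => node (Nf o xs) (fun l => Y l o xs) k).
Proof. by move=> hY; apply: cmpq_mul; [exact: cmpq_nat|exact: cmpq_exp2V]. Qed.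

Lemma cmp_next_node Y k l : (forall l, cmp D (Y l)) ->
  cmp D (fun o xs => next_node k (fun l => Y l o xs) l).
Proof. by move=> hY; apply: cmp_add => //; exact: cmp_const. Qed.

Lemma cmpq_W Y a : (forall l, cmp D (Y l)) ->
  cmpq D (fun o xs => W o xs (fun l => Y l o xs) a).
Proof. by move=> hY; apply: cmpq_grid_value => // k; exact: cmp_grid_size. Qed.

Lemma cmpq_slope Y k a : (forall l, cmp D (Y l)) ->
  cmpq D (fun o xs => slope (Nf o xs) (W o xs) (fun l => Y l o xs) k a).
Proof.
move=> hY; apply: cmpq_mul; last exact: cmpq_exp2.
apply: cmpq_sub; last exact: cmpq_W.
by apply: (@cmpq_W (fun l o xs => next_node k (fun l => Y l o xs) l)) => l; exact: cmp_next_node.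
Qed.

Lemma cmpb_near_node Y : (forall l, cmp D (Y l)) ->
  cmpb D (fun o xs => near_node (Nf o xs) (al o xs) (be o xs) (rhof o xs) (fun l => Y l o xs)).
Proof.
move=> hY; apply: cmpb_forall => i; apply: cmpb_and; apply: cmpb_leq.
- by apply: cmpq_mul => //; exact: cmpq_node.
- by apply: cmpq_add => //; exact: cmpq_node.
- exact: cmpq_node.
apply: cmpq_add => //; apply: cmpq_add; first exact: (cmpq_const D 1).
by apply: cmpq_mul => //; exact: cmpq_node.
Qed.

Lemma cmpb_in_grid Y : (forall l, cmp D (Y l)) ->
  cmpb D (fun o xs => in_grid (Nf o xs) (Lf o xs) (fun l => Y l o xs)).
Proof. by move=> hY; apply: cmpb_forall => k; apply: cmpb_le => //; exact: cmp_grid_size. Qed.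

Lemma cmpb_edge Y k : (forall l, cmp D (Y l)) ->
  cmpb D (fun o xs => edge (Nf o xs) (Lf o xs) (al o xs) (be o xs) (rhof o xs)
    (fun l => Y l o xs) k).
Proof.
move=> hY; apply: cmpb_and; first exact: cmpb_in_grid.
apply: cmpb_and; first by apply: cmpb_le; [exact: cmp_succ|exact: cmp_grid_size].
apply: cmpb_and; first exact: cmpb_near_node.
by apply: (@cmpb_near_node (fun l o xs => next_node k (fun l => Y l o xs) l)) => l;
  exact: cmp_next_node.
Qed.

Lemma cmpb_small_residual Y : (forall l, cmp D (Y l)) ->
  cmpb D (fun o xs => small_residual (Nf o xs) (Lf o xs) (al o xs) (be o xs) (rhof o xs)
    (ef o xs) (djf o xs) (Aq o xs) (Bq o xs) (W o xs) (fun l => Y l o xs)).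
Proof.
move=> hY; apply: cmpb_imp; first by apply: cmpb_forall => k; exact: cmpb_edge.
apply: cmpb_forall => a; apply: cmpb_and; first apply: cmpb_leq => //.
  apply: cmpq_norm; apply: cmpq_add; apply: cmpq_bigsum => b.
    by apply: cmpq_mul => //; exact: cmpq_slope.
  by apply: cmpq_bigsum => b'; apply: cmpq_mul => //; exact: cmpq_slope.
apply: cmpb_forall => k; apply: cmpb_leq => //.
by apply: cmpq_mul => //; apply: cmpq_norm; exact: cmpq_slope.
Qed.

Lemma cmpb_small_oscillation Y Y' : (forall l, cmp D (Y l)) -> (forall l, cmp D (Y' l)) ->
  cmpb D (fun o xs => small_oscillation (Nf o xs) (Lf o xs) (al o xs) (be o xs) (rhof o xs)
    (ef o xs) (W o xs) (fun l => Y l o xs) (fun l => Y' l o xs)).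
Proof.
move=> hY hY'; apply: cmpb_forall => k; apply: cmpb_imp.
  apply: cmpb_and; first exact: cmpb_edge.
  apply: cmpb_and; first exact: cmpb_edge.
  have c2 Z : (forall l, cmp D (Z l)) -> forall l, cmp D (fun o xs => Z l o xs + 2)%N.
    by move=> hZ l; apply: cmp_add => //; exact: cmp_const.
  by apply: cmpb_forall => l; apply: cmpb_and; apply: cmpb_le => //; exact: c2.
apply: cmpb_forall => a; apply: cmpb_leq => //; apply: cmpq_norm.
by apply: cmpq_sub; exact: cmpq_slope.
Qed.

Section Initial.
Variables (N'f pf : cfun nat) (e0f : cfun rat).
Hypothesis hN' : cmp D N'f.
Hypothesis hp : cmp D pf.
Hypothesis he0 : cmpq D e0f.

Let G o xs : ('I_m -> nat) -> 'I_n -> rat := grid_value (fun=> 2 ^ N'f o xs)%N 1 (pf o xs).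

Lemma cmpq_coarse_value (C Y : 'I_m -> cfun nat) a :
  (forall i, cmp D (C i)) -> (forall i, cmp D (Y i)) ->
  cmpq D (fun o xs => coarse_value (Nf o xs) (N'f o xs) (G o xs)
    (fun i => C i o xs) (fun i => Y i o xs) a).
Proof.
move=> hC hY; apply: cmpq_bigsum => b; apply: cmpq_mul.
  apply: cmpq_bigprod => i.
  have ht : cmpq D (fun o xs =>
      (Y i o xs)%:R * 2 ^- (Nf o xs - N'f o xs) - (C i o xs)%:R).
    apply: cmpq_sub; last exact: cmpq_nat.
    by apply: cmpq_mul; [exact: cmpq_nat|apply: cmpq_exp2V; exact: cmp_sub].
  by rewrite /wt; case: (b i) => //; apply: cmpq_sub => //; exact: (cmpq_const D 1).
apply: (@cmpq_grid_value _ _ _ (fun=> fun o xs => 2 ^ N'f o xs)%N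
  (fun i o xs => C i o xs + b i)%N) => // i.
  exact: cmp_exp2.
by apply: cmp_add => //; exact: cmp_const.
Qed.

Lemma cmpb_small_initial (C Y : 'I_m -> cfun nat) :
  (forall i, cmp D (C i)) -> (forall i, cmp D (Y i)) ->
  cmpb D (fun o xs => small_initial (Nf o xs) (W o xs) (N'f o xs) (G o xs) (e0f o xs)
    (fun i => C i o xs) (fun i => Y i o xs)).
Proof.
move=> hC hY; apply: cmpb_imp.
  have hP : cmp D (fun o xs => 2 ^ (Nf o xs - N'f o xs))%N.
    by apply: cmp_exp2; exact: cmp_sub.
  apply: cmpb_forall => i; apply: cmpb_and; apply: cmpb_le => //; apply: cmp_mul => //.
  exact: cmp_succ.
apply: cmpb_forall => a; apply: cmpb_leq => //; apply: cmpq_norm; apply: cmpq_sub.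
  apply: (@cmpq_W (fun k o xs => at_zero (fun i => Y i o xs) k)) => k.
  by rewrite /at_zero; case: fintype.split => [i|_] //; exact: cmp_const.
exact: cmpq_coarse_value.
Qed.

End Initial.

Lemma cmpb_geometry : cmpb D (fun o xs => geometry (Nf o xs) (Lf o xs) (al o xs) (be o xs) (rhof o xs)).
Proof.
have h0 := cmpq_const D 0; have h1 := cmpq_const D 1.
have hm : cmpq D (fun o xs => mesh (Nf o xs)) by exact: cmpq_exp2V.
apply: cmpb_forall => i; apply: cmpb_and; last (apply: cmpb_and; last (apply: cmpb_and; last apply: cmpb_and));
  apply: cmpb_leq => //.
- by apply: cmpq_mul => //; apply: cmpq_add.
- by apply: cmpq_mul => //; apply: cmpq_sub.
apply: cmpq_mul; last exact: cmpq_sub.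
by apply: cmpq_mul => //; exact: cmpq_nat.
Qed.

Lemma cmpb_rayleigh (vf v'f : 'I_m -> 'I_n -> cfun rat) :
  (forall i a, cmpq D (vf i a)) -> (forall i a, cmpq D (v'f i a)) ->
  cmpb D (fun o xs => rayleigh (al o xs) (be o xs) (djf o xs) (Aq o xs) (Bq o xs)
    (fun i a => vf i a o xs) (fun i a => v'f i a o xs)).
Proof.
move=> hv hv'.
have lhs (c : cfun rat) (w : 'I_n -> cfun rat) : cmpq D c -> (forall a, cmpq D (w a)) ->
    cmpq D (fun o xs => djf o xs * (1 + `|c o xs|) * (\sum_a `|w a o xs|) ^+ 2).
  move=> hcc hw; apply: cmpq_mul.
    apply: cmpq_mul => //; apply: cmpq_add; first exact: (cmpq_const D 1).
    exact: cmpq_norm.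
  by apply: cmpq_sqr; apply: cmpq_bigsum => a; exact: cmpq_norm.
apply: cmpb_forall => i; apply: cmpb_and; apply: cmpb_ltq.
- exact: (lhs (alf i)).
- apply: cmpq_bigsum => a; apply: cmpq_bigsum => b; apply: cmpq_mul => //.
  by apply: cmpq_mul => //; apply: cmpq_sub => //; exact: cmpq_mul.
- exact: (lhs (bef i)).
apply: cmpq_bigsum => a; apply: cmpq_bigsum => b; apply: cmpq_mul => //.
by apply: cmpq_mul => //; apply: cmpq_sub => //; exact: cmpq_mul.
Qed.

End Nodes.
End Program.

Lemma nth_map_enum d (y : 'I_d -> nat) (s : seq nat) (i : 'I_d) :
  nth 0%N ([seq y i | i <- enum 'I_d] ++ s) i = y i.
Proof.
rewrite nth_cat size_map size_enum_ord ltn_ord (nth_map i) ?size_enum_ord //.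
by rewrite nth_ord_enum.
Qed.

Lemma nth_map_enum_tail d (y : 'I_d -> nat) (s : seq nat) p :
  nth 0%N ([seq y i | i <- enum 'I_d] ++ s) (d + p) = nth 0%N s p.
Proof. by rewrite nth_cat size_map size_enum_ord ltnNge leq_addr /= addKn. Qed.

Section Check.
Variables m n Kc : nat.

(* A certificate z lists the code of the grid function, the index of the
   approximations of the data that are used, e, rho, and the numbers and
   vectors of [rayleigh]. *)
Definition cert_code z := dnth z 0.
Definition cert_level z := dnth (cert_code z) 0.
Definition cert_steps z := dnth (cert_code z) 2.
Definition cert_index z := dnth z 1.
Definition cert_rat z p := rat_of_code (dnth z p).
Definition cert_e z := cert_rat z 2.
Definition cert_rho z := cert_rat z 3.
Definition cert_al z (i : 'I_m) := cert_rat z (4 + i).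
Definition cert_be z (i : 'I_m) := cert_rat z (4 + m + i).
Definition cert_v z (i : 'I_m) (a : 'I_n) := cert_rat z (4 + 2 * m + i * n + a).
Definition cert_v' z (i : 'I_m) (a : 'I_n) := cert_rat z (4 + 2 * m + m * n + i * n + a).
Definition cert_values z : ('I_(m + 1) -> nat) -> 'I_n -> rat :=
  grid_value (grid_size (cert_level z) (cert_steps z)) 3 (cert_code z).

(* The positions in an oracle of [cauchy_data_rep] of the j-th approximations. *)
Definition data_A (o : nat -> nat) j : 'I_n -> 'I_n -> rat := code_entry (o (j * 8)%N).
Definition data_B (o : nat -> nat) j (i : 'I_m) : 'I_n -> 'I_n -> rat :=
  code_entry (o (((j * m + i) * 2).+1 * 4)%N).
Definition data_phi (o : nat -> nat) j := o (j * 2).+1.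
Definition data_level o j := dnth (data_phi o j) 0.
Definition data_values o j : ('I_m -> nat) -> 'I_n -> rat :=
  grid_value (fun=> 2 ^ data_level o j)%N 1 (data_phi o j).

(** The fixed shift [Kc] absorbs the constant of the error estimate. *)
Definition cert_tol k : rat := 2 ^- (k + Kc).

(** The tests use the mesh as time step as well, while the numbering of grid functions reads the
    time step from the code; the first conjunct makes the two agree. *)
Definition certifies o z k : Prop :=
  let j := cert_index z in
  rat_of_code (dnth (cert_code z) 1) = 2 ^- cert_level z /\
  certified (cert_level z) (cert_steps z) (cert_al z) (cert_be z) (cert_rho z) (cert_e z)
    (2 ^- j) (data_A o j) (data_B o j) (cert_values z) (cert_v z) (cert_v' z)
    (data_level o j) (data_values o j) (cert_tol k).

Definition check_static o z k : bool :=
  let j := cert_index z in let N := cert_level z in let L := cert_steps z in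
  [&& (rat_of_code (dnth (cert_code z) 1) <= 2 ^- N)
    && (2 ^- N <= rat_of_code (dnth (cert_code z) 1)),
    0 < cert_e z, cert_e z * (1 + L%:R * mesh N) <= cert_tol k, 2 ^- j <= cert_tol k,
    (data_level o j <= N)%N, geometry N L (cert_al z) (cert_be z) (cert_rho z)
  & rayleigh (cert_al z) (cert_be z) (2 ^- j) (data_A o j) (data_B o j) (cert_v z) (cert_v' z)].

Definition check_residual o z y : bool :=
  let j := cert_index z in let N := cert_level z in let L := cert_steps z in
  in_grid N L y ==> small_residual N L (cert_al z) (cert_be z) (cert_rho z) (cert_e z)
    (2 ^- j) (data_A o j) (data_B o j) (cert_values z) y.

Definition check_oscillation z y y' : bool :=
  let N := cert_level z in let L := cert_steps z in
  in_grid N L y && in_grid N L y' ==>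
  small_oscillation N L (cert_al z) (cert_be z) (cert_rho z) (cert_e z) (cert_values z) y y'.

Definition check_initial o z k c y : bool :=
  let j := cert_index z in let N := cert_level z in
  [forall i, (c i < 2 ^ data_level o j)%N] && [forall i, (y i <= 2 ^ N)%N] ==>
  small_initial N (cert_values z) (data_level o j) (data_values o j) (cert_tol k) c y.

(** One bound for the coordinates of all nodes that the tests quantify over; for nodes outside the
    grids the tests hold vacuously. *)
Definition node_bound o z := (2 ^ cert_level z + cert_steps z + 2 ^ data_level o (cert_index z)).+1%N.

Definition check : cfun bool := fun o xs =>
  let z := nth 0%N xs 0 in let k := nth 0%N xs 1 in
  [&& check_static o z k,
    allv (m + 1) (node_bound o z) (fun ys => check_residual o z (fun i => nth 0%N ys i)),
    allv ((m + 1) + (m + 1)) (node_bound o z) (fun ys =>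
      check_oscillation z (fun i => nth 0%N ys i) (fun i => nth 0%N ys ((m + 1) + i)%N))
  & allv (m + m) (node_bound o z) (fun ys =>
      check_initial o z k (fun i => nth 0%N ys i) (fun i => nth 0%N ys (m + i)%N))].

Lemma nth_map_enum0 d (y : 'I_d -> nat) (i : 'I_d) :
  nth 0%N [seq y i | i <- enum 'I_d] i = y i.
Proof. by rewrite -[X in nth _ X _]cats0 nth_map_enum. Qed.

Lemma allv_one d S (P : ('I_d -> nat) -> bool) :
  allv d S (fun ys => P (fun i => nth 0%N ys i)) <->
  forall y : 'I_d -> nat, (forall i, y i < S)%N -> P y.
Proof.
have E (y : 'I_d -> nat) : (fun i : 'I_d => nth 0%N [seq y i | i <- enum 'I_d] i) = y.
  by apply/funext => i; rewrite nth_map_enum0.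
split=> [/allvP h y hy|h]; first by have := h y hy; rewrite E.
by apply/allvP => y hy; rewrite E; exact: h.
Qed.

Lemma allv_two d S (P : ('I_d -> nat) -> ('I_d -> nat) -> bool) :
  allv (d + d) S (fun ys => P (fun i => nth 0%N ys i) (fun i => nth 0%N ys (d + i)%N)) <->
  forall y y' : 'I_d -> nat, (forall i, y i < S)%N -> (forall i, y' i < S)%N -> P y y'.
Proof.
pose lo (y : 'I_(d + d) -> nat) i := y (lshift d i); pose hi (y : 'I_(d + d) -> nat) i := y (rshift d i).
have E1 (y : 'I_(d + d) -> nat) : (fun i : 'I_d => nth 0%N [seq y i | i <- enum 'I_(d + d)] i) = lo y.
  by apply/funext => i; exact: (nth_map_enum0 y (lshift d i)).
have E2 (y : 'I_(d + d) -> nat) :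
    (fun i : 'I_d => nth 0%N [seq y i | i <- enum 'I_(d + d)] (d + i)%N) = hi y.
  by apply/funext => i; exact: (nth_map_enum0 y (rshift d i)).
split=> [/allvP h y y' hy hy'|h]; last first.
  by apply/allvP => y hy; rewrite E1 E2; apply: h => i; exact: hy.
pose yy (i : 'I_(d + d)) := match fintype.split i with inl i => y i | inr i => y' i end.
have := h yy; rewrite E1 E2.
have -> : lo yy = y by apply/funext => i; rewrite /lo /yy -[lshift d i]/(unsplit (inl i)) unsplitK.
have -> : hi yy = y' by apply/funext => i; rewrite /hi /yy -[rshift d i]/(unsplit (inr i)) unsplitK.
by apply=> i; rewrite /yy; case: fintype.split.
Qed.

Lemma checkP o z k : check o [:: z; k] <-> certifies o z k.
Proof.
rewrite /check /=; split.
  case/and4P => /and5P[/le_anti tauE c1 c2 c3 /and3P[c4 c5 c6]].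
  move=> /(allv_one _ (check_residual o z)) h1 /(allv_two _ (check_oscillation z)) h2.
  move=> /(allv_two _ (check_initial o z k)) h3.
  have bnd y : in_grid (m := m) (cert_level z) (cert_steps z) y ->
      forall i, (y i < node_bound o z)%N.
    move=> /forallP hy i; rewrite ltnS; apply: (leq_trans (hy i)); rewrite /grid_size.
    by case: ifP => _; rewrite -!addnA ?leq_addr // addnCA leq_addr.
  split=> //; split=> //.
  - by move=> y hy; have := h1 y (bnd y hy); rewrite /check_residual hy.
  - by move=> y y' hy hy'; have := h2 y y' (bnd y hy) (bnd y' hy'); rewrite /check_oscillation hy hy'.
  move=> c y hc hy.
  have cb i : (c i < node_bound o z)%N by rewrite ltnS ltnW // (leq_trans (hc i)) // leq_addl.
  have yb i : (y i < node_bound o z)%N by rewrite ltnS (leq_trans (hy i)) // -addnA leq_addr.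
  have /implyP := h3 c y cb yb.
  by apply; apply/andP; split; apply/forallP.
move=> [tauE [[c1 c2 c3 c4 c5] c6 h1 h2 h3]]; apply/and4P; split.
- by rewrite /check_static tauE lexx c1 c2 c3 c4 c5 c6.
- by apply/(allv_one _ (check_residual o z)) => y _; apply/implyP => hy; exact: h1.
- apply/(allv_two _ (check_oscillation z)) => y y' _ _; apply/implyP => /andP[hy hy'].
  exact: h2.
apply/(allv_two _ (check_initial o z k)) => c y _ _.
by apply/implyP => /andP[/forallP hc /forallP hy]; exact: h3.
Qed.

Section Computability.
Variables (D : nat) (zf kf : cfun nat).
Hypothesis hz : cmp D zf.
Hypothesis hk : cmp D kf.

Lemma cmp_cert_code : cmp D (fun o xs => cert_code (zf o xs)).
Proof. by apply: cmp_dnth => //; exact: cmp_const. Qed.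

Lemma cmp_cert_level : cmp D (fun o xs => cert_level (zf o xs)).
Proof. by apply: cmp_dnth; [exact: cmp_cert_code|exact: cmp_const]. Qed.

Lemma cmp_cert_steps : cmp D (fun o xs => cert_steps (zf o xs)).
Proof. by apply: cmp_dnth; [exact: cmp_cert_code|exact: cmp_const]. Qed.

Lemma cmp_cert_index : cmp D (fun o xs => cert_index (zf o xs)).
Proof. by apply: cmp_dnth => //; exact: cmp_const. Qed.

Lemma cmpq_cert_rat p : cmpq D (fun o xs => cert_rat (zf o xs) p).
Proof. by apply: cmpq_code; apply: cmp_dnth => //; exact: cmp_const. Qed.

Lemma cmpq_cert_tol : cmpq D (fun o xs => cert_tol (kf o xs)).
Proof. by apply: cmpq_exp2V; apply: cmp_add => //; exact: cmp_const. Qed.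

Lemma cmpq_data_A a b : cmpq D (fun o xs => data_A o (cert_index (zf o xs)) a b).
Proof.
apply: cmpq_entry; apply: cmp_oracle; apply: cmp_mul; [exact: cmp_cert_index|exact: cmp_const].
Qed.

Lemma cmpq_data_B i a b : cmpq D (fun o xs => data_B o (cert_index (zf o xs)) i a b).
Proof.
apply: cmpq_entry; apply: cmp_oracle; apply: cmp_mul; last exact: cmp_const.
apply: cmp_succ; apply: cmp_mul; last exact: cmp_const.
apply: cmp_add; last exact: cmp_const.
by apply: cmp_mul; [exact: cmp_cert_index|exact: cmp_const].
Qed.

Lemma cmp_data_phi : cmp D (fun o xs => data_phi o (cert_index (zf o xs))).
Proof.
apply: cmp_oracle; apply: cmp_succ.
by apply: cmp_mul; [exact: cmp_cert_index|exact: cmp_const].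
Qed.

Lemma cmp_data_level : cmp D (fun o xs => data_level o (cert_index (zf o xs))).
Proof. by apply: cmp_dnth; [exact: cmp_data_phi|exact: cmp_const]. Qed.

Lemma cmp_node_bound : cmp D (fun o xs => node_bound o (zf o xs)).
Proof.
apply: cmp_succ; apply: cmp_add; last by apply: cmp_exp2; exact: cmp_data_level.
by apply: cmp_add; [apply: cmp_exp2; exact: cmp_cert_level|exact: cmp_cert_steps].
Qed.

Lemma cmpb_check_static : cmpb D (fun o xs => check_static o (zf o xs) (kf o xs)).
Proof.
have hN := cmp_cert_level; have hL := cmp_cert_steps; have hj := cmp_cert_index.
have ht : cmpq D (fun o xs => rat_of_code (dnth (cert_code (zf o xs)) 1)).
  by apply: cmpq_code; apply: cmp_dnth; [exact: cmp_cert_code|exact: cmp_const].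
have hN2 := cmpq_exp2V hN; have hj2 := cmpq_exp2V hj.
apply: cmpb_and; first by apply: cmpb_and; apply: cmpb_leq.
apply: cmpb_and; first by apply: cmpb_ltq; [exact: (cmpq_const D 0)|exact: cmpq_cert_rat].
apply: cmpb_and.
  apply: cmpb_leq; last exact: cmpq_cert_tol.
  apply: cmpq_mul; first exact: cmpq_cert_rat.
  apply: cmpq_add; first exact: (cmpq_const D 1).
  by apply: cmpq_mul => //; exact: cmpq_nat.
apply: cmpb_and; first by apply: cmpb_leq => //; exact: cmpq_cert_tol.
apply: cmpb_and; first by apply: cmpb_le => //; exact: cmp_data_level.
apply: cmpb_and.
  by apply: (@cmpb_geometry m D _ _ (fun i o xs => cert_al (zf o xs) i)
    (fun i o xs => cert_be (zf o xs) i)) => // *; exact: cmpq_cert_rat.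
apply: (@cmpb_rayleigh m n D (fun i o xs => cert_al (zf o xs) i)
    (fun i o xs => cert_be (zf o xs) i) _
    (fun a b o xs => data_A o (cert_index (zf o xs)) a b)
    (fun i a b o xs => data_B o (cert_index (zf o xs)) i a b) _ _ _ _ _
    (fun i a o xs => cert_v (zf o xs) i a) (fun i a o xs => cert_v' (zf o xs) i a)) => //;
  try (by move=> *; exact: cmpq_cert_rat).
  by move=> *; exact: cmpq_data_A.
by move=> *; exact: cmpq_data_B.
Qed.

Lemma cmpb_check_residual (Y : 'I_(m + 1) -> cfun nat) : (forall i, cmp D (Y i)) ->
  cmpb D (fun o xs => check_residual o (zf o xs) (fun i => Y i o xs)).
Proof.
have hN := cmp_cert_level; have hL := cmp_cert_steps.
have hj2 := cmpq_exp2V cmp_cert_index.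
move=> hY; apply: cmpb_imp; first exact: cmpb_in_grid.
apply: (@cmpb_small_residual m n D _ _ (fun i o xs => cert_al (zf o xs) i)
    (fun i o xs => cert_be (zf o xs) i) _ _ _
    (fun a b o xs => data_A o (cert_index (zf o xs)) a b)
    (fun i a b o xs => data_B o (cert_index (zf o xs)) i a b)) => //;
  try (by move=> *; exact: cmpq_cert_rat); try exact: cmpq_cert_rat.
- by move=> *; exact: cmpq_data_A.
- by move=> *; exact: cmpq_data_B.
exact: cmp_cert_code.
Qed.

Lemma cmpb_check_oscillation (Y Y' : 'I_(m + 1) -> cfun nat) :
  (forall i, cmp D (Y i)) -> (forall i, cmp D (Y' i)) ->
  cmpb D (fun o xs => check_oscillation (zf o xs) (fun i => Y i o xs) (fun i => Y' i o xs)).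
Proof.
have hN := cmp_cert_level; have hL := cmp_cert_steps.
move=> hY hY'; apply: cmpb_imp; first by apply: cmpb_and; exact: cmpb_in_grid.
apply: (@cmpb_small_oscillation m n D _ _ (fun i o xs => cert_al (zf o xs) i)
    (fun i o xs => cert_be (zf o xs) i)) => //;
  try (by move=> *; exact: cmpq_cert_rat); try exact: cmpq_cert_rat.
exact: cmp_cert_code.
Qed.

Lemma cmpb_check_initial (C Y : 'I_m -> cfun nat) :
  (forall i, cmp D (C i)) -> (forall i, cmp D (Y i)) ->
  cmpb D (fun o xs => check_initial o (zf o xs) (kf o xs) (fun i => C i o xs) (fun i => Y i o xs)).
Proof.
have hN := cmp_cert_level; have hL := cmp_cert_steps; have hN' := cmp_data_level.
move=> hC hY; apply: cmpb_imp.
  apply: cmpb_and; apply: cmpb_forall => i; apply: cmpb_le => //.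
  - exact: cmp_succ.
  - exact: cmp_exp2.
  exact: cmp_exp2.
apply: cmpb_small_initial => //; [exact: cmp_cert_code|exact: cmp_data_phi|exact: cmpq_cert_tol].
Qed.

End Computability.

Lemma cmpb_allv_ext D d (b : cfun nat) (P : cfun bool) (Q : cfun (seq nat -> bool)) :
  cmp D b -> cmpb (d + D) P ->
  (forall o xs (y : 'I_d -> nat), size xs = D ->
    P o ([seq y i | i <- enum 'I_d] ++ xs) = Q o xs [seq y i | i <- enum 'I_d]) ->
  cmpb D (fun o xs => allv d (b o xs) (Q o xs)).
Proof.
move=> hb hP PQ; apply: cmp_ext (cmpb_allv hb hP) => o xs sx; congr nat_of_bool.
by apply/allvP/allvP => h y hy; have := h y hy; rewrite PQ.
Qed.

Lemma cmpb_check : cmpb 2 check.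
Proof.
have hz : cmp 2 (fun _ xs => nth 0%N xs 0) by exact: cmp_proj.
have hS := cmp_node_bound hz.
apply: cmpb_and; first by apply: cmpb_check_static => //; exact: cmp_proj.
apply: cmpb_and.
  apply: (cmpb_allv_ext (P := fun o l => check_residual o (nth 0%N l (m + 1 + 0))
    (fun i => nth 0%N l i))) => // [|o xs y _].
    by apply: (@cmpb_check_residual _ _ _ (fun i _ l => nth 0%N l i)) => *; exact: cmp_proj.
  by rewrite nth_map_enum_tail; congr check_residual; apply/funext => i;
    rewrite nth_map_enum nth_map_enum0.
apply: cmpb_and.
  apply: (cmpb_allv_ext (P := fun o l => check_oscillation (nth 0%N l (m + 1 + (m + 1) + 0))
    (fun i => nth 0%N l i) (fun i => nth 0%N l (m + 1 + i)))) => // [|o xs y _].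
    by apply: (@cmpb_check_oscillation _ _ _ (fun i _ l => nth 0%N l i)
      (fun i _ l => nth 0%N l (m + 1 + i))) => *; exact: cmp_proj.
  rewrite nth_map_enum_tail; congr check_oscillation; apply/funext => i.
    by rewrite (nth_map_enum y xs (lshift _ i)) (nth_map_enum0 y (lshift _ i)).
  by rewrite (nth_map_enum y xs (rshift _ i)) (nth_map_enum0 y (rshift _ i)).
apply: (cmpb_allv_ext (P := fun o l => check_initial o (nth 0%N l (m + m + 0))
  (nth 0%N l (m + m + 1)) (fun i => nth 0%N l i) (fun i => nth 0%N l (m + i)))) => // [|o xs y _].
  by apply: (@cmpb_check_initial _ _ _ _ _ (fun i _ l => nth 0%N l i)
    (fun i _ l => nth 0%N l (m + i))) => *; exact: cmp_proj.
rewrite !nth_map_enum_tail; congr check_initial; apply/funext => i.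
  by rewrite (nth_map_enum y xs (lshift _ i)) (nth_map_enum0 y (lshift _ i)).
by rewrite (nth_map_enum y xs (rshift _ i)) (nth_map_enum0 y (rshift _ i)).
Qed.

End Check.

(** * Every certificate has a code *)

Lemma dnth_code s i : dnth (CodeSeq.code s) i = nth 0%N s i.
Proof. by rewrite /dnth CodeSeq.codeK. Qed.

Lemma rat_code_exists (q : rat) : exists c, rat_of_code c = q.
Proof.
have [a [b ab]] : exists a b : nat, numq q = a%:Z - b%:Z :> int.
  by case: (numq q) => k; [exists k, 0%N; rewrite subr0|exists 0%N, k.+1; rewrite sub0r NegzE].
exists (CodeSeq.code [:: a; b; `|denq q|.-1]%N).
rewrite /rat_of_code CodeSeq.codeK /= prednK ?absz_gt0 ?denq_neq0 //.
rewrite -[RHS]divq_num_den ab intrB -!pmulrn; congr (_ / _).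
by rewrite -[in RHS](gez0_abs (ltW (denq_gt0 q))).
Qed.

Section NodeIndex.
Context {d : nat}.
Implicit Types (K y : 'I_d -> nat).

Let ext y (i : nat) : nat := if insub i is Some o then y o else 0%N.

Let extE y i : ext y (val i) = y i. Proof. by rewrite /ext valK. Qed.

(** [node_index] is a numeral with mixed radices. Digits are indexed here by natural numbers instead
    of ordinals, so that induction on their number is possible. *)
Let radix_index (K y : nat -> nat) e : nat := (\sum_(i < e) y i * \prod_(j < i) (K j).+1)%N.

Let node_indexE K y : node_index K y = radix_index (ext K) (ext y) d.
Proof.
apply: eq_bigr => i _; rewrite extE; congr (_ * _)%N.
have -> := @big_ord_widen _ _ _ i d (fun j => (ext K j).+1) (ltnW (ltn_ord i)).
by apply: eq_bigr => j _; rewrite extE.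
Qed.

Let radix_index_lt (K y : nat -> nat) e : (forall i, i < e -> y i <= K i)%N ->
  (radix_index K y e < \prod_(j < e) (K j).+1)%N.
Proof.
elim: e => [|e IH] hy; first by rewrite /radix_index !big_ord0.
rewrite /radix_index !big_ord_recr /= -/(radix_index K y e).
have lt := IH (fun i hi => hy i (ltnW hi)).
apply: (@leq_trans ((y e).+1 * \prod_(j < e) (K j).+1)%N).
  by rewrite mulSn ltn_add2r.
by rewrite mulnC leq_mul2l ltnS hy ?orbT.
Qed.

Let radix_index_inj (K y y' : nat -> nat) e : (forall i, i < e -> y i <= K i)%N ->
  (forall i, i < e -> y' i <= K i)%N ->
  radix_index K y e = radix_index K y' e -> forall i, (i < e)%N -> y i = y' i.
Proof.
elim: e => // e IH hy hy'; rewrite /radix_index !big_ord_recr /=.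
rewrite -/(radix_index K y e) -/(radix_index K y' e).
have lt := radix_index_lt (fun i hi => hy i (ltnW hi)).
have lt' := radix_index_lt (fun i hi => hy' i (ltnW hi)).
set P := (\prod_(j < e) _)%N in lt lt' *.
have P0 : (0 < P)%N by apply: leq_ltn_trans lt.
move=> E; have Ey : y e = y' e.
  have := congr1 (fun x => x %/ P)%N E.
  by rewrite /= !(addnC (radix_index _ _ _)) !divnMDl // !divn_small // !addn0.
move: E; rewrite Ey => /addIn/(IH (fun i hi => hy i (ltnW hi)) (fun i hi => hy' i (ltnW hi))) h i.
by rewrite ltnS leq_eqVlt => /predU1P[->|/h].
Qed.

Lemma node_index_lt K y : (forall i, y i <= K i)%N ->
  (node_index K y < \prod_(j < d) (K j).+1)%N.
Proof.
move=> hy; rewrite node_indexE.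
have -> : (\prod_(j < d) (K j).+1 = \prod_(j < d) (ext K j).+1)%N.
  by apply: eq_bigr => j _; rewrite extE.
by apply: radix_index_lt => i hi; rewrite -[i]/(val (Ordinal hi)) !extE.
Qed.

Lemma node_index_inj K y y' : (forall i, y i <= K i)%N -> (forall i, y' i <= K i)%N ->
  node_index K y = node_index K y' -> y = y'.
Proof.
move=> hy hy'; rewrite !node_indexE => E; apply/funext => i; rewrite -(extE y) -(extE y').
by apply: (radix_index_inj _ _ E (ltn_ord i)) => j hj; rewrite -[j]/(val (Ordinal hj)) !extE.
Qed.

(** By injectivity of [node_index], a position of the list belongs to at most one pair of a node and
    a component, so the prescribed values can be stored independently; positions without such a pair
    receive 0. *)
Lemma grid_code_exists n K (pre : seq nat) (W : ('I_d -> nat) -> 'I_n -> rat) :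
  exists c, (forall i, i < size pre -> dnth c i = nth 0 pre i)%N /\
    forall y a, (forall i, y i <= K i)%N -> grid_value K (size pre) c y a = W y a.
Proof.
have /choice[f hf] p : exists c, forall y (a : 'I_n), (forall i, y i <= K i)%N ->
    (p = node_index K y * n + a)%N -> rat_of_code c = W y a.
  have [[[y a] [hy pe]]|no] :=
      pselect (exists ya : ('I_d -> nat) * 'I_n, (forall i, ya.1 i <= K i)%N /\
        (p = node_index K ya.1 * n + ya.2)%N); last first.
    by exists 0%N => y a hy pe; case: no; exists (y, a).
  have [c hc] := rat_code_exists (W y a); exists c => y' a' hy' pe'; rewrite hc.
  rewrite /= in hy pe; have n0 : (0 < n)%N by exact: leq_ltn_trans (ltn_ord a).
  have E : (node_index K y = node_index K y')%N.
    have := congr1 (fun x => x %/ n)%N (etrans (esym pe) pe').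
    by rewrite /= !divnMDl // !divn_small ?addn0.
  have -> : a' = a.
    by apply: val_inj; apply/eqP; rewrite -(eqn_add2l (node_index K y * n)%N) -pe E -pe'.
  by rewrite (node_index_inj hy hy' E).
exists (CodeSeq.code (pre ++ mkseq f ((\prod_(j < d) (K j).+1) * n)%N)); split.
  by move=> i hi; rewrite dnth_code nth_cat hi.
move=> y a hy; rewrite /grid_value dnth_code nth_cat ltnNge leq_addr /= addKn nth_mkseq.
  exact: hf.
have := node_index_lt hy; set P := (\prod_(j < d) _)%N => lt.
apply: (@leq_trans ((node_index K y).+1 * n)%N); last by rewrite leq_mul2r lt orbT.
by rewrite mulSn addnC ltn_add2r.
Qed.

End NodeIndex.

(** A code determines the grid function at the nodes of the grid only, and the tests read no other
    values. *)
Lemma certified_ext m n N L (al be : 'I_m -> rat) rho e dj (Aq : 'I_n -> 'I_n -> rat) Bq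
    W W' v v' N' G e0 :
  (forall y a, (forall k, y k <= grid_size N L k)%N -> W' y a = W y a) ->
  certified N L al be rho e dj Aq Bq W v v' N' G e0 ->
  certified N L al be rho e dj Aq Bq W' v v' N' G e0.
Proof.
move=> hW [c1 c2 c3 c4 c5]; split=> //.
- move=> y hy; have sl k a : edge N L al be rho y k -> slope N W' y k a = slope N W y k a.
    case/and4P => /forallP g yk _ _; rewrite /slope !hW // => l; rewrite /next_node.
    by case: eqP => [->|_]; rewrite ?addn1 ?addn0.
  have := c3 y hy; rewrite /small_residual => /implyP h; apply/implyP => he.
  have he' k : edge N L al be rho y k by move/forallP: he.
  apply/forallP => a; have /forallP/(_ a)/andP[h1 /forallP h2] := h he.
  apply/andP; split; last by apply/forallP => k; rewrite sl.
  apply: le_trans h1; rewrite le_eqVlt; apply/orP; left; apply/eqP; congr (`|_ + _|).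
    by apply: eq_bigr => b _; rewrite sl.
  by apply: eq_bigr => i _; apply: eq_bigr => b _; rewrite sl.
- move=> y y' hy hy'; apply/forallP => k; apply/implyP => /and3P[e1 e2 e3].
  have /forallP/(_ k) := c4 y y' hy hy'; rewrite e1 e2 e3 /= => /forallP h.
  have sl z a : edge N L al be rho z k -> slope N W' z k a = slope N W z k a.
    case/and4P => /forallP g yk _ _; rewrite /slope !hW // => l; rewrite /next_node.
    by case: eqP => [->|_]; rewrite ?addn1 ?addn0.
  by apply/forallP => a; rewrite !sl.
move=> c y hc hy; have := c5 c y hc hy; rewrite /small_initial => /implyP h.
apply/implyP => /h /forallP h'; apply/forallP => a; rewrite hW // => k.
move: k; apply: st_coordP => [i|]; last by rewrite at_zero_time.
by rewrite at_zero_space /grid_size /= ltn_ord.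
Qed.

Lemma cert_table m n (c0 c1 c2 c3 : nat) (al be : 'I_m -> rat) (v v' : 'I_m -> 'I_n -> rat) :
  exists z, [/\ [/\ dnth z 0 = c0, dnth z 1 = c1, dnth z 2 = c2 & dnth z 3 = c3],
    forall i, cert_al z i = al i, forall i, cert_be z i = be i,
    forall i a, cert_v z i a = v i a & forall i a, cert_v' z i a = v' i a].
Proof.
have /choice[fal hal] i := rat_code_exists (al i).
have /choice[fbe hbe] i := rat_code_exists (be i).
have /choice[fv hv] (ia : 'I_m * 'I_n) := rat_code_exists (v ia.1 ia.2).
have /choice[fv' hv'] (ia : 'I_m * 'I_n) := rat_code_exists (v' ia.1 ia.2).
pose line (f : 'I_m -> nat) := [seq f i | i <- enum 'I_m].
pose table (f : 'I_m * 'I_n -> nat) :=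
  mkseq (fun p => if insub (p %/ n)%N is Some i then
    if insub (p %% n)%N is Some a then f (i, a) else 0%N else 0%N) (m * n)%N.
have tableE f (i : 'I_m) (a : 'I_n) : nth 0%N (table f) (i * n + a) = f (i, a).
  have n0 : (0 < n)%N by exact: leq_ltn_trans (ltn_ord a).
  rewrite nth_mkseq; first by rewrite divnMDl // divn_small // addn0 modnMDl modn_small // !valK.
  apply: (@leq_trans (i.+1 * n)%N); last by rewrite leq_mul2r ltn_ord orbT.
  by rewrite mulSn addnC ltn_add2r.
have skip (s t : seq nat) p : nth 0%N (s ++ t) (size s + p) = nth 0%N t p.
  by rewrite nth_cat ltnNge leq_addr /= addKn.
have sl f : size (line f) = m by rewrite size_map size_enum_ord.
have st f : size (table f) = (m * n)%N by rewrite size_mkseq.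
have head (s t : seq nat) p : (p < size s)%N -> nth 0%N (s ++ t) p = nth 0%N s p.
  by move=> h; rewrite nth_cat h.
have tl f (i : 'I_m) (a : 'I_n) : (i * n + a < size (table f))%N.
  rewrite st; apply: (@leq_trans (i.+1 * n)%N); last by rewrite leq_mul2r ltn_ord orbT.
  by rewrite mulSn addnC ltn_add2r.
exists (CodeSeq.code ([:: c0; c1; c2; c3] ++ line fal ++ line fbe ++ table fv ++ table fv')).
split=> [|i|i|i a|i a]; first by rewrite !dnth_code.
- rewrite /cert_al /cert_rat dnth_code (skip [:: _; _; _; _]) head ?sl //.
  by rewrite nth_map_enum0 hal.
- rewrite /cert_be /cert_rat dnth_code -!addnA (skip [:: _; _; _; _]) -{1}(sl fal) skip head ?sl //.
  by rewrite nth_map_enum0 hbe.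
- rewrite /cert_v /cert_rat dnth_code -!addnA (skip [:: _; _; _; _]) add0n.
  by rewrite -{1}(sl fal) skip -{1}(sl fbe) skip head // tableE hv.
rewrite /cert_v' /cert_rat dnth_code -!addnA (skip [:: _; _; _; _]) add0n.
by rewrite -{1}(sl fal) skip -{1}(sl fbe) skip -(st fv) skip tableE hv'.
Qed.

Lemma certificate_code m n Kc o k j N L (al be : 'I_m -> rat) rho e v v' W :
  certified N L al be rho e (2 ^- j) (@data_A n o j) (data_B o j) W v v'
    (data_level o j) (data_values o j) (cert_tol Kc k) ->
  exists z, @certifies m n Kc o z k.
Proof.
move=> hc; have [ct ht] := rat_code_exists (2 ^- N).
have [ce he] := rat_code_exists e; have [cr hr] := rat_code_exists rho.
have [c [hpre hval]] := grid_code_exists (grid_size N L) [:: N; ct; L] W.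
have [z [[z0 z1 z2 z3] zal zbe zv zv']] := cert_table c j ce cr al be v v'.
have lev : cert_level z = N by rewrite /cert_level /cert_code z0 (hpre 0%N).
have ste : cert_steps z = L by rewrite /cert_steps /cert_code z0 (hpre 2%N).
exists z; split; first by rewrite lev /cert_code z0 (hpre 1%N).
rewrite lev ste /cert_index z1 /cert_e /cert_rho /cert_rat z2 z3 he hr.
have -> : cert_al z = al by apply/funext.
have -> : cert_be z = be by apply/funext.
have -> : cert_v z = v by apply/funext => i; apply/funext => a.
have -> : cert_v' z = v' by apply/funext => i; apply/funext => a.
apply: certified_ext hc => y a hy.
by rewrite /cert_values lev ste /cert_code z0; exact: hval.
Qed.

(** * Names of the data and of the solution *)

Section Names.
Context {R : realType}.

Lemma cvge0_lt (f : nat -> \bar R) eps k : f i @[i --> \oo] --> 0%E -> 0 < eps ->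
  exists2 i, (k < i)%N & (f i < eps%:E)%E.
Proof.
move=> cf e0; have h : \forall i \near \oo, (f i < eps%:E)%E.
  apply: (cf [set x | (x < eps%:E)%E]); apply: open_nbhs_nbhs; split.
    exact: open_ereal_lt_ereal.
  by rewrite /= lte_fin.
have [N _ hN] := h; exists (maxn N k.+1); first exact: leq_maxr.
by apply: hN; rewrite /= leq_maxl.
Qed.

(** The bound for the distance between the i-th and the k-th term survives the limit in i. The
    distances [d] need only dominate those of [s], so the lemma applies to single entries and point
    values. *)
Lemma le_fast_cauchy (x : R) (s : nat -> R) (d : nat -> \bar R) k :
  d i @[i --> \oo] --> 0%E -> (forall i, (`|s i - x|%:E <= d i)%E) ->
  (forall i, (k < i)%N -> `|s i - s k| <= 2 ^- k) -> `|s k - x| <= 2 ^- k.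
Proof.
move=> cd hd hs; apply/ler_addgt0Pr => e e0.
have [i ki di] := cvge0_lt k cd e0.
have h1 : `|s i - x| <= e by rewrite -lee_fin; exact: le_trans (hd i) (ltW di).
rewrite -(subrK (s i) (s k)) -addrA; apply: (le_trans (ler_normD _ _)).
by rewrite distrC; apply: lerD => //; exact: hs.
Qed.

Lemma mx_rep_entry n (M : set 'M[R]_n) q X : mx_rep M q X ->
  forall j a b, `|ratr (code_entry (q j) a b) - X a b| <= 2 ^- j.
Proof.
move=> [MX [s [hs hf hc]]] j a b.
have E i : s i a b = ratr (code_entry (q i) a b).
  by have [_ ->] := hs i; rewrite mxE.
rewrite -E; apply: (@le_fast_cauchy _ (fun i => s i a b) _ _ hc) => [i|i ji].
  by rewrite lee_fin; have := le_coord_enorm (s i - X) a b; rewrite !mxE.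
have := hf _ _ ji; rewrite lte_fin => h.
by have := le_trans (le_coord_enorm (s i - s j) a b) (ltW h); rewrite !mxE.
Qed.

Lemma grid_fun_value n d (K : 'I_d -> nat) off c :
  grid_fun_of_codes R n K (drop off (CodeSeq.decode c)) =
  fun y => \col_a ratr (grid_value K off c y a).
Proof.
by apply/funext => y; apply/matrixP => a b; rewrite !mxE nth_drop.
Qed.

Lemma Cs_rep_approx m n q (phi : 'rV[R]_m -> 'cV[R]_n) : Cs_rep q phi ->
  exists pj : nat -> 'rV[R]_m -> 'cV[R]_n, forall j,
    multilinear_interpolation (fun=> 2 ^- dnth (q j) 0) (fun=> 2 ^ dnth (q j) 0)%N
      (fun y => \col_a ratr (grid_value (fun=> 2 ^ dnth (q j) 0)%N 1 (q j) y a)) (pj j) /\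
    forall x, unit_cube x -> `|pj j x - phi x| <= 2 ^- j.
Proof.
move=> [cphi [s [hs hf hc]]]; exists s => j; split.
  by have [_] := hs j; rewrite /cube_numbering grid_fun_value.
move=> x cx; apply: mx_norm_le => [|a b]; first by rewrite invr_ge0 exprn_ge0.
rewrite ord1 !mxE; apply: (@le_fast_cauchy _ (fun i => s i x a 0) _ _ hc) => [i|i ji].
  apply: (@le_trans _ _ (enorm (s i x - phi x))%:E).
    by rewrite lee_fin; have := le_coord_enorm (s i x - phi x) a 0; rewrite !mxE.
  by apply: ereal_sup_ubound; exists x.
rewrite -lee_fin; apply: le_trans (ltW (hf _ _ ji)).
apply: (@le_trans _ _ (enorm (s i x - s j x))%:E).
  by rewrite lee_fin; have := le_coord_enorm (s i x - s j x) a 0; rewrite !mxE.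
by apply: ereal_sup_ubound; exists x.
Qed.

Lemma data_rep_approx m n (A : 'M[R]_n) (B : 'I_m -> 'M[R]_n) Nn phi q :
  cauchy_data_rep R m n q (A, B, Nn, phi) ->
  [/\ forall j a b, `|ratr (data_A q j a b) - A a b| <= 2 ^- j,
      forall j i a b, `|ratr (data_B q j i a b) - B i a b| <= 2 ^- j
    & exists pj : nat -> 'rV[R]_m -> 'cV[R]_n, forall j,
      multilinear_interpolation (fun=> 2 ^- data_level q j) (fun=> 2 ^ data_level q j)%N
        (fun y => \col_a ratr (data_values q j y a)) (pj j) /\
      forall x, unit_cube x -> `|pj j x - phi x| <= 2 ^- j].
Proof.
move=> [[[/= hA hB] _] hphi]; split.
- move=> j a b; have := mx_rep_entry hA j a b; rewrite /data_A.
  by have -> : (j.*2.*2.*2 = j * 8)%N by lia.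
- move=> j i a b; have := mx_rep_entry (hB i) j a b; rewrite /data_B.
  by have -> : ((j * m + i).*2.+1.*2.*2 = ((j * m + i) * 2).+1 * 4)%N by lia.
have E : (fun k => q k.*2.+1) = data_phi q.
  by apply/funext => k; rewrite /data_phi muln2.
rewrite /= E in hphi; exact: Cs_rep_approx hphi.
Qed.

End Names.

(** * The solution operator *)

Section Operator.
Context {R : realType} {m n MA : nat}.
Hypothesis m_gt0 : (0 < m)%N.
Hypothesis n_gt0 : (0 < n)%N.
Hypothesis MA_gt0 : (0 < MA)%N.

Definition data_const : R := (n ^ 2 * MA ^ 3)%:R.
(** [pencil_abs_le] bounds the eigenvalues by the square of [data_const]; the added 1 makes the
    bound positive. Both constants depend on n and [MA] only, as one program must serve all data. *)
Definition speed_bound : R := data_const ^+ 2 + 1.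
Let K := data_const.
Let Lam := speed_bound.

Lemma data_const_ge0 : 0 <= K. Proof. exact: ler0n. Qed.

Lemma speed_bound_gt0 : 0 < Lam.
Proof. by rewrite ltr_wpDl // sqr_ge0. Qed.

Section Data.
Variables (A : 'M[R]_n) (B : 'I_m -> 'M[R]_n).
Let H := correctness_domain A B.

Definition hyperbolic : Prop :=
  [/\ posdef_mx A, forall i, (B i)^T = B i, coercive K A,
      forall i, lambda_min A (B i) < 0 < lambda_max A (B i)
    & (forall i, - lambda_min A (B i) <= Lam /\ lambda_max A (B i) <= Lam) /\
      (forall a b, `|A a b| <= MA%:R) /\ (forall i a b, `|B i a b| <= MA%:R)].

Lemma admissible_hyperbolic Mphi p Nn phi :
  admissible Mphi MA p (A, B, Nn, phi) -> hyperbolic.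
Proof.
move=> [[pA A1 A2] hB _ _ _].
have cA : coercive K A by exact: posdef_coercive.
have sB i : (B i)^T = B i by have [] := hB i.
have ab i l : pencil_spectrum A (B i) l -> `|l| <= K ^+ 2.
  apply: pencil_abs_le pA cA _ => v; apply: sym_abs_qf_le => //.
  by have [] := hB i.
split=> //; first by move=> i; have [] := hB i.
split=> [i|]; last by split=> [a b|i a b]; apply: entry_le_norm2 => //; have [] := hB i.
have [s1 _] := lambda_maxP n_gt0 pA (sB i); have [s2 _] := lambda_minP n_gt0 pA (sB i).
have := ab _ _ s1; have := ab _ _ s2; rewrite !ler_norml => /andP[a1 _] /andP[_ a2].
by rewrite /Lam /speed_bound -/K; split; lra.
Qed.

Hypothesis hyp : hyperbolic.

Let pA : posdef_mx A. Proof. by case: hyp. Qed.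
Let sB : forall i, (B i)^T = B i. Proof. by case: hyp. Qed.
Let cA : coercive K A. Proof. by case: hyp. Qed.
Let lM0 i : 0 < lambda_max A (B i).
Proof. by case: hyp => _ _ _ /(_ i)/andP[]. Qed.
Let lm0 i : lambda_min A (B i) < 0.
Proof. by case: hyp => _ _ _ /(_ i)/andP[]. Qed.
Let LamM i : lambda_max A (B i) <= Lam.
Proof. by case: hyp => _ _ _ _ [/(_ i)[]]. Qed.
Let Lamm i : - lambda_min A (B i) <= Lam.
Proof. by case: hyp => _ _ _ _ [/(_ i)[]]. Qed.

Lemma hyperbolic_unique u v phi : {within H, continuous u} -> {within H, continuous v} ->
  solves_cauchy_problem A B phi u -> solves_cauchy_problem A B phi v ->
  forall y, H y -> u y = v y.
Proof.
exact: (solution_unique m_gt0 n_gt0 pA sB data_const_ge0 cA lM0 lm0 LamM Lamm speed_bound_gt0).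
Qed.

Lemma lat_le_weaken T T' v c c' : lat_le A B T v c -> T' <= T -> c <= c' -> lat_le A B T' v c'.
Proof.
move=> [t0 t00 h] TT cc; exists t0 => // tau N k ht hN hk.
by apply: le_trans cc; apply: h => //; exact: le_trans TT.
Qed.

Lemma lat_leN T v c : lat_le A B T v c -> lat_le A B T (fun x t => - v x t) c.
Proof.
move=> [t0 t00 h]; exists t0 => // tau N k ht hN hk.
apply: le_trans (h tau N k ht hN hk); rewrite le_eqVlt; apply/orP; left; apply/eqP.
congr (_ * _); apply: eq_bigr => j _; rewrite /on_lattice.
by case: ifP => _; rewrite ?normrN.
Qed.

Section Solution.
Variables (u : 'rV[R]_(m + 1) -> 'cV[R]_n) (phi : 'rV[R]_m -> 'cV[R]_n).
Hypothesis uc : {within H, continuous u}.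
Hypothesis usol : solves_cauchy_problem A B phi u.
Variables (q : nat -> nat) (pj : nat -> 'rV[R]_m -> 'cV[R]_n).
Hypothesis qA : forall j a b, `|ratr (data_A q j a b) - A a b| <= 2 ^- j.
Hypothesis qB : forall j i a b, `|ratr (data_B q j i a b) - B i a b| <= 2 ^- j.
Hypothesis qphi : forall j,
  multilinear_interpolation (fun=> 2 ^- data_level q j) (fun=> 2 ^ data_level q j)%N
    (fun y => \col_a ratr (data_values q j y a)) (pj j) /\
  forall x, unit_cube x -> `|pj j x - phi x| <= 2 ^- j.

Lemma certificate_found Kc k : exists z, @certifies m n Kc q z k.
Proof.
have [[ut [ux [put pux pde]]] uphi] := usol.
pose g (l : 'I_(m + 1)) := match fintype.split l with inl i => ux i | inr _ => ut end.
have gs i : g (space i) = ux i by rewrite /g -[space i]/(unsplit (inl i : 'I_m + 'I_1)) unsplitK.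
have gt : g (time m) = ut by rewrite /g -[time m]/(unsplit (inr ord0 : 'I_m + 'I_1)) unsplitK.
have gu : forall l, is_partial H l u (g l).
  by apply: st_coordP => [i|]; rewrite ?gs ?gt.
have gpde y : H y -> A *m g (time m) y + \sum_i B i *m g (space i) y = 0.
  by move=> Hy; rewrite gt -[RHS](pde y Hy); congr (_ + _); apply: eq_bigr => i _; rewrite gs.
have [_ _ _ _ [_ [AC BC]]] := hyp.
have tol0 : 0 < cert_tol Kc k by rewrite invr_gt0 exprn_gt0.
have [j [N [L [al [be [rho [e [v [v' [W hc]]]]]]]]]] :=
  certificate_exists m_gt0 n_gt0 pA sB lM0 lm0 LamM Lamm speed_bound_gt0 (ler0n R MA) AC BC
    gu gpde uc uphi qA qB (fun j => proj1 (qphi j)) (fun j => proj2 (qphi j)) tol0.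
exact: certificate_code hc.
Qed.

(** In units of the tolerance: 2 for the initial values, namely the test and the approximation of
    phi, and the stability constant times the defect of the interpolant, accumulated over the height
    of the grid. *)
Definition scale_const : R :=
  2 + @stab_const R m n K * (1 + ((m + 1) * n)%:R + Lam).

Definition error_const : R := 2 ^+ m * (8 * K ^+ 2 + 2) * scale_const ^+ 2.

Lemma certificate_sound Kc k z : @certifies m n Kc q z k ->
  exists f T, [/\ continuous f, space_time_numbering H (dnth z 0) f,
    forall y, H y -> y 0 (time m) <= T
  & lat_le A B T (spread (fun y => f y - u y)) (error_const * (2 ^- (k + Kc)) ^+ 2)].
Proof.
move=> [tauE [[e_gt0 eT djt NN geo] ray res osc ini]].
set N := cert_level z in tauE eT NN geo res osc ini.
set L := cert_steps z in eT geo res osc ini.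
set j := cert_index z in djt NN ray res osc ini.
rewrite -(ratr_geometry (R := R)) in geo.
rewrite -(ratr_rayleigh (R := R)) in ray.
have rj (i : nat) : ratr (2 ^- i) = 2 ^- i :> R by rewrite fmorphV rmorphXn /= ratr_nat.
rewrite rj in ray.
have rb := rayleigh_bounds n_gt0 pA sB (qA j) (qB j) ray.
have al_lM i : ratr (cert_al z i) <= lambda_max A (B i) by have [/ltW] := rb i.
have lm_be i : lambda_min A (B i) <= ratr (cert_be z i) by have [_ /ltW] := rb i.
have re : 0 < ratr (cert_e z) :> R by rewrite ltr0q.
have [f hf cf] := multilinear_exists (fun _ : 'I_(m + 1) => mesh_gt0 (R := R) N)
  (grid_size N L) (fun y => \col_a ratr (cert_values z y a) : 'cV[R]_n).
have box := domain_box m_gt0 lM0 lm0 geo al_lM lm_be.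
exists f, (L%:R * mesh N); split=> //.
- have hE : (fun k0 : 'I_(m + 1) =>
      if (k0 < m)%N then 2 ^- dnth (dnth z 0) 0 else ratr (rat_of_code (dnth (dnth z 0) 1))) =
      (fun=> mesh N) :> ('I_(m + 1) -> R).
    by apply/funext => l; rewrite -[dnth z 0]/(cert_code z) tauE rj; case: ifP.
  have tau0 : 0 < rat_of_code (dnth (dnth z 0) 1).
    by rewrite -[dnth z 0]/(cert_code z) tauE invr_gt0 exprn_gt0.
  have L1 : (1 <= dnth (dnth z 0) 2)%N.
    have := @grid_size_gt0 R m m_gt0 _ _ _ _ _ geo (time m).
    by rewrite /grid_size /= addn0 ltnn.
  rewrite /space_time_numbering; split=> //.
    by rewrite [X in grid_box X _]hE.
  by rewrite [X in multilinear_interpolation X _ _ _]hE grid_fun_value.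
- move=> y /box/(_ (time m))/andP[_]; by rewrite /grid_size /= addn0 ltnn.
have [[ut [ux [put pux pde]]] uphi] := usol.
pose E0 : R := 2 ^- (k + Kc).
have E00 : 0 < E0 by rewrite invr_gt0 exprn_gt0.
have Lh0 : 0 <= L%:R * mesh N :> R by rewrite mulr_ge0 // invr_ge0 exprn_ge0.
have nn0 : 0 < 1 + ((m + 1) * n)%:R + Lam by rewrite addr_gt0 ?speed_bound_gt0 // ltr_pwDl.
have sc0 := stab_const_gt0 (m := m) (n := n) data_const_ge0.
have eT' : ratr (cert_e z) * (L%:R * mesh N) <= E0.
  have := eT; rewrite -(ler_rat R) rj -/E0; apply: le_trans.
  have rM (x y : rat) : ratr (x * (1 + y)) = ratr x * (1 + ratr y) :> R.
    by rewrite rmorphM rmorphD rmorph1.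
  have rL : ratr (L%:R * mesh N) = L%:R * mesh N :> R by rewrite rmorphM /= ratr_nat ratr_mesh.
  rewrite rM rL; by rewrite ler_pM2l // lerDr.
have asol := interpolant_approx m_gt0 lM0 lm0 speed_bound_gt0 re (qA j) (qB j) geo al_lM lm_be hf.
have {}asol := asol _ _.
have ini0 x : unit_cube x -> `|f (st_point x 0) - u (st_point x 0)| <= 2 * E0.
  move=> cx; have [hp hpx] := qphi j.
  have i1 : `|f (st_point x 0) - pj j x| <= E0.
    apply: (initial_error m_gt0 geo hf NN (ltW E00) hp _ cx) => c y hc hy.
    by have := ini c y hc hy; rewrite -(ratr_small_initial (R := R)) rj.
  have i2 : `|pj j x - u (st_point x 0)| <= E0.
    rewrite uphi //; apply: (le_trans (hpx x cx)).
    by rewrite -rj -[E0]rj ler_rat.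
  rewrite -(subrK (pj j x) (f _)) -addrA; apply: (le_trans (ler_normD _ _)).
  by rewrite mulr2n mulrDl mul1r lerD.
have del0 : 0 < (1 + ((m + 1) * n)%:R + Lam) * ratr (cert_e z) :> R by rewrite mulr_gt0.
have eps0 : 0 < 2 * E0 by rewrite mulr_gt0.
have := error_lat m_gt0 n_gt0 pA sB data_const_ge0 cA lM0 lm0 LamM Lamm speed_bound_gt0
  put pux pde uc del0 eps0 Lh0 _ ini0.
move=> /(_ _)/wrap[|h].
  apply: asol => [y hy|y y' hy hy'].
    by rewrite -rj ratr_small_residual; exact: res.
  by rewrite ratr_small_oscillation; exact: osc.
apply: (lat_le_weaken h) => //.
rewrite /error_const -[leRHS]mulrA -exprMn.
have M0 : 0 <= 2 ^+ m * (8 * K ^+ 2 + 2) :> R.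
  by rewrite mulr_ge0 ?exprn_ge0 // addr_ge0 // mulr_ge0 // sqr_ge0.
rewrite ler_wpM2l // ler_pXn2r ?nnegrE //.
- rewrite /scale_const [leRHS]mulrDl lerD //.
  rewrite -[leRHS]mulrA -[leLHS]mulrA ler_wpM2l ?(ltW sc0) //.
  by rewrite -mulrA ler_wpM2l // ltW.
- apply: addr_ge0; first exact: ltW.
  by apply: mulr_ge0 => //; apply: mulr_ge0; exact: ltW.
apply: mulr_ge0; last exact: ltW.
by apply: addr_ge0 => //; apply: mulr_ge0; exact: ltW.
Qed.

End Solution.
End Data.
(** The choice of [Kc]: it suffices that 2^-Kc is at most 1 / (X + 1). The inequality is strict
    because fast Cauchy sequences demand strict bounds. *)
Lemma rescaled_precision (X : R) : 0 <= X -> exists Kc, forall k,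
  X * (2 ^- (k + Kc)) ^+ 2 < (2 ^- k) ^+ 2.
Proof.
move=> X0; have X1 : 0 < X + 1 by rewrite ltr_wpDl.
have iX : 0 < (X + 1)^-1 by rewrite invr_gt0.
have [Kc hK] := exp2V_small iX; exists Kc => k.
have p0 : 0 < 2 ^- Kc :> R by rewrite invr_gt0 exprn_gt0.
have p1 : 2 ^- Kc <= 1 :> R by rewrite invf_le1 ?exprn_gt0 // exprn_ege1 // ler1n.
rewrite exprD invfM exprMn mulrCA gtr_pMr; last by rewrite exprn_gt0 // invr_gt0 exprn_gt0.
have h := hK _ (leqnn Kc).
apply: (@le_lt_trans _ _ (X * 2 ^- Kc)).
  by rewrite ler_wpM2l // expr2 ler_piMl // ltW.
apply: (@le_lt_trans _ _ (X / (X + 1))); first by rewrite ler_wpM2l.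
by rewrite ltr_pdivrMr // mul1r ltrDl.
Qed.

Lemma sqrt_ltr (x b : R) : 0 < b -> x < b ^+ 2 -> Num.sqrt x < b.
Proof. by move=> b0 h; rewrite -[ltRHS](ger0_norm (ltW b0)) -sqrtr_sqr ltr_sqrt // exprn_gt0. Qed.

Lemma sL2_norm_ge0 (G : set 'rV[R]_(m + 1)) (v : 'rV[R]_(m + 1) -> 'cV[R]_n) :
  (0 <= sL2_norm G v)%E.
Proof.
apply: (@le_trans _ _ (sqrte (integral_Rd (fun x : 'rV[R]_m =>
  (\1_G (st_point x 0) * enorm (v (st_point x 0)) ^+ 2)%:E)))); first exact: sqrte_ge0.
by apply: ereal_sup_ubound; exists 0.
Qed.

(** Two outputs are compared through their distances to [u], as required of a fast Cauchy sequence.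
    The errors are added on lattices by [lat_leD], before passing to the sL2-norm. *)
Lemma solution_operator_computable Mphi p :
  computable_operator (cauchy_data_rep R m n)
    (fun D => CsL2_rep (n := n) (data_domain D)) (solution_operator Mphi MA p).
Proof.
have sc0 : 0 < scale_const.
  rewrite /scale_const ltr_wpDr // mulr_ge0 ?ltW ?(stab_const_gt0 data_const_ge0) //.
  by rewrite addr_gt0 ?speed_bound_gt0 // ltr_pwDl.
have ec0 : 0 < error_const.
  rewrite /error_const !mulr_gt0 ?exprn_gt0 //.
  by rewrite ltr_wpDl // mulr_ge0 // sqr_ge0.
(* The 8 combines the 2 of [lat_sL2] with the 4 that [lat_leD] yields for two errors of the same
   size. *)
pose X := n%:R * 8 * error_const.
have X0 : 0 <= X by rewrite /X mulr_ge0 ?(ltW ec0) // mulr_ge0.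
have [Kc hKc] := rescaled_precision X0.
have [e he] := cmp_search (@cmpb_check m n Kc) (cmp_cert_code (cmp_proj 1 0)).
exists e => -[[[A B] Nn] phi] u [adm cku usol] q hq.
have hyp := admissible_hyperbolic adm.
have uc : {within correctness_domain A B, continuous u} by case: (p) cku => [|?] [].
have [qA qB [pj qphi]] := data_rep_approx hq.
have found k : exists z, check m n Kc q [:: z; k].
  have [z hz] := certificate_found hyp uc usol qA qB qphi Kc k.
  by exists z; apply/checkP.
have [r tr hr] := he q found; exists r => //; rewrite /CsL2_rep /data_domain /=.
set H := correctness_domain A B.
have /choice[s hs] k : exists f : 'rV[R]_(m + 1) -> 'cV[R]_n, [/\ continuous f, space_time_numbering H (r k) f &
    exists T, (forall y, H y -> y 0 (time m) <= T) /\
    lat_le A B T (spread (fun y => f y - u y)) (error_const * (2 ^- (k + Kc)) ^+ 2)].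
  have [z /checkP hz rz] := hr k.
  have [f [T [cf nf hT hl]]] := certificate_sound hyp uc usol qA qB qphi hz.
  by exists f; split=> //; [rewrite rz|exists T].
have [_ _ _ l0 [LL _]] := hyp.
have lM0 i : 0 < lambda_max A (B i) by have /andP[] := l0 i.
have lm0 i : lambda_min A (B i) < 0 by have /andP[] := l0 i.
have LamM i : lambda_max A (B i) <= Lam by have [] := LL i.
have Lamm i : - lambda_min A (B i) <= Lam by have [] := LL i.
have sc k : {within H, continuous (s k)}.
  by apply: continuous_subspaceT; have [] := hs k.
have L2 (v : 'rV[R]_(m + 1) -> 'cV[R]_n) T c k : {within H, continuous v} ->
    (forall y, H y -> y 0 (time m) <= T) -> 0 < c ->
    c <= 4 * (error_const * (2 ^- (k + Kc)) ^+ 2) -> lat_le A B T (spread v) c ->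
    (sL2_norm H v < (2 ^- k)%:E)%E.
  move=> cv hT c0 hc hl.
  apply: le_lt_trans (lat_sL2 m_gt0 lM0 lm0 LamM Lamm speed_bound_gt0 cv c0 hl hT) _.
  rewrite lte_fin; apply: sqrt_ltr; first by rewrite invr_gt0 exprn_gt0.
  apply: le_lt_trans (hKc k); rewrite /X -!mulrA ler_wpM2l //.
  by apply: (le_trans (ler_wpM2l (ler0n R 2) hc)); rewrite !mulrA -natrM.
have c0 k : 0 < error_const * (2 ^- (k + Kc)) ^+ 2.
  by rewrite mulr_gt0 // exprn_gt0 // invr_gt0 exprn_gt0.
have cB (v w : 'rV[R]_(m + 1) -> 'cV[R]_n) : {within H, continuous v} ->
    {within H, continuous w} -> {within H, continuous (fun y => v y - w y)}.
  by move=> cv cw x; apply: continuousB; [exact: cv|exact: cw].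
split=> //; exists s; split=> [k|k i ki|].
- by split; [exact: sc|have [] := hs k].
- have [_ _ [Ti [hTi li]]] := hs i; have [_ _ [Tk [hTk lk]]] := hs k.
  have ck : error_const * (2 ^- (i + Kc)) ^+ 2 <= error_const * (2 ^- (k + Kc)) ^+ 2.
    rewrite ler_pM2l // ler_pXn2r ?nnegrE ?invr_ge0 ?exprn_ge0 //.
    by rewrite lef_pV2 ?posrE ?exprn_gt0 // ler_eXn2l ?ltr1n // leq_add2r ltnW.
  (* Both times bound the height of the domain, hence so does the smaller one, up to which both
     lattice estimates hold. *)
  have li' := lat_le_weaken (T' := Num.min Ti Tk) li _ ck.
  have lk' := lat_leN (lat_le_weaken (T' := Num.min Ti Tk) lk _ (lexx _)).
  have := lat_leD lM0 lm0 (li' _) (lk' _); rewrite !ge_min !lexx orbT.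
  move=> /(_ isT isT) l.
  set e2 := error_const * _ in l.
  apply: (L2 _ (Num.min Ti Tk) (2 * (e2 + e2)) k (cB _ _ (sc i) (sc k)) _ _ _ _).
  + by move=> y Hy; rewrite le_min hTi ?hTk.
  + by apply: mulr_gt0 => //; apply: addr_gt0; exact: c0.
  + by rewrite -/e2; lra.
  have -> : spread (fun y => s i y - s k y) =
      (fun x t => spread (fun y => s i y - u y) x t + - spread (fun y => s k y - u y) x t).
    apply/funext => x; apply/funext => t; rewrite /spread opprB addrA subrK.
    by [].
  exact: l.
have small k : (sL2_norm H (fun y => s k y - u y)%R < (2 ^- k)%:E)%E.
  have [_ _ [Tk [hTk lk]]] := hs k.
  apply: (L2 _ Tk _ k (cB _ _ (sc k) uc) hTk (c0 k) _ lk).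
  by rewrite ler_peMl ?(ltW (c0 k)) // ler1n.
apply: (@squeeze_cvge _ _ _ _ (fun=> 0%E) _ (fun k => (2 ^- k)%:E)).
- by near=> k; rewrite sL2_norm_ge0 ltW.
- exact: cvg_cst.
apply: cvg_EFin; first by near=> k.
apply/cvgrPdist_le => eps eps0; have [j0 hj] := exp2V_small eps0.
exists j0 => // j /= jj; rewrite sub0r normrN ger0_norm ?hj //.
Unshelve. all: by end_near. Qed.

End Operator.

(** The first conjunct makes the relation [solution_operator] the graph of a partial function with
    values on the domain of the data, so that the second one speaks of an operator. *)
Theorem theorem5p3 (R : realType) (m n Mphi MA p : nat)
    (m_ge1 : (1 <= m)%N) (n_ge1 : (1 <= n)%N)
    (Mphi_gt0 : (0 < Mphi)%N) (MA_gt0 : (0 < MA)%N) (p_ge2 : (2 <= p)%N) :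
  (forall (D : cauchy_data R m n) u v,
     solution_operator Mphi MA p D u -> solution_operator Mphi MA p D v ->
     forall y, data_domain D y -> u y = v y) /\
  computable_operator (cauchy_data_rep R m n)
    (fun D => CsL2_rep (n := n) (data_domain D))
    (solution_operator Mphi MA p).
Proof.
split; last exact: solution_operator_computable.
move=> [[[A B] Nn] phi] u v [adm cu su] [_ cv sv].
have hyp := admissible_hyperbolic n_ge1 MA_gt0 adm.
have Ck0 (f : 'rV[R]_(m + 1) -> 'cV[R]_n) G : Ck p G f -> {within G, continuous f}.
  by case: (p) => [|?] [].
exact: (hyperbolic_unique m_ge1 n_ge1 hyp (Ck0 _ _ cu) (Ck0 _ _ cv) su sv).
Qed.
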